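(* Let $(V,E)$ be a finite, simple, undirected, connected graph with edge weight $w:E\to\mathbb{R}_+$, and let $n\in(0,\infty]$. For any $m_0:V\to\mathbb{R}_+$ there exist $T>0$ and a unique solution $m\in C^{\infty}([0,T)\times V,\mathbb{R}_+)$ to the normalized Bakry-Émery Ricci flow $$\begin{cases}\partial_t m(t,x)=-\mathrm{Ric}_{n,m(t,\cdot)}(x)+\frac{1}{|V|}\sum_{y\in V}\mathrm{Ric}_{n,m(t,\cdot)}(y), & \forall\, x\in V,\\ m(0,x)=m_0(x), & \forall\, x\in V.\end{cases}$$
   Context: $\mathbb{R}_+=(0,\infty)$. The edge weight is symmetric, $w(x,y)=w(y,x)$, and is fixed; the vertex weight $m:V\to\mathbb{R}_+$ varies. Write $y\sim x$ if $\{x,y\}\in E$. For a vertex weight $m$ and $f,g:V\to\mathbb{R}$ define $$\Delta f(x)=\sum_{y\sim x}\frac{w(x,y)}{m(x)}(f(y)-f(x)),\qquad \Gamma(f,g)=\tfrac12\big(\Delta(fg)-f\Delta g-g\Delta f\big),$$ $$\Gamma(f)=\Gamma(f,f),\qquad \Gamma_2(f)=\tfrac12\Delta\Gamma(f)-\Gamma(\Delta f,f).$$ For $x\in V$ and $n\in(0,\infty]$ (with $1/\infty=0$), the Bakry-Émery curvature $\mathrm{Ric}_{n,m}(x)$ is the maximal $K\in\mathbb{R}$ such that $\Gamma_2(f)(x)\ge\frac1n(\Delta f(x))^2+K\,\Gamma(f)(x)$ for all $f:V\to\mathbb{R}$. $C^\infty([0,T)\times V,\mathbb{R}_+)$ denotes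 functions $m:[0,T)\times V\to\mathbb{R}_+$ such that $t\mapsto m(t,x)$ is smooth for every $x\in V$. *)

(* Defs.v *)
From HB Require Import structures.
From mathcomp Require Import all_boot all_order all_algebra.
From mathcomp Require Import all_classical all_reals all_analysis.

Set Implicit Arguments.
Unset Strict Implicit.
Unset Printing Implicit Defensive.

Import Order.TTheory GRing.Theory Num.Theory.
Import numFieldNormedType.Exports.

Local Open Scope classical_set_scope.
Local Open Scope ring_scope.

Section Curvature.
Context {R : realType} {V : finType}.

(* The graph is the relation [e] on [V]; the edge weight is a function of two
   vertices whose values are only used on adjacent pairs. *)
Variables (e : rel V) (w : V -> V -> R).

Definition laplacian (m : V -> R) (f : V -> R) (x : V) : R :=
  \sum_(y | e x y) w x y / m x * (f y - f x).

Definition Gamma (m : V -> R) (f g : V -> R) (x : V) : R :=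
  2^-1 * (laplacian m (f \* g) x - f x * laplacian m g x
          - g x * laplacian m f x).

Definition Gamma2 (m : V -> R) (f : V -> R) (x : V) : R :=
  2^-1 * laplacian m (Gamma m f f) x - Gamma m (laplacian m f) f x.

(* In [\bar R] the inverse of [+oo] is [0], so [fine (n^-1)%E] is 1/n for every
   [n] in (0, +oo]. *)
Definition curvature_dim (n : \bar R) (m : V -> R) (x : V) (K : R) : Prop :=
  forall f : V -> R,
    fine (n^-1)%E * laplacian m f x ^+ 2 + K * Gamma m f f x <= Gamma2 m f x.

Definition is_Ric (n : \bar R) (m : V -> R) (x : V) (K : R) : Prop :=
  curvature_dim n m x K /\ forall L : R, curvature_dim n m x L -> L <= K.

(* The default value 0 is for a vertex without neighbours (which in a connected
   graph means a one-vertex graph): there [Gamma] vanishes and every [K]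
   satisfies the curvature-dimension inequality. *)
Definition Ric (n : \bar R) (m : V -> R) (x : V) : R :=
  xget 0 [set K | is_Ric n m x K].

Lemma RicE (n : \bar R) (m : V -> R) (x : V) (K : R) :
  is_Ric n m x K -> Ric n m x = K.
Proof.
move=> [cdK maxK]; apply: xget_unique => // L [cdL maxL].
by apply/le_anti/andP; split; [exact: maxK|exact: maxL].
Qed.

End Curvature.

Section Smooth.
Context {R : realType}.

(* Derivative relative to a set: one-sided at an endpoint belonging to [A]. *)
Definition is_derive_within (A : set R) (f : R -> R) (t l : R) : Prop :=
  (s - t)^-1 * (f s - f t) @[s --> within A t^'] --> l.

(* [d k] is the k-th derivative of [f] on [A]. *)
Definition smooth_on (A : set R) (f : R -> R) : Prop :=
  exists d : nat -> R -> R,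
    (forall t, A t -> d 0%N t = f t) /\
    (forall k t, A t -> is_derive_within A (d k) t (d k.+1 t)).

End Smooth.

(* A function [0, T) * V -> (0, oo) is represented by a function on [R * V],
   of which only the values at times in [0, T) are constrained. *)
Definition normalized_Ricci_flow {R : realType} {V : finType} (e : rel V)
    (w : V -> V -> R) (n : \bar R) (m0 : V -> R) (T : R) (m : R -> V -> R) :
    Prop :=
  [/\ forall (t : R) (x : V), t \in `[0, T[ -> 0 < m t x,
      forall x : V, smooth_on [set` `[0, T[] (m ^~ x),
      forall (t : R) (x : V), t \in `[0, T[ ->
        is_derive_within [set` `[0, T[] (m ^~ x) t
          (- Ric e w n (m t) x + #|V|%:R^-1 * \sum_(y : V) Ric e w n (m t) y)
    & forall x : V, m 0 x = m0 x].

(* Main.v *)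
Require Import Defs.
From HB Require Import structures.
From mathcomp Require Import all_boot all_order all_algebra.
From mathcomp Require Import all_classical all_reals all_analysis.
From mathcomp Require Import ring lra.

(** Put [a := 1/m].  Up to the factor [2 m(x)], the curvature-dimension
    inequality at [x] says that a quadratic form [M a K] in [f - f x] is psd;
    this form is linear in [(a, K)], and [Ric(x) = kappa(a)] is the largest such
    [K].  [kappa] is locally Lipschitz, which gives uniqueness by Gronwall, but
    it is a smallest eigenvalue and not differentiable.  The solution is
    nevertheless analytic on a one-sided neighbourhood of [0].
    - Along a convergent series [a(t)] the function [kappa(a(t))] has a Taylor
      expansion to every order (symmetric elimination over the valuation ring
      of power series, pivoting on an entry of minimal order), so the flow has
      a formal solution [(a, l)], where [l] is the formal curvature.
    - The form [M a l] has a kernel vector [v] over formal power series, and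
      [v] can be chosen regular enough for the system formed by the flow and by
      [M a l v = 0] to determine [(a, l, v)], beyond a finite order, by a
      recursion [z = c + X h(z)]; hence all these series converge.
    - [kappa(a(t)) <= l(t)] because of the kernel vector, and [M (a(t)) (l(t))]
      is psd because a convergent matrix which is psd up to every power of [t]
      is psd; hence [kappa(a(t)) = l(t)] and [a] is a genuine solution. *)

Set Implicit Arguments.
Unset Strict Implicit.
Unset Printing Implicit Defensive.

Import Order.TTheory GRing.Theory Num.Theory.
Import numFieldNormedType.Exports.

Local Open Scope classical_set_scope.
Local Open Scope ring_scope.

(** * Formal power series *)

(** The obstacle is a circularity: a smallest eigenvalue is smooth along an analytic curve, on each
    side of a point (Rellich), but here the curve is itself produced by that eigenvalue. Only the
    right side of 0 can be described by one series, since another branch may be the smallest one on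
    the left; hence series at 0 are evaluated at [t > 0]. For coefficients there is no circle,
    because the time derivative shifts the order by one. For convergence the equation
    [det (M a l) = 0] is of no help: at a multiple eigenvalue it is degenerate in [l]. A kernel
    vector repairs this. Pairing [M a l v = 0] with a truncation of [v] isolates [l] with the
    coefficient [G(v(0)) > 0], and the other entries of [v] come from a left inverse that loses
    finitely many orders, a loss which a deep enough truncation compensates. Of the graph only three
    facts survive: linearity in [a], a lower bound by [- C G], and definiteness after adding a
    multiple of [G]. The last one is arranged by squares in the coordinates that the curvature at
    [x] does not see. *)

Definition fps (R : realType) := nat -> R.

HB.instance Definition _ (R : realType) := gen_eqMixin (fps R).
HB.instance Definition _ (R : realType) := gen_choiceMixin (fps R).

Section FpsRing.
Context {R : realType}.
Implicit Types f g h : fps R.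

Definition fps_add f g : fps R := fun k => f k + g k.
Definition fps_opp f : fps R := fun k => - f k.
Definition fps_mul f g : fps R := fun k => \sum_(i < k.+1) f i * g (k - i)%N.
Definition fpsC (c : R) : fps R := fun k => if k == 0%N then c else 0.

Lemma fps_addA : associative fps_add.
Proof. by move=> f g h; apply/funext => k; rewrite /fps_add addrA. Qed.
Lemma fps_addC : commutative fps_add.
Proof. by move=> f g; apply/funext => k; rewrite /fps_add addrC. Qed.
Lemma fps_add0 : left_id (fpsC 0) fps_add.
Proof. by move=> f; apply/funext => k; rewrite /fps_add /fpsC if_same add0r. Qed.
Lemma fps_addN : left_inverse (fpsC 0) fps_opp fps_add.
Proof.
by move=> f; apply/funext => k; rewrite /fps_add /fps_opp /fpsC if_same addNr.
Qed.

HB.instance Definition _ :=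
  GRing.isZmodule.Build (fps R) fps_addA fps_addC fps_add0 fps_addN.

Lemma fpsD f g k : (f + g) k = f k + g k. Proof. by []. Qed.
Lemma fpsN f k : (- f) k = - f k. Proof. by []. Qed.
Lemma fpsB f g k : (f - g) k = f k - g k. Proof. by []. Qed.
Lemma fps0 k : (0 : fps R) k = 0. Proof. exact: if_same. Qed.

Lemma fps_sum (I : Type) (r : seq I) (P : pred I) (F : I -> fps R) k :
  (\sum_(i <- r | P i) F i) k = \sum_(i <- r | P i) F i k.
Proof. by apply: (big_morph (fun f : fps R => f k)) => //; rewrite fps0. Qed.

(** A coefficient of a product involves finitely many others, so the ring laws are inherited from
    polynomials through this truncation. *)
Lemma fps_mul_poly f g k N : (k < N)%N ->
  fps_mul f g k = ((\poly_(i < N) f i) * (\poly_(i < N) g i))`_k.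
Proof.
move=> kN; rewrite coefM; apply: eq_bigr => i _; rewrite !coef_poly.
rewrite (leq_ltn_trans _ kN) ?leq_ord// (leq_ltn_trans _ kN) ?leq_subr//.
Qed.

Lemma fps_mulC : commutative fps_mul.
Proof.
by move=> f g; apply/funext => k; rewrite !(fps_mul_poly _ _ (ltnSn k)) mulrC.
Qed.

Lemma coefM_eq (R' : comNzRingType) (p p' q : {poly R'}) k :
  (forall i, (i <= k)%N -> p`_i = p'`_i) -> (p * q)`_k = (p' * q)`_k.
Proof.
by move=> pp'; rewrite !coefM; apply: eq_bigr => i _; rewrite pp' ?leq_ord.
Qed.

Lemma fps_mulA : associative fps_mul.
Proof.
move=> f g h; apply/funext => k.
rewrite !(fps_mul_poly _ _ (ltnSn k)).
rewrite mulrC (@coefM_eq _ _ ((\poly_(i < k.+1) g i) * (\poly_(i < k.+1) h i))); last first.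
  by move=> i ik; rewrite coef_poly ltnS ik (@fps_mul_poly _ _ _ k.+1).
rewrite mulrC mulrA; apply: coefM_eq => i ik.
by rewrite coef_poly ltnS ik (@fps_mul_poly _ _ _ k.+1).
Qed.

Lemma fps_mul1 : left_id (fpsC 1) fps_mul.
Proof.
move=> f; apply/funext => k; rewrite /fps_mul big_ord_recl big1 ?addr0.
  by rewrite /fpsC eqxx mul1r subn0.
by move=> i _; rewrite /fpsC /= mul0r.
Qed.

Lemma fps_mulDl : left_distributive fps_mul fps_add.
Proof.
move=> f g h; apply/funext => k.
by rewrite /fps_mul /fps_add -big_split; apply: eq_bigr => i _; rewrite mulrDl.
Qed.

Lemma fps1_neq0 : fpsC 1 != 0.
Proof.
apply/eqP => /(congr1 (@^~ 0%N)); rewrite fps0 /fpsC eqxx.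
by move/eqP; rewrite oner_eq0.
Qed.

HB.instance Definition _ := GRing.Zmodule_isComNzRing.Build (fps R)
  fps_mulA fps_mulC fps_mul1 fps_mulDl fps1_neq0.

Lemma fpsM f g k : (f * g) k = \sum_(i < k.+1) f i * g (k - i)%N.
Proof. by []. Qed.
Lemma fps1 k : (1 : fps R) k = (k == 0%N)%:R.
Proof. by rewrite {1}/GRing.one /= /fpsC; case: eqP. Qed.
Lemma fpsM0 f g : (f * g) 0%N = f 0%N * g 0%N.
Proof. by rewrite fpsM big_ord1. Qed.
Lemma fpsC0 c : fpsC c 0%N = c. Proof. by []. Qed.

Lemma fpsCM c f k : (fpsC c * f) k = c * f k.
Proof.
rewrite fpsM big_ord_recl big1 ?addr0 ?subn0 // => i _.
by rewrite /fpsC /= mul0r.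
Qed.

Lemma fpsC_is_zmod_morphism : zmod_morphism fpsC.
Proof.
by move=> a b; apply/funext => k; rewrite fpsB /fpsC; case: eqP; rewrite ?subrr.
Qed.
Lemma fpsC_is_monoid_morphism : monoid_morphism fpsC.
Proof.
split=> // a b; apply/funext => k; rewrite fpsCM /fpsC.
by case: eqP; rewrite ?mulr0.
Qed.
HB.instance Definition _ :=
  GRing.isZmodMorphism.Build R (fps R) fpsC fpsC_is_zmod_morphism.
HB.instance Definition _ :=
  GRing.isMonoidMorphism.Build R (fps R) fpsC fpsC_is_monoid_morphism.

Definition fpsX : fps R := fun k => (k == 1%N)%:R.

(* [shf K f] is the quotient of [f] by [X^K], [trf K f] the remainder. *)
Definition shf (K : nat) f : fps R := fun k => f (K + k)%N.
Definition trf (K : nat) f : fps R := fun k => if (k < K)%N then f k else 0.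

Lemma fpsXM f k : (fpsX * f) k = if k is j.+1 then f j else 0.
Proof.
rewrite fpsM; case: k => [|k]; first by rewrite big_ord1 /fpsX mul0r.
rewrite big_ord_recl /fpsX mul0r add0r big_ord_recl mul1r big1 ?addr0.
  by rewrite subSS subn0.
by move=> i _; rewrite mul0r.
Qed.

Lemma fpsXnM K f k :
  (fpsX ^+ K * f) k = if (k < K)%N then 0 else f (k - K)%N.
Proof.
elim: K k => [|K IH] k; first by rewrite mul1r subn0.
rewrite exprS -mulrA fpsXM; case: k => [//|k].
by rewrite IH ltnS subSS.
Qed.

Lemma fpsXnE K k : (fpsX ^+ K) k = (k == K)%:R.
Proof.
rewrite -[X in X k]mulr1 fpsXnM fps1 subn_eq0.
by case: ltngtP.
Qed.

Lemma trf_shf K f : f = trf K f + fpsX ^+ K * shf K f.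
Proof.
apply/funext => k; rewrite fpsD fpsXnM /trf /shf.
by case: ltnP => [|Kk]; rewrite ?addr0 // add0r subnKC.
Qed.

Lemma shf_fpsXn K f : shf K (fpsX ^+ K * f) = f.
Proof. by apply/funext => k; rewrite /shf fpsXnM ltnNge leq_addr addKn. Qed.

Lemma fpsXn_dvd K f : (forall k, (k < K)%N -> f k = 0) ->
  f = fpsX ^+ K * shf K f.
Proof.
move=> f0; rewrite {1}(trf_shf K f); suff -> : trf K f = 0 by rewrite add0r.
by apply/funext => k; rewrite /trf fps0; case: ifP => // /f0.
Qed.

Lemma fpsXnM_lt K f k : (k < K)%N -> (fpsX ^+ K * f) k = 0.
Proof. by rewrite fpsXnM => ->. Qed.

Lemma shfD K f g : shf K (f + g) = shf K f + shf K g. Proof. by []. Qed.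

Lemma shf0 K : shf K 0 = 0.
Proof. by apply/funext => k; rewrite /shf !fps0. Qed.

(* The inverse of [1 - X g] is the geometric series. *)
Lemma fps_unitP f : f 0%N != 0 -> exists g, f * g = 1.
Proof.
move=> f0.
have [h fE] : exists h, fpsC (f 0%N)^-1 * f = 1 - fpsX * h.
  exists (- shf 1 (fpsC (f 0%N)^-1 * f)).
  rewrite mulrN opprK {1}(trf_shf 1 (fpsC _ * f)) expr1; congr (_ + _).
  apply/funext => -[|k]; rewrite /trf //= fps1 ?fpsCM ?mulVf//.
pose g : fps R := fun n => (\sum_(j < n.+1) (fpsX * h) ^+ j) n.
have gE d k : (\sum_(j < (k + d).+1) (fpsX * h) ^+ j) k = g k.
  elim: d => [|d IH]; first by rewrite addn0.
  rewrite addnS big_ord_recr /= fpsD IH exprMn fpsXnM_lt ?addr0//.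
  by rewrite ltnS leq_addr.
exists (fpsC (f 0%N)^-1 * g); rewrite mulrCA mulrA fE.
apply/funext => n.
have -> : ((1 - fpsX * h) * g) n
        = ((1 - fpsX * h) * \sum_(j < n.+1) (fpsX * h) ^+ j) n.
  rewrite !fpsM; apply: eq_bigr => i _; congr (_ * _).
  by rewrite -(gE i) subnK // -ltnS.
have -> : (1 - fpsX * h) * \sum_(j < n.+1) (fpsX * h) ^+ j
    = 1 - (fpsX * h) ^+ n.+1.
  by rewrite -[LHS]opprK -mulNr opprB -subrX1 opprB.
by rewrite fpsB exprMn fpsXnM_lt // subr0.
Qed.

End FpsRing.

(** * Convergent power series *)

Section FpsNorm.
Context {R : realType}.
Implicit Types (f g h : fps R) (r s t : R).

(** Partial sums of a weighted l1 norm: they satisfy the inequalities of a normed algebra before any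
    convergence is known, so a radius can be found by induction on [n]. *)
Definition nrm r n f : R := \sum_(k < n) `|f k| * r ^+ k.

Lemma nrm_ge0 r n f : 0 <= r -> 0 <= nrm r n f.
Proof. by move=> r0; apply: sumr_ge0 => i _; rewrite mulr_ge0 ?exprn_ge0. Qed.

Lemma ler_nrm r n f g : 0 <= r -> (forall k, `|f k| <= `|g k|) ->
  nrm r n f <= nrm r n g.
Proof. by move=> r0 fg; apply: ler_sum => i _; rewrite ler_wpM2r ?exprn_ge0. Qed.

Lemma nrmD r n f g : 0 <= r -> nrm r n (f + g) <= nrm r n f + nrm r n g.
Proof.
move=> r0; rewrite -big_split; apply: ler_sum => i _ /=.
by rewrite -mulrDl ler_wpM2r ?exprn_ge0// ler_normD.
Qed.

Lemma nrmN r n f : nrm r n (- f) = nrm r n f.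
Proof. by apply: eq_bigr => i _; rewrite fpsN normrN. Qed.

Lemma nrmXM r n f : nrm r n.+1 (fpsX * f) = r * nrm r n f.
Proof.
rewrite /nrm big_ord_recl fpsXM normr0 mul0r add0r mulr_sumr.
by apply: eq_bigr => i _; rewrite fpsXM exprS mulrCA.
Qed.

Lemma ler_nrmS r n f : 0 <= r -> nrm r n f <= nrm r n.+1 f.
Proof.
by move=> r0; rewrite /nrm big_ord_recr lerDl mulr_ge0 ?exprn_ge0.
Qed.

Lemma ler_nrm_r r s n f : 0 <= r -> r <= s -> nrm r n f <= nrm s n f.
Proof.
move=> r0 rs; apply: ler_sum => i _; rewrite ler_wpM2l//.
by rewrite lerXn2r ?nnegrE// (le_trans r0).
Qed.

Lemma nrm_poly r n f : nrm r n f = (\poly_(k < n) `|f k|).[r].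
Proof. by rewrite horner_poly. Qed.

Lemma norm_fpsM_le f g n k : (k < n)%N ->
  `|(f * g) k| <= ((\poly_(k < n) `|f k|) * (\poly_(k < n) `|g k|))`_k.
Proof.
move=> kn; rewrite fpsM coefM (le_trans (ler_norm_sum _ _ _))//.
apply: ler_sum => i _; rewrite !coef_poly normrM.
by rewrite (leq_ltn_trans _ kn) ?leq_ord// (leq_ltn_trans _ kn) ?leq_subr.
Qed.

Lemma horner_normM r f g n :
  nrm r n f * nrm r n g = \sum_(k < (n + n).+1)
    ((\poly_(k < n) `|f k|) * (\poly_(k < n) `|g k|))`_k * r ^+ k.
Proof.
rewrite !nrm_poly -hornerM (@horner_coef_wide _ (n + n).+1)//.
apply: (leq_trans (size_polyMleq _ _)).
apply: (leq_trans (leq_pred _)); apply: leqW.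
by apply: leq_add; exact: size_poly.
Qed.

Lemma coef_normM_ge0 f g n k :
  0 <= ((\poly_(k < n) `|f k|) * (\poly_(k < n) `|g k|))`_k.
Proof.
rewrite coefM; apply: sumr_ge0 => i _; rewrite !coef_poly.
by rewrite mulr_ge0//; case: ifP.
Qed.

Lemma nrmM r n f g : 0 <= r -> nrm r n (f * g) <= nrm r n f * nrm r n g.
Proof.
move=> r0; rewrite horner_normM -addnS big_split_ord /= ler_wpDr//.
  by apply: sumr_ge0 => i _; rewrite mulr_ge0 ?exprn_ge0 ?coef_normM_ge0.
apply: ler_sum => i _; rewrite ler_wpM2r ?exprn_ge0//.
exact: norm_fpsM_le.
Qed.

Definition convr r f := exists C, forall n, nrm r n f <= C.
Definition conv f := exists2 r : R, 0 < r & convr r f.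

Lemma convr_le r s f : 0 <= r -> r <= s -> convr s f -> convr r f.
Proof.
by move=> r0 rs [C fC]; exists C => n; rewrite (le_trans _ (fC n)) ?ler_nrm_r.
Qed.

Lemma convrD r f g : 0 <= r -> convr r f -> convr r g -> convr r (f + g).
Proof.
move=> r0 [C fC] [D gD]; exists (C + D) => n.
by rewrite (le_trans (nrmD _ _ _ r0))// lerD.
Qed.

Lemma convrN r f : convr r f -> convr r (- f).
Proof. by move=> [C fC]; exists C => n; rewrite nrmN. Qed.

Lemma convrM r f g : 0 <= r -> convr r f -> convr r g -> convr r (f * g).
Proof.
move=> r0 [C fC] [D gD]; exists (C * D) => n.
by rewrite (le_trans (nrmM _ _ _ r0))// ler_pM ?nrm_ge0.
Qed.

Lemma convr_fin r f K : 0 <= r -> (forall k, (K <= k)%N -> f k = 0) ->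
  convr r f.
Proof.
move=> r0 f0; exists (nrm r K f) => n.
have [nK|Kn] := leqP n K.
  elim: K {f0} nK => [|K IH]; first by rewrite leqn0 => /eqP ->.
  rewrite leq_eqVlt ltnS => /predU1P[-> //|/IH /le_trans -> //].
  exact: ler_nrmS.
rewrite -(subnKC (ltnW Kn)) /nrm big_split_ord /= gerDl big1// => i _.
by rewrite f0 ?leq_addr// normr0 mul0r.
Qed.

Lemma convr_fpsC r c : 0 <= r -> convr r (fpsC c).
Proof. by move=> r0; apply: (@convr_fin _ _ 1) => // -[]. Qed.

Lemma convr_shf r K f : 0 < r -> convr r f -> convr r (shf K f).
Proof.
move=> r0 [C fC]; exists (C / r ^+ K) => n.
rewrite ler_pdivlMr ?exprn_gt0// (le_trans _ (fC (K + n)%N))//.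
rewrite /nrm big_split_ord /= mulr_suml ler_wpDl//.
  by apply: sumr_ge0 => i _; rewrite mulr_ge0 ?exprn_ge0 ?(ltW r0).
by apply: ler_sum => i _; rewrite /shf -mulrA exprD (mulrC (r ^+ i)).
Qed.

Lemma convr_trf_shf r K f : 0 <= r -> convr r (shf K f) -> convr r f.
Proof.
move=> r0 fC; rewrite (trf_shf K f); apply: convrD => //.
  by apply: (@convr_fin _ _ K) => // k Kk; rewrite /trf ltnNge Kk.
apply: convrM => //; apply: (@convr_fin _ _ K.+1) => // k Kk.
by rewrite fpsXnE gtn_eqF.
Qed.

Lemma conv2 f g (P : R -> Prop) : conv f -> conv g ->
  (forall r, 0 < r -> convr r f -> convr r g -> P r) -> exists2 r : R, 0 < r & P r.
Proof.
move=> [r r0 cf] [s s0 cg] H; exists (Num.min r s); first by rewrite lt_min r0.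
apply: H; first by rewrite lt_min r0.
- by apply: convr_le cf; rewrite ?ge_min ?lexx// le_min !ltW.
- by apply: convr_le cg; rewrite ?ge_min ?lexx ?orbT// le_min !ltW.
Qed.

Lemma convD f g : conv f -> conv g -> conv (f + g).
Proof.
by move=> cf cg; apply: (conv2 cf cg) => r /ltW r0 *; apply: convrD.
Qed.

Lemma convN f : conv f -> conv (- f).
Proof. by move=> [r r0 cf]; exists r => //; apply: convrN. Qed.

Lemma convB f g : conv f -> conv g -> conv (f - g).
Proof. by move=> cf cg; apply: convD => //; apply: convN. Qed.

Lemma convM f g : conv f -> conv g -> conv (f * g).
Proof.
by move=> cf cg; apply: (conv2 cf cg) => r /ltW r0 *; apply: convrM.
Qed.

Lemma conv_fin f K : (forall k, (K <= k)%N -> f k = 0) -> conv f.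
Proof. by move=> f0; exists 1 => //; apply: (convr_fin ler01 f0). Qed.

Lemma conv_fpsC c : conv (fpsC c).
Proof. by exists 1 => //; apply: convr_fpsC. Qed.

Lemma conv_fpsXn K : conv (fpsX ^+ K).
Proof. by apply: (@conv_fin _ K.+1) => // k Kk; rewrite fpsXnE gtn_eqF. Qed.

Lemma conv_shf K f : conv f -> conv (shf K f).
Proof. by move=> [r r0 cf]; exists r => //; apply: convr_shf. Qed.

Lemma conv_trf K f : conv (trf K f).
Proof. by apply: (@conv_fin _ K) => // k Kk; rewrite /trf ltnNge Kk. Qed.

Lemma conv0 : conv 0.
Proof. by apply: (@conv_fin _ 0) => k _; rewrite fps0. Qed.

Lemma conv_sum (I : Type) (r : seq I) (F : I -> fps R) :
  (forall i, conv (F i)) -> conv (\sum_(i <- r) F i).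
Proof. by move=> cF; apply: big_ind => //; [exact: conv0|exact: convD]. Qed.

Definition ev f t : R := limn (pseries f t).

Lemma cvg_norm_pseries r f t : `|t| <= r -> convr r f ->
  cvgn [normed (series (fun k => f k * t ^+ k))].
Proof.
move=> tr [C fC]; apply: nondecreasing_is_cvgn.
  by apply: nondecreasing_series => i _ _ /=.
exists C => _ [n _ <-]; rewrite /= /series /= big_mkord (le_trans _ (fC n))//.
apply: ler_sum => i _; rewrite normrM normrX ler_wpM2l//.
by rewrite lerXn2r ?nnegrE// (le_trans _ tr).
Qed.

Lemma cvg_pseries r f t : `|t| <= r -> convr r f -> cvgn (pseries f t).
Proof. by move=> tr fr; apply: normed_cvg; exact: cvg_norm_pseries tr fr. Qed.

Lemma cvg_ev r f t : `|t| <= r -> convr r f -> pseries f t @ \oo --> ev f t.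
Proof. exact: cvg_pseries. Qed.

Lemma norm_ev_le r f t C : `|t| <= r -> (forall n, nrm r n f <= C) ->
  `|ev f t| <= C.
Proof.
move=> tr fC; have fr : convr r f by exists C.
have cv : (fun n => `|pseries f t n|) @ \oo --> `|ev f t|.
  by apply: cvg_norm; apply: cvg_ev tr fr.
apply: (cvgr_to_le cv); near=> n.
rewrite /pseries /series /= big_mkord (le_trans (ler_norm_sum _ _ _))//.
rewrite (le_trans _ (fC n))//; apply: ler_sum => i _.
by rewrite normrM normrX ler_wpM2l// lerXn2r ?nnegrE// (le_trans _ tr).
Unshelve. all: by end_near. Qed.

Lemma evD r f g t : `|t| <= r -> convr r f -> convr r g ->
  ev (f + g) t = ev f t + ev g t.
Proof.
move=> tr fr gr; apply: cvg_lim => //.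
rewrite (_ : pseries (f + g) t = pseries f t + pseries g t).
  by apply: cvgD; apply: cvg_ev tr _.
apply/funext => n; rewrite /pseries /series /= [RHS]/GRing.add /= -big_split.
by apply: eq_bigr => i _; rewrite /= fpsD mulrDl.
Qed.

Lemma evN r f t : `|t| <= r -> convr r f -> ev (- f) t = - ev f t.
Proof.
move=> tr fr; apply: cvg_lim => //.
rewrite (_ : pseries (- f) t = - pseries f t).
  by apply: cvgN; apply: cvg_ev tr _.
apply/funext => n; rewrite /pseries /series /= [RHS]/GRing.opp /= -sumrN.
by apply: eq_bigr => i _; rewrite /= fpsN mulNr.
Qed.

Lemma ev_fin f t K : (forall k, (K <= k)%N -> f k = 0) ->
  ev f t = \sum_(k < K) f k * t ^+ k.
Proof.
move=> f0; apply: cvg_lim => //; apply: cvg_near_cst; near=> n.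
have Kn : (K <= n)%N by near: n; exact: nbhs_infty_ge.
rewrite /pseries /series /= big_mkord -(subnKC Kn) big_split_ord /=.
by rewrite [X in _ + X]big1 ?addr0// => i _; rewrite f0 ?leq_addr// mul0r.
Unshelve. all: by end_near. Qed.

Lemma ev_fpsC c t : ev (fpsC c) t = c.
Proof.
by rewrite (@ev_fin _ _ 1) ?big_ord1 ?expr0 ?mulr1// => -[].
Qed.

Lemma ev_fpsXn K t : ev (fpsX ^+ K) t = t ^+ K.
Proof.
rewrite (@ev_fin _ _ K.+1) => [|k Kk]; last by rewrite fpsXnE gtn_eqF.
rewrite big_ord_recr big1 /= ?fpsXnE ?eqxx ?mul1r ?add0r// => i _.
by rewrite fpsXnE ltn_eqF ?mul0r.
Qed.

Lemma ev0 f : ev f 0 = f 0%N.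
Proof.
apply: cvg_lim => //; apply: cvg_near_cst; near=> n.
have : (0 < n)%N by near: n; exact: nbhs_infty_gt.
rewrite /pseries /series /= big_mkord => n0.
rewrite -(prednK n0) big_ord_recl.
by rewrite expr0 mulr1 big1 ?addr0// => i _; rewrite exprS mul0r mulr0.
Unshelve. all: by end_near. Qed.

(** The truncated product and the product of the truncations differ only in degrees at least [n].
    There the coefficients are controlled by the norms at [r], which gives the error
    [C D (|t| / r)^n]; hence the strict inequality on [t]. *)
Lemma evM r f g t : `|t| < r -> convr r f -> convr r g ->
  ev (f * g) t = ev f t * ev g t.
Proof.
move=> tr fr gr; have r0 : 0 < r by exact: le_lt_trans tr.
have [C fC] := fr; have [D gD] := gr.
have cfg : pseries f t \* pseries g t @ \oo --> ev f t * ev g t.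
  by apply: cvgM; [apply: cvg_ev fr|apply: cvg_ev gr]; exact: ltW.
apply: cvg_lim => //; apply: cvg_sub0 cfg.
apply: (@squeeze_cvgr _ _ _ _ (fun n => - geometric (C * D) (`|t| / r) n)
  (geometric (C * D) (`|t| / r))); last first.
- by apply: cvg_geometric; rewrite normrM normfV normr_id (gtr0_norm r0)
    ltr_pdivrMr// mul1r.
- rewrite -[X in _ --> X]oppr0; apply: cvgN.
  by apply: cvg_geometric; rewrite normrM normfV normr_id (gtr0_norm r0)
    ltr_pdivrMr// mul1r.
near=> n; rewrite -ler_norml.
have psE h : pseries h t n = (\poly_(k < n) h k).[t].
  by rewrite horner_poly /pseries /series /= big_mkord.
have -> : (pseries (f * g) t - pseries f t \* pseries g t) n
    = pseries (f * g) t n - pseries f t n * pseries g t n by [].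
rewrite !psE -hornerM (@horner_coef_wide _ (n + n).+1 (_ * _)); last first.
  apply: (leq_trans (size_polyMleq _ _)); apply: (leq_trans (leq_pred _)).
  by apply: leqW; apply: leq_add; exact: size_poly.
rewrite horner_poly -addnS big_split_ord /= opprD addrA.
rewrite [X in X - _](_ : _ = 0) ?sub0r; last first.
  apply/eqP; rewrite subr_eq0; apply/eqP; apply: eq_bigr => i _.
  by rewrite [(f * g) i](@fps_mul_poly _ _ _ _ n).
rewrite normrN (le_trans (ler_norm_sum _ _ _))//.
rewrite (@le_trans _ _ (nrm r n f * nrm r n g * (`|t| / r) ^+ n))//; last first.
  rewrite /geometric /= ler_wpM2r ?exprn_ge0 ?divr_ge0 ?(ltW r0)//.
  by rewrite ler_pM ?nrm_ge0 ?(ltW r0).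
rewrite horner_normM mulr_suml -[in leRHS]addnS big_split_ord /= ler_wpDl//.
  apply: sumr_ge0 => i _; rewrite !mulr_ge0 ?coef_normM_ge0 ?exprn_ge0 ?(ltW r0)//.
  by rewrite divr_ge0 ?(ltW r0).
apply: ler_sum => i _; rewrite normrM normrX -mulrA ler_pM//.
  rewrite !coefM (le_trans (ler_norm_sum _ _ _))//; apply: ler_sum => j _.
  rewrite !coef_poly normrM; case: ifP; case: ifP; rewrite ?normr0//.
have -> : `|t| = `|t| / r * r by rewrite divfK// gt_eqF.
set q := `|t| / r; have q0 : 0 <= q by rewrite divr_ge0 // ltW.
rewrite mulfK ?gt_eqF// exprMn mulrC ler_wpM2l ?exprn_ge0 ?(ltW r0)//.
rewrite exprD ler_piMr ?exprn_ge0// exprn_ile1//.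
by rewrite ler_pdivrMr // mul1r ltW.
Unshelve. all: by end_near. Qed.
End FpsNorm.

(** * One-sided germs at 0 *)

Section NearZero.
Context {R : realType}.
Implicit Types (f g : fps R) (t : R).
Local Notation "0+" := ((0 : R)^'+).

Lemma filterS4 (T : Type) (F : set_system T) {FF : Filter F} (P1 P2 P3 P4 Q : T -> Prop) :
  (forall x, P1 x -> P2 x -> P3 x -> P4 x -> Q x) ->
  F P1 -> F P2 -> F P3 -> F P4 -> F Q.
Proof.
move=> H F1 F2 F3 F4; apply: filterS3 F1 F2 (filterI F3 F4) => x p1 p2 [p3 p4].
exact: H.
Qed.

Lemma near0_gt : \forall t \near 0+, 0 < t.
Proof. exact: nbhs_right_gt. Qed.

Lemma near0_lt (c : R) : 0 < c -> \forall t \near 0+, t < c.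
Proof. by move=> c0; apply: nbhs_right_lt. Qed.

Lemma near_norm_lt (c : R) : 0 < c -> \forall t \near 0+, `|t| < c.
Proof.
move=> c0; move: near0_gt (near0_lt c0); apply: filterS2 => t t0 tc.
by rewrite gtr0_norm.
Qed.

Lemma near_mul_lt (C c : R) : 0 < c -> \forall t \near 0+, C * t < c.
Proof.
move=> c0; have d0 : 0 < c / (`|C| + 1) by rewrite divr_gt0// ltr_wpDl.
move: near0_gt (near0_lt d0); apply: filterS2 => t t0.
rewrite ltr_pdivlMr ?ltr_wpDl// => tc; apply: le_lt_trans tc.
by rewrite mulrC ler_wpM2l ?(ltW t0)// ler_wpDr// ler_norm.
Qed.

Lemma near_ge0_cst (a C : R) : (\forall t \near 0+, 0 <= a + C * t) -> 0 <= a.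
Proof.
move=> H; rewrite leNgt; apply/negP => a0.
have : \forall t \near 0+, False.
  have na0 : 0 < - a by rewrite oppr_gt0.
  move: H (near_mul_lt C na0); apply: filterS2 => t; lra.
by move=> /filter_ex [].
Qed.

Lemma convN_all (I : finType) (F : I -> fps R) : (forall i, conv (F i)) ->
  exists2 r : R, 0 < r & forall i, convr r (F i).
Proof.
move=> cF; have /choice[r rP] : forall i, exists r, 0 < r /\ convr r (F i).
  by move=> i; have [r] := cF i; exists r.
exists (\big[Num.min/1]_i r i).
  by apply: lt_bigmin => // i _; have [] := rP i.
move=> i; have [ri0 cri] := rP i; apply: convr_le cri; last exact: bigmin_le_cond.
by apply/ltW; apply: lt_bigmin => // j _; have [] := rP j.
Qed.

Lemma near_evD f g : conv f -> conv g ->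
  \forall t \near 0+, ev (f + g) t = ev f t + ev g t.
Proof.
move=> cf cg; have [r r0] := conv2 cf cg (fun r _ cf cg => conj cf cg).
move=> -[fr gr]; apply: filterS (near_norm_lt r0) => t /ltW tr.
exact: evD tr fr gr.
Qed.

Lemma near_evN f : conv f -> \forall t \near 0+, ev (- f) t = - ev f t.
Proof.
move=> [r r0 fr]; apply: filterS (near_norm_lt r0) => t /ltW tr.
exact: evN tr fr.
Qed.

Lemma near_evB f g : conv f -> conv g ->
  \forall t \near 0+, ev (f - g) t = ev f t - ev g t.
Proof.
move=> cf cg; move: (near_evD cf (convN cg)) (near_evN cg).
by apply: filterS2 => t -> ->.
Qed.

Lemma near_evM f g : conv f -> conv g ->
  \forall t \near 0+, ev (f * g) t = ev f t * ev g t.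
Proof.
move=> cf cg; have [r r0] := conv2 cf cg (fun r _ cf cg => conj cf cg).
move=> -[fr gr]; apply: filterS (near_norm_lt r0) => t tr.
exact: evM tr fr gr.
Qed.

Lemma near_all (I : finType) (P : I -> R -> Prop) :
  (forall i, \forall t \near 0+, P i t) -> \forall t \near 0+, forall i, P i t.
Proof.
move=> H; have : \forall t \near 0+, forall i, i \in enum I -> P i t.
  elim: (enum I) => [|i s IH]; first by apply: filterS near0_gt => t _ i.
  move: (H i) IH; apply: filterS2 => t Pi Ps j; rewrite inE => /predU1P[->//|].
  exact: Ps.
by apply: filterS => t Pt i; apply: Pt; rewrite mem_enum.
Qed.

Lemma near_ev_sum (I : finType) (F : I -> fps R) : (forall i, conv (F i)) ->
  \forall t \near 0+, ev (\sum_i F i) t = \sum_i ev (F i) t.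
Proof.
move=> cF; elim: (index_enum I) => [|i s IH].
  by apply: filterS near0_gt => t _; rewrite !big_nil -(rmorph0 fpsC) ev_fpsC.
move: IH (near_evD (cF i) (conv_sum s cF)); apply: filterS2 => t IH.
by rewrite !big_cons => ->; rewrite IH.
Qed.

Lemma near_ev_bound f : conv f ->
  exists2 C : R, 0 < C & \forall t \near 0+, `|ev f t| <= C.
Proof.
move=> [r r0 [C fC]]; exists (`|C| + 1); first by rewrite ltr_wpDl.
apply: filterS (near_norm_lt r0) => t /ltW tr.
by rewrite (le_trans (norm_ev_le tr fC))// ler_wpDr// ler_norm.
Qed.

Lemma near_ev_shf K f : conv f ->
  \forall t \near 0+, ev f t = ev (trf K f) t + t ^+ K * ev (shf K f) t.
Proof.
move=> cf; have cX := @conv_fpsXn R K; have cs := conv_shf K cf.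
move: (near_evD (conv_trf K f) (convM cX cs)) (near_evM cX cs).
by apply: filterS2 => t; rewrite -trf_shf => -> ->; rewrite ev_fpsXn.
Qed.

Lemma near_ev_trf K f : conv f ->
  exists2 C : R, 0 < C & \forall t \near 0+, `|ev f t - ev (trf K f) t| <= C * t ^+ K.
Proof.
move=> cf; have [C C0 HC] := near_ev_bound (conv_shf K cf); exists C => //.
move: near0_gt HC (near_ev_shf K cf); apply: filterS3 => t t0 HC ->.
rewrite addrC addKr mulrC normrM normrX (gtr0_norm t0).
by rewrite ler_wpM2r// exprn_ge0// ltW.
Qed.

Lemma near_ev_cst f : conv f ->
  exists2 C : R, 0 < C & \forall t \near 0+, `|ev f t - f 0%N| <= C * t.
Proof.
move=> cf; have [C C0 HC] := near_ev_trf 1 cf; exists C => //.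
apply: filterS HC => t; rewrite expr1 (@ev_fin _ (trf 1 f) _ 1) ?big_ord1 ?expr0 ?mulr1//.
by move=> [|k].
Qed.

Lemma near_ev_pos f : conv f -> 0 < f 0%N ->
  \forall t \near 0+, f 0%N / 2 <= ev f t.
Proof.
move=> cf f0; have [C C0 HC] := near_ev_cst cf.
have f20 : 0 < f 0%N / 2 by rewrite divr_gt0.
move: HC (near_mul_lt C f20); apply: filterS2 => t.
by rewrite ler_norml => /andP[H _] ?; lra.
Qed.

(** The valuation of a finite family: an entry attaining it divides all others, so it can serve as a
    pivot over the power series. *)
Lemma min_order (I : finType) (F : I -> fps R) :
  (forall i, F i = 0) \/ exists e, (exists i, F i e <> 0) /\
    forall i, F i = fpsX ^+ e * shf e (F i).
Proof.
have [[e eP]|H] := pselect (exists e, [exists i, F i e != 0]); last first.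
  left => i; apply/funext => e; rewrite fps0; apply/eqP/negPn/negP => Fie.
  by apply: H; exists e; apply/existsP; exists i.
right; have eex : exists e, [exists i, F i e != 0] by exists e.
case: (ex_minnP eex) => {eex eP}e /existsP[i /eqP Fie] emin; exists e; split.
  by exists i.
move=> j; apply: fpsXn_dvd => k ke; apply/eqP/negPn/negP => Fjk.
have /emin : [exists i, F i k != 0] by apply/existsP; exists j.
by rewrite leqNgt ke.
Qed.

End NearZero.

(** * Bilinear forms and symmetric elimination over a commutative ring *)

Section Forms.
Context {V : finType}.

Section Ring.
Context {S : comNzRingType}.
Implicit Types (M : V -> V -> S) (f g : V -> S).

Definition mv M f (i : V) : S := \sum_j M i j * f j.
Definition bil M f g : S := \sum_i f i * mv M g i.
Definition qf M f : S := bil M f f.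
Definition delta (i j : V) : S := (j == i)%:R.
Definition msym M := forall i j, M i j = M j i.

Lemma mv_lin M (a b : S) f g i :
  mv M (fun j => a * f j + b * g j) i = a * mv M f i + b * mv M g i.
Proof.
rewrite /mv !mulr_sumr -big_split; apply: eq_bigr => j _ /=; ring.
Qed.

Lemma bil_lin M (a b : S) f g h :
  bil M h (fun j => a * f j + b * g j) = a * bil M h f + b * bil M h g.
Proof.
rewrite /bil !mulr_sumr -big_split; apply: eq_bigr => j _ /=.
rewrite mv_lin; ring.
Qed.

Lemma bilC M f g : msym M -> bil M f g = bil M g f.
Proof.
move=> sM; rewrite /bil /mv.
under eq_bigr do rewrite mulr_sumr.
rewrite exchange_big; apply: eq_bigr => j _; rewrite mulr_sumr.
by apply: eq_bigr => i _; rewrite sM; ring.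
Qed.

Lemma sum_delta (F : V -> S) i : \sum_j F j * delta i j = F i.
Proof.
rewrite (bigD1 i)//= /delta eqxx mulr1 big1 ?addr0// => j /negbTE ->.
by rewrite mulr0.
Qed.

Lemma mv_delta M i j : mv M (delta j) i = M i j.
Proof. exact: sum_delta. Qed.

Lemma bil_delta M i f : bil M (delta i) f = mv M f i.
Proof. by rewrite /bil; under eq_bigr do rewrite mulrC; rewrite sum_delta. Qed.

Lemma qf_lin M (a b : S) f g : msym M ->
  qf M (fun j => a * f j + b * g j)
  = a ^+ 2 * qf M f + 2 * (a * b) * bil M f g + b ^+ 2 * qf M g.
Proof.
move=> sM; rewrite /qf bil_lin; set h := fun _ => _.
rewrite (bilC h f)// (bilC h g)// /h !bil_lin (bilC g f)//; ring.
Qed.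

Lemma qf_matlin (M N : V -> V -> S) (a b : S) f :
  qf (fun i j => a * M i j + b * N i j) f = a * qf M f + b * qf N f.
Proof.
rewrite /qf /bil !mulr_sumr -big_split; apply: eq_bigr => i _ /=.
have -> : mv (fun i j => a * M i j + b * N i j) f i
    = a * mv M f i + b * mv N f i.
  by rewrite /mv !mulr_sumr -big_split; apply: eq_bigr => j _ /=; ring.
ring.
Qed.

(* Elimination of the coordinate [i]: the matrix of [G] after the substitution
   [v := u v - (b . v) delta_i]. *)
Definition pivot_form (u : S) (b : V -> S) (i : V) M : V -> V -> S := fun j l =>
  u ^+ 2 * M j l - u * b j * M i l - u * b l * M j i + b j * b l * M i i.

Definition pivot_subst (u : S) (b : V -> S) (i : V) f : V -> S :=
  fun j => u * f j - (\sum_l b l * f l) * delta i j.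

Lemma qf_pivot_form u b i M f : qf (pivot_form u b i M) f = qf M (pivot_subst u b i f).
Proof.
set s := \sum_l b l * f l.
have mvE j : mv (pivot_form u b i M) f j
    = u * (u * mv M f j - s * M j i) - b j * (u * mv M f i - s * M i i).
  rewrite /mv /s !mulr_suml !mulr_sumr.
  rewrite -!sumrB !mulr_sumr -sumrB; apply: eq_bigr => l _; rewrite /pivot_form; ring.
have mvT j : mv M (pivot_subst u b i f) j = u * mv M f j - s * M j i.
  rewrite -mv_delta -mulNr -mv_lin; apply: eq_bigr => l _.
  by rewrite /pivot_subst -/s mulNr.
rewrite /qf /bil; under eq_bigr do rewrite mvE -!mvT.
have eE j : pivot_subst u b i f j = u * f j - s * delta i j by [].
move: (pivot_subst u b i f) eE {mvE mvT} => E eE.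
under [RHS]eq_bigr do rewrite [X in X * _]eE.
transitivity (u * (\sum_j f j * mv M E j) - s * mv M E i).
  rewrite /s mulr_sumr mulr_suml -sumrB.
  by apply: eq_bigr => j _; ring.
rewrite -[mv M E i](sum_delta (mv M E)) !mulr_sumr -sumrB.
by apply: eq_bigr => j _; ring.
Qed.

End Ring.
End Forms.

(** * Quadratic forms *)

Section RealForms.
Context {R : realType} {V : finType}.
Implicit Types (M G : V -> V -> R) (f g : V -> R) (B : V -> V -> fps R).
Local Notation "0+" := ((0 : R)^'+).

Definition psd M := forall f, 0 <= qf M f.
Definition sqn f : R := \sum_j f j ^+ 2.

Lemma sqn_ge0 f : 0 <= sqn f.
Proof. by apply: sumr_ge0 => j _; rewrite sqr_ge0. Qed.

Lemma ler_sqn f i : f i ^+ 2 <= sqn f.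
Proof.
by rewrite /sqn (bigD1 i)//= lerDl sumr_ge0// => j _; rewrite sqr_ge0.
Qed.

Lemma ler_sqn2 f i j : `|f i * f j| <= sqn f.
Proof.
have : `|f i * f j| * 2 <= f i ^+ 2 + f j ^+ 2.
  by rewrite normrM -(real_normK (num_real (f i))) -(real_normK (num_real (f j)));
    have := sqr_ge0 (`|f i| - `|f j|); nra.
by have := ler_sqn f i; have := ler_sqn f j; lra.
Qed.

Lemma norm_qf M f : `|qf M f| <= (\sum_i \sum_j `|M i j|) * sqn f.
Proof.
rewrite (le_trans (ler_norm_sum _ _ _))// mulr_suml; apply: ler_sum => i _.
rewrite /mv mulr_sumr (le_trans (ler_norm_sum _ _ _))// mulr_suml.
apply: ler_sum => j _; rewrite mulrCA normrM ler_wpM2l// ler_sqn2//.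
Qed.

Lemma discriminant_le (a b c : R) :
  (forall s, 0 <= a + 2 * s * b + s ^+ 2 * c) -> b ^+ 2 <= a * c.
Proof.
move=> H; have [c0|c0|c0] := ltgtP c 0.
(* For [c < 0] two opposite values of [s] are added, which cancels the linear term; they are large
   enough for the sum to be negative. *)
- have := H (1 + (`|a| + 1) / - c); have := H (- (1 + (`|a| + 1) / - c)).
  set q := _ / _ => H1 H2.
  have qc : q * c = - (`|a| + 1) by rewrite /q; field; lra.
  have q0 : 0 < q by rewrite divr_gt0 ?oppr_gt0// ltr_wpDl.
  have sc : (1 + q) ^+ 2 * c = (1 + q) * (c - (`|a| + 1)).
    by transitivity ((1 + q) * (c + q * c)); [ring|rewrite qc].
  have aa := ler_norm a; have a0 := normr_ge0 a.
  have : (1 + q) * (c - (`|a| + 1)) < - `|a| by nra.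
  by move: H1 H2; rewrite sqrrN !sc; lra.
- have := H (- b / c); rewrite (_ : _ + _ = a - b ^+ 2 / c); last by field; lra.
  by rewrite subr_ge0 ler_pdivrMr.
- rewrite c0 mulr0; have [->|b0] := eqVneq b 0; first by rewrite expr0n.
  have := H (- (a + 1) / (2 * b)); rewrite c0 mulr0 addr0.
  by rewrite (_ : _ + _ = -1); [lra|field].
Qed.

Lemma psd_CS M f g : msym M -> psd M -> bil M f g ^+ 2 <= qf M f * qf M g.
Proof.
move=> sM pM; apply: discriminant_le => s.
have := pM (fun j => 1 * f j + s * g j); rewrite qf_lin//.
by rewrite expr1n !mul1r.
Qed.

Lemma qf_delta M i : qf M (delta i) = M i i.
Proof. by rewrite /qf bil_delta mv_delta. Qed.

Lemma psd_diag_gt0 M i j : msym M -> psd M -> M i j != 0 -> 0 < M i i.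
Proof.
move=> sM pM Mij; have := psd_CS (delta i) (delta j) sM pM.
rewrite bil_delta mv_delta !qf_delta lt_def.
have := pM (delta i); rewrite qf_delta => -> H; rewrite andbT.
apply/eqP => Mii; move: H; rewrite Mii mul0r leNgt => /negP; apply.
by rewrite lt_def sqr_ge0 sqrf_eq0 Mij.
Qed.

(* Cauchy-Schwarz in the other direction: a psd matrix almost annihilates the
   vectors on which its form is small. *)
Lemma psd_mv M f i : msym M -> psd M -> mv M f i ^+ 2 <= M i i * qf M f.
Proof.
by move=> sM pM; have := psd_CS (delta i) f sM pM; rewrite bil_delta qf_delta.
Qed.

(** Expansion of [qf M] at [u f], which is the substituted vector plus a multiple of [delta i]. The
    row [b] is independent of [M], so that a substitution built from [B] can be applied to [G]. *)
Lemma pivot_form_decomp M (u : R) b i f : msym M -> 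
  u ^+ 2 * qf M f = qf M (pivot_subst u b i f)
    + 2 * (\sum_l b l * f l) * mv M (pivot_subst u b i f) i
    + (\sum_l b l * f l) ^+ 2 * M i i.
Proof.
move=> sM; set s := \sum_l _.
have -> : u ^+ 2 * qf M f = qf M (fun j => u * f j + 0 * f j).
  by rewrite qf_lin//; ring.
have -> : qf M (fun j => u * f j + 0 * f j)
    = qf M (fun j => 1 * pivot_subst u b i f j + s * delta i j).
  by congr qf; apply/funext => j; rewrite /pivot_subst -/s; ring.
by rewrite qf_lin// (bilC _ _ sM) bil_delta qf_delta; ring.
Qed.

Lemma mv_pivot_subst M (u : R) b i f :
  mv M (pivot_subst u b i f) i = u * mv M f i - (\sum_l b l * f l) * M i i.
Proof.
rewrite -mv_delta -mulNr -mv_lin; apply: eq_bigr => l _.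
by rewrite /pivot_subst mulNr.
Qed.

(* Pivoting on the diagonal entry [(i, i)] of [M] itself is orthogonal. *)
Lemma pivot_decomp M i f : msym M ->
  M i i ^+ 2 * qf M f
  = qf (pivot_form (M i i) (M i) i M) f + mv M f i ^+ 2 * M i i.
Proof.
move=> sM; rewrite (pivot_form_decomp (M i i) (M i) i)// mv_pivot_subst qf_pivot_form.
rewrite -/(mv M f i); ring.
Qed.

Definition evm B (t : R) i j : R := ev (B i j) t.
Definition c0m B i j : R := B i j 0%N.
Definition mconv B := forall i j, conv (B i j).

Lemma near_evm_cst B : mconv B -> exists2 C : R, 0 < C &
  \forall t \near 0+, forall f, `|qf (evm B t) f - qf (c0m B) f| <= C * t * sqn f.
Proof.
move=> cB.
have /choice[C HC] : forall ij, exists C : R, 0 < C /\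
    \forall t \near 0+, `|ev (B ij.1 ij.2) t - B ij.1 ij.2 0%N| <= C * t.
  by move=> ij; have [C] := near_ev_cst (cB ij.1 ij.2); exists C.
exists (1 + \sum_i \sum_j C (i, j)).
  rewrite ltr_wpDr// sumr_ge0// => i _; rewrite sumr_ge0// => j _.
  by have [/ltW] := HC (i, j).
have /near_all H : forall ij, \forall t \near 0+,
    `|ev (B ij.1 ij.2) t - B ij.1 ij.2 0%N| <= C ij * t.
  by move=> ij; have [] := HC ij.
move: (@near0_gt R) H; apply: filterS2 => t t0 H f.
have -> : qf (evm B t) f - qf (c0m B) f
    = qf (fun i j => 1 * evm B t i j + -1 * c0m B i j) f.
  by rewrite qf_matlin mul1r mulN1r.
rewrite (le_trans (norm_qf _ _))// ler_wpM2r ?sqn_ge0//.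
rewrite mulrDl mul1r ler_wpDl ?(ltW t0)// mulr_suml; apply: ler_sum => i _.
rewrite mulr_suml; apply: ler_sum => j _.
by have := H (i, j); rewrite /evm /c0m mul1r mulN1r.
Qed.

Lemma conv_pivot_form u b i B : conv u -> (forall j, conv (b j)) -> mconv B ->
  mconv (pivot_form u b i B).
Proof.
move=> cu cb cB j l; rewrite /pivot_form expr2; apply: convD; last first.
  by apply: convM => //; apply: convM.
apply: convB; last by do 2 apply: convM => //.
by apply: convB; do 2 apply: convM => //.
Qed.

Lemma near_evm_pivot_form u b i B : conv u -> (forall j, conv (b j)) -> mconv B ->
  \forall t \near 0+, forall j l, evm (pivot_form u b i B) t j l
    = pivot_form (ev u t) (fun j => ev (b j) t) i (evm B t) j l.
Proof.
move=> cu cb cB; apply: near_all => j; apply: near_all => l.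
have cuM : forall j, conv (u * b j) by move=> k; apply: convM.
(* One radius for all the series involved: [None] stands for [u], the left summand for [b], the
   right one for the entries of [B]. *)
have [r r0 rP] := @convN_all R _ (fun o : option (V + V * V) =>
  match o with None => u | Some (inl k) => b k | Some (inr (k, m)) => B k m end)
  (fun o => match o with None => cu | Some (inl k) => cb k
    | Some (inr (k, m)) => cB k m end).
have ru : convr r u := rP None.
have rb k : convr r (b k) := rP (Some (inl k)).
have rB k m : convr r (B k m) := rP (Some (inr (k, m))).
apply: filterS (near_norm_lt r0) => t tr; rewrite /evm /pivot_form !expr2.
have r0' := ltW r0.
have cM (p q : fps R) : convr r p -> convr r q -> convr r (p * q) by exact: convrM.
have cD (p q : fps R) : convr r p -> convr r q -> convr r (p + q) by exact: convrD.
have cN (p : fps R) : convr r p -> convr r (- p) by exact: convrN.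
rewrite (evD (ltW tr)); [|by auto 10|by auto 10].
rewrite (evD (ltW tr)); [|by auto 10|by auto 10].
rewrite (evD (ltW tr)); [|by auto 10|by auto 10].
rewrite !(evN (ltW tr)); [|by auto 10|by auto 10].
by rewrite !(evM tr); auto 10.
Qed.

End RealForms.

(** * Symmetric elimination for forms depending on [t] *)

Section Elimination.
Context {R : realType} {V : finType}.
Implicit Types (M G : V -> V -> R) (f g : V -> R) (B : V -> V -> fps R).
Local Notation "0+" := ((0 : R)^'+).

(** Elimination keeps the index type [V]; the set [A] of indices still alive shrinks instead and
    gives the induction measure. Rows suffice because the matrices are symmetric. *)
Definition supp (S : comNzRingType) (A : {set V}) (M : V -> V -> S) :=
  forall i j, i \notin A -> M i j = 0.

Lemma msym_pivot_form (S : comNzRingType) u b i (M : V -> V -> S) :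
  msym M -> msym (pivot_form u b i M).
Proof. by move=> sM j l; rewrite /pivot_form (sM j l) (sM i l) (sM i j); ring. Qed.

Lemma pivot_form_row0 (S : comNzRingType) u b i (M : V -> V -> S) l :
  b i = u -> pivot_form u b i M i l = 0.
Proof. by rewrite /pivot_form => ->; ring. Qed.

Lemma supp_pivot_form (S : comNzRingType) u b i (M : V -> V -> S) (A : {set V}) :
  supp A M -> b i = u -> (forall j, j \notin A -> b j = 0) ->
  supp (A :\ i) (pivot_form u b i M).
Proof.
move=> sM bi bA j l; rewrite !inE negb_and negbK => /orP[/eqP ->|jA].
  exact: pivot_form_row0.
by rewrite /pivot_form bA// !(sM j)//; ring.
Qed.

Definition rst (A : {set V}) f i : R := if i \in A then f i else 0.

Lemma qf_rst A M f : msym M -> supp A M -> qf M f = qf M (rst A f).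
Proof.
move=> sM sA; have mvE i : mv M f i = mv M (rst A f) i.
  apply: eq_bigr => j _; rewrite /rst; case: ifPn => // jA.
  by rewrite sM sA// !mul0r.
rewrite /qf /bil; apply: eq_bigr => i _; rewrite -mvE /rst; case: ifPn => // iA.
rewrite [mv M f i]big1 ?mulr0// => j _; by rewrite sA// mul0r.
Qed.

Lemma sqn_dot_le (b f : V -> R) :
  (\sum_l b l * f l) ^+ 2 <= (\sum_l \sum_m `|b l * b m|) * sqn f.
Proof.
rewrite (le_trans _ (norm_qf _ _))// (le_trans _ (ler_norm _))//.
rewrite le_eqVlt; apply/orP; left; apply/eqP.
rewrite expr2 mulr_suml; apply: eq_bigr => i _; rewrite /mv mulr_sumr mulr_sumr.
by apply: eq_bigr => j _; ring.
Qed.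

Lemma sqn_pivot_subst_le (u : R) b i f : sqn (pivot_subst u b i f)
  <= (2 * u ^+ 2 + 2 * \sum_l \sum_m `|b l * b m|) * sqn f.
Proof.
apply: (@le_trans _ _ (2 * (u ^+ 2 * sqn f + (\sum_l b l * f l) ^+ 2))).
  2: by have := sqn_dot_le b f; lra.
rewrite /sqn /pivot_subst; move: (\sum_l b l * f l) => s.
rewrite -[X in _ + X](sum_delta (fun=> s ^+ 2) i) mulr_sumr -big_split mulr_sumr.
apply: ler_sum => j _ /=; rewrite /delta; case: eqP => _ /=;
  rewrite ?mulr1 ?mulr0 ?subr0 ?addr0.
  by have := sqr_ge0 (u * f j + s); nra.
by have := sqr_ge0 (u * f j); nra.
Qed.

Lemma near_sqn_pivot_subst (u : fps R) (b : V -> fps R) i :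
  conv u -> (forall j, conv (b j)) -> exists2 C : R, 0 < C &
  \forall t \near 0+, forall f,
    sqn (pivot_subst (ev u t) (fun j => ev (b j) t) i f) <= C * sqn f.
Proof.
move=> cu cb; have [C C0 HC] := near_ev_bound cu.
have /choice[D HD] : forall j, exists D : R, 0 < D /\
    \forall t \near 0+, `|ev (b j) t| <= D.
  by move=> j; have [D] := near_ev_bound (cb j); exists D.
exists (1 + (2 * C ^+ 2 + 2 * \sum_l \sum_m D l * D m)).
  have DD : 0 <= \sum_l \sum_m D l * D m.
    apply: sumr_ge0 => l _; apply: sumr_ge0 => m _.
    by rewrite mulr_ge0 ?ltW//; have [] := HD l; have [] := HD m.
  by have := sqr_ge0 C; lra.
have /near_all H : forall j, \forall t \near 0+, `|ev (b j) t| <= D j.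
  by move=> j; have [] := HD j.
move: HC H; apply: filterS2 => t HC H f.
rewrite (le_trans (sqn_pivot_subst_le _ _ _ _))// ler_wpM2r ?sqn_ge0//.
rewrite ler_wpDl// lerD// ler_wpM2l//.
  by rewrite -(real_normK (num_real (ev u t))) lerXn2r ?nnegrE// ltW.
apply: ler_sum => l _; apply: ler_sum => m _; rewrite normrM ler_pM//.
Qed.

Lemma near_qf_bound B : mconv B -> exists2 C : R, 0 < C &
  \forall t \near 0+, forall f, `|qf (evm B t) f| <= C * sqn f.
Proof.
move=> cB; have [C C0 HC] := near_evm_cst cB.
exists (C + \sum_i \sum_j `|c0m B i j|).
  by rewrite ltr_wpDr// sumr_ge0// => i _; rewrite sumr_ge0.
move: (@near0_gt R) (near0_lt (@ltr01 R)) HC; apply: filterS3 => t t0 t1 HC f.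
rewrite -[X in `|X|](subrK (qf (c0m B) f)) (le_trans (ler_normD _ _))// mulrDl.
apply: lerD; last exact: norm_qf.
by rewrite (le_trans (HC f))// ler_wpM2r ?sqn_ge0// ler_piMr// ltW.
Qed.

Lemma c0m_psd B (C : R) : mconv B ->
  (\forall t \near 0+, forall f, - (C * t * sqn f) <= qf (evm B t) f) ->
  psd (c0m B).
Proof.
move=> cB H f; have [D D0 HD] := near_evm_cst cB.
apply: (@near_ge0_cst _ _ ((C + D) * sqn f)).
move: H HD; apply: filterS2 => t /(_ f) + /(_ f).
by rewrite ler_norml => ? /andP[]; lra.
Qed.

Lemma near_evm_shf e B : mconv B -> (forall i j, B i j = fpsX ^+ e * shf e (B i j)) ->
  \forall t \near 0+, forall f,
    qf (evm B t) f = t ^+ e * qf (evm (fun i j => shf e (B i j)) t) f.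
Proof.
move=> cB Be; have : \forall t \near 0+, forall i, forall j,
    ev (B i j) t = t ^+ e * ev (shf e (B i j)) t.
  apply: near_all => i; apply: near_all => j.
  apply: filterS (near_evM (@conv_fpsXn R e) (conv_shf e (cB i j))) => t.
  by rewrite -Be ev_fpsXn.
apply: filterS => t H f; rewrite /qf /bil mulr_sumr; apply: eq_bigr => i _.
rewrite mulrCA; congr (_ * _); rewrite /mv mulr_sumr; apply: eq_bigr => j _.
by rewrite /evm H mulrA.
Qed.

Lemma qf_evm0 (A : {set V}) B t f : (forall i j, B i j = 0) -> qf (evm B t) f = 0.
Proof.
move=> B0; rewrite /qf /bil big1// => i _; rewrite /mv big1 ?mulr0// => j _.
by rewrite /evm B0 -(rmorph0 fpsC) ev_fpsC mul0r.
Qed.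

Lemma near_qf_pivot_form u b i B : conv u -> (forall j, conv (b j)) -> mconv B ->
  \forall t \near 0+, forall f, qf (evm (pivot_form u b i B) t) f
    = qf (evm B t) (pivot_subst (ev u t) (fun j => ev (b j) t) i f).
Proof.
move=> cu cb cB; apply: filterS (near_evm_pivot_form i cu cb cB) => t H f.
rewrite -qf_pivot_form; congr qf; apply/funext => j; apply/funext => l; exact: H.
Qed.

(** Divide by the largest common power of [X]. The constant matrix is then nonzero and psd, hence
    has a positive diagonal entry to pivot on. The pivoted form satisfies the same hypothesis, as
    the substitution stretches vectors by a bounded factor, and it has one index less. *)
Lemma psd_flat B : msym B -> mconv B ->
  (forall k, exists C : R, \forall t \near 0+, forall f,
     - (C * t ^+ k * sqn f) <= qf (evm B t) f) ->
  \forall t \near 0+, psd (evm B t).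
Proof.
have [A sA] : exists A : {set V}, supp A B by exists (setTfor V) => i j; rewrite inE.
have [n] := ubnP #|A|; elim: n A B sA => // n IH A B sA; rewrite ltnS => An sB cB H.
have [B0|[e [[[i0 j0] /= Be0] Be]]] := min_order (fun ij => B ij.1 ij.2).
  apply: filterS (@near0_gt R) => t _ f; rewrite (qf_evm0 A) => // i j.
  exact: (B0 (i, j)).
pose B' i j := shf e (B i j).
have cB' : mconv B' by move=> i j; apply: conv_shf.
have sB' : msym B' by move=> i j; rewrite /B' sB.
have evB := near_evm_shf cB (fun i j => Be (i, j)).
have H' k : exists C : R, \forall t \near 0+, forall f,
     - (C * t ^+ k * sqn f) <= qf (evm B' t) f.
  (* Division by [X^e] costs [e] orders of precision. *)
  have [C HC] := H (k + e)%N; exists C.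
  move: (@near0_gt R) HC evB; apply: filterS3 => t t0 HC evB f.
  rewrite -(ler_pM2l (exprn_gt0 e t0)) -evB (le_trans _ (HC f))//.
  by rewrite exprD le_eqVlt; apply/orP; left; apply/eqP; ring.
have [i ui] : exists i, 0 < B' i i 0%N.
  (* Order 1 already makes the constant matrix psd; as its entry at [(i0, j0)] is nonzero, the
     diagonal entry at [i0] is positive. *)
  have [C HC] := H' 1%N; have pB' := c0m_psd cB' HC.
  exists i0; apply: (psd_diag_gt0 (j := j0) _ pB').
    by move=> i j; rewrite /c0m sB'.
  by rewrite /c0m /B' /shf addn0; apply/eqP.
pose Bn := pivot_form (B' i i) (B' i) i B'.
have cBn : mconv Bn by apply: conv_pivot_form.
have evBn := near_qf_pivot_form i (cB' i i) (cB' i) cB'.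
have sB'A : supp A B' by move=> j l jA; rewrite /B' sA// shf0.
have iA : i \in A.
  apply/negPn/negP => iA; move: ui.
  by rewrite /B' (sA _ _ iA) /shf fps0 ltxx.
have : \forall t \near 0+, psd (evm Bn t).
  apply: (IH (A :\ i)) => //.
  - by apply: (supp_pivot_form sB'A erefl) => j jA; rewrite sB' sB'A.
  - by move: An; rewrite (cardsD1 i) iA.
  - exact: msym_pivot_form.
  move=> k; have [C HC] := H' k.
  have [D D0 HD] := near_sqn_pivot_subst i (cB' i i) (cB' i).
  exists (`|C| * D); move: HC HD evBn.
  move: (@near0_gt R); apply: filterS4 => t t0 HC HD evBn f.
  rewrite evBn; apply: le_trans (HC _); rewrite lerN2.
  have tk : 0 <= t ^+ k by rewrite exprn_ge0// ltW.
  apply: (@le_trans _ _ (`|C| * t ^+ k * (D * sqn f))).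
    2: by rewrite le_eqVlt; apply/orP; left; apply/eqP; ring.
  apply: (@le_trans _ _ (`|C| * t ^+ k * sqn (pivot_subst (ev (B' i i) t)
      (fun j => ev (B' i j) t) i f))).
    by rewrite ler_wpM2r ?sqn_ge0// ler_wpM2r// ler_norm.
  by rewrite ler_wpM2l ?mulr_ge0.
move=> pBn; have evu : \forall t \near 0+, 0 < ev (B' i i) t.
  apply: filterS (near_ev_pos (cB' i i) ui) => t; apply: lt_le_trans.
  by rewrite divr_gt0.
apply: filterS4 (@near0_gt R) evB evu (filterI pBn evBn) => t t0 {}evB {}evu.
move=> [{}pBn {}evBn] f; have {}evu : 0 < evm B' t i i := evu.
rewrite evB mulr_ge0 ?exprn_ge0 ?(ltW t0)//.
suff : 0 <= evm B' t i i ^+ 2 * qf (evm B' t) f by rewrite pmulr_rge0 ?exprn_gt0.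
rewrite pivot_decomp; last first.
  by move=> j l; rewrite /evm sB'.
rewrite addr_ge0//; last by rewrite mulr_ge0 ?sqr_ge0// ltW.
by have := pBn f; rewrite evBn qf_pivot_form.
Qed.

End Elimination.

(** * Expansion of the largest K with B(t) - K G(t) psd *)

Section PencilMax.
Context {R : realType} {T : Type}.

Lemma pencil_max (P Q : T -> R) : (forall f, 0 <= Q f) ->
  (exists K, forall f, K * Q f <= P f) -> (exists f, 0 < Q f) ->
  exists K, (forall f, K * Q f <= P f) /\
    forall L, K < L -> exists f, P f < L * Q f.
Proof.
move=> Q0 [K0 HK0] [f0 Qf0]; pose S := [set K | forall f, K * Q f <= P f].
have SK0 : S K0 by [].
have ubS : ubound S (P f0 / Q f0).
  by move=> K SK; rewrite ler_pdivlMr//; exact: SK.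
have hS : has_sup S by split; [exists K0|exists (P f0 / Q f0)].
exists (sup S); split=> [f|L].
  have := Q0 f; rewrite le_eqVlt => /predU1P[Qf|Qf].
    by have := HK0 f; rewrite -Qf !mulr0.
  rewrite -ler_pdivlMr//; apply: ge_sup; first by exists K0.
  by move=> K SK; rewrite ler_pdivlMr//; exact: SK.
move=> KL; apply: contrapT => /forallNP H.
have : S L by move=> f; rewrite leNgt; apply/negP/H.
by move=> /(ub_le_sup hS.2); rewrite leNgt KL.
Qed.
End PencilMax.

Section PencilExpansion.
Context {R : realType} {V : finType}.
Implicit Types (A : {set V}) (M : V -> V -> R) (f g : V -> R) (B G : V -> V -> fps R).
Local Notation "0+" := ((0 : R)^'+).

(** Young's inequality for the cross term of [f] and [s delta_i] in [M]; the weight [eps] decides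
    which of the two pays. *)
Lemma psd_cross M i f s (eps : R) : 0 < eps -> msym M -> psd M ->
  `|2 * s * mv M f i| <= eps * qf M f + s ^+ 2 * M i i / eps.
Proof.
move=> e0 sM pM.
have H (s' : R) : 0 <= eps * qf M f + 2 * s' * mv M f i + s' ^+ 2 * M i i / eps.
  have := pM (fun j => eps * f j + s' * delta i j).
  rewrite qf_lin// (bilC _ _ sM) bil_delta qf_delta.
  rewrite -(pmulr_rge0 _ (x := eps^-1)) ?invr_gt0//.
  by congr (_ <= _); field; lra.
rewrite ler_norml; have := H s; have := H (- s); rewrite sqrrN.
by move=> ? ?; apply/andP; split; lra.
Qed.

(** The last two conditions say that the largest [K] with [B(t) - K G(t)] psd is [O(t^k)]. The
    condition at [t = 0] is definiteness of [B + C G] on the coordinates in [A], a property that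
    survives elimination. *)
Definition bounded_pencil A B G (k : nat) := [/\ msym B, msym G, mconv B, mconv G
  & supp A B /\ supp A G] /\
  [/\ \forall t \near 0+, psd (evm G t),
   exists c C : R, [/\ 0 < c, 0 < C & forall f, (forall i, i \notin A -> f i = 0) ->
     c * sqn f <= qf (c0m B) f + C * qf (c0m G) f],
   exists C : R, \forall t \near 0+, forall f,
     0 <= qf (evm B t) f + C * t ^+ k * qf (evm G t) f &
   exists C : R, \forall t \near 0+, exists f,
     qf (evm B t) f < C * t ^+ k * qf (evm G t) f].

(** The largest [K] is [mu t^k + O(t^(k+1))]. Both bounds are phrased with forms and test vectors, a
    shape that can be carried through a substitution. *)
Definition has_expansion B G (k : nat) := exists mu C : R, \forall t \near 0+,
  (forall f, (mu * t ^+ k - C * t ^+ k.+1) * qf (evm G t) f <= qf (evm B t) f) /\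
  (exists f, qf (evm B t) f < (mu * t ^+ k + C * t ^+ k.+1) * qf (evm G t) f).

Lemma rst_supp A f i : i \notin A -> rst A f i = 0.
Proof. by rewrite /rst => /negbTE ->. Qed.

Lemma supp_c0m A B : supp A B -> supp A (c0m B).
Proof. by move=> sA i j iA; rewrite /c0m sA// fps0. Qed.

Lemma supp_evm A B t : supp A B -> supp A (evm B t).
Proof. by move=> sA i j iA; rewrite /evm sA// -(rmorph0 fpsC) ev_fpsC. Qed.

Lemma psd_c0m B : mconv B -> (\forall t \near 0+, psd (evm B t)) -> psd (c0m B).
Proof.
move=> cB pB; apply: (@c0m_psd _ _ _ 0) => //; apply: filterS pB => t pB f.
by rewrite !mul0r oppr0.
Qed.

(** As [k > 0], [B] vanishes at 0 and definiteness falls on [G(0)] alone. So [B / t^k] and [G] are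
    perturbations of order [t] of a constant pair whose denominator is definite on [A], and [mu] is
    the maximum for that pair. *)
Lemma expansion_base A B G k : bounded_pencil A B G k ->
  (forall i j, B i j = fpsX ^+ k * shf k (B i j)) -> (0 < k)%N ->
  has_expansion B G k.
Proof.
move=> [[sB sG cB cG [sAB sAG]] [pG [c [C0 [c0 C00 Hc]]] [C3 H3] [C4 H4]]] Bk k0.
pose B' i j := shf k (B i j).
have cB' : mconv B' by move=> i j; apply: conv_shf.
have sB' : msym B' by move=> i j; rewrite /B' sB.
have sAB' : supp A B' by move=> j l jA; rewrite /B' sAB// shf0.
have evB := near_evm_shf cB Bk; rewrite -/B' in evB.
have pG0 := psd_c0m cG pG.
have G0c f : c / C0 * sqn (rst A f) <= qf (c0m G) (rst A f).
  have := Hc (rst A f) (@rst_supp A f); rewrite [qf (c0m B) _](_ : _ = 0).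
    by rewrite add0r mulrAC ler_pdivrMr// (mulrC C0).
  rewrite /qf /bil big1// => i _; rewrite /mv big1 ?mulr0// => j _.
  by rewrite /c0m Bk fpsXnM_lt ?mul0r.
set c' := c / C0 in G0c; have c'0 : 0 < c' by rewrite divr_gt0.
(* With [A] empty both forms vanish, against the strict inequality in [H4]. *)
have [a aA] : exists a, a \in A.
  apply: contrapT => /forallNP A0; have [t [f]] := @filter_ex _ _ (at_right_proper_filter (0 : R)) _ H4.
  have A0' (i : V) : i \notin A by apply/negP/A0.
  have sBt : supp A (evm B t) by exact: supp_evm.
  have sGt : supp A (evm G t) by exact: supp_evm.
  have q0 M : supp A M -> qf M f = 0.
    move=> sM; rewrite /qf /bil big1// => i _; rewrite /mv big1 ?mulr0// => j _.
    by rewrite sM ?mul0r.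
  by rewrite !q0// mulr0 ltxx.
have [C1 C10 HC1] := near_evm_cst cB'.
have [C2 C20 HC2] := near_evm_cst cG.
have [mu [Hmu1 Hmu2]] : exists K, (forall f, K * qf (c0m G) f <= qf (c0m B') f) /\
    forall L, K < L -> exists f, qf (c0m B') f < L * qf (c0m G) f.
  apply: pencil_max => //.
    (* The lower bound [H3], divided by [t^k], passes to the limit at 0. *)
    exists (- C3) => f; rewrite -subr_ge0 mulNr opprK.
    apply: (@near_ge0_cst _ _ ((C1 + `|C3| * C2) * sqn f)).
    apply: filterS4 (@near0_gt R) H3 evB (filterI HC1 HC2).
    move=> t t0 {}H3 {}evB [{}HC1 {}HC2].
    have := H3 f; rewrite evB mulrAC [X in _ + X]mulrC -mulrDr.
    rewrite pmulr_rge0 ?exprn_gt0// => H.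
    have := HC1 f; have := HC2 f; rewrite !ler_norml => /andP[_ h2] /andP[_ h1].
    have : `|C3 * (qf (evm G t) f - qf (c0m G) f)| <= `|C3| * (C2 * t * sqn f).
      by rewrite normrM ler_wpM2l.
    by rewrite ler_norml => /andP[_ h3]; lra.
  exists (rst A (delta a)); apply: lt_le_trans (G0c _).
  rewrite mulr_gt0// (lt_le_trans _ (ler_sqn _ a))//.
  by rewrite /rst aA /delta eqxx expr1n.
(* [D] measures, relative to [sqn], the error of replacing [B'(t)] and [G(t)] by their values at 0;
   the [+ 1] in it serves the test value [mu + t] below. [E] converts this error into multiples of
   [G(t)], which is at least [c' / 2] times [sqn] on [A]. *)
pose D := (`|mu| + 1) * C2 + C1; have D0 : 0 < D.
  by rewrite addr_gt0 ?mulr_gt0// ltr_wpDl.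
have c'2 : 0 < c' / 2 by rewrite divr_gt0.
pose E := D / (c' / 2); exists mu, (1 + E).
have HcC := near_mul_lt C2 c'2.
have H01 := near0_lt (@ltr01 R).
apply: filterS4 (@near0_gt R) evB (filterI HC1 HC2) (filterI HcC H01).
move=> t t0 {}evB [{}HC1 {}HC2] [{}HcC {}H01].
have Gs f : c' / 2 * sqn (rst A f) <= qf (evm G t) (rst A f).
  have := HC2 (rst A f); rewrite ler_norml => /andP[h _].
  have := G0c f; have : C2 * t * sqn (rst A f) <= c' / 2 * sqn (rst A f).
    by rewrite ler_wpM2r ?sqn_ge0// ltW.
  lra.
have tk : 0 < t ^+ k by rewrite exprn_gt0.
have Dq f : D * sqn (rst A f) <= E * qf (evm G t) (rst A f).
  by rewrite /E -mulrA ler_wpM2l ?(ltW D0)// ler_pdivlMl.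
have muC f : `|mu * (qf (evm G t) f - qf (c0m G) f)| <= `|mu| * (C2 * t * sqn f).
  by rewrite normrM ler_wpM2l.
have qB f : qf (evm B t) f = t ^+ k * qf (evm B' t) (rst A f).
  rewrite evB (qf_rst (A := A) (M := evm B' t))//; last exact: supp_evm.
  by move=> i j; rewrite /evm sB'.
have qG f : qf (evm G t) f = qf (evm G t) (rst A f).
  apply: qf_rst; last exact: supp_evm.
  by move=> i j; rewrite /evm sG.
have dmu := normr_ge0 mu.
have Ds f : (`|mu| * C2 + C1) * sqn (rst A f) <= D * sqn (rst A f).
  by rewrite ler_wpM2r ?sqn_ge0// /D lerD2r ler_wpM2r ?ltW// ltr_pwDr.
split=> [f|].
  rewrite qB qG exprS; set g := rst A f.
  rewrite [X in X * _](_ : _ = t ^+ k * (mu - (1 + E) * t)); last ring.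
  rewrite -mulrA ler_wpM2l ?(ltW tk)//.
  have := HC1 g; rewrite ler_norml => /andP[h1 _].
  have := muC g; rewrite ler_norml => /andP[_ h2].
  have h3 := Hmu1 g; have h4 := ler_wpM2l (ltW t0) (Dq f).
  have h5 := ler_wpM2l (ltW t0) (Ds f).
  have h6 : 0 <= t * qf (evm G t) g.
    rewrite mulr_ge0 ?(ltW t0)//; apply: le_trans (Gs f).
    by rewrite mulr_ge0 ?sqn_ge0 ?(ltW c'2).
  rewrite -/g in h4 h5; lra.
(* The test vector may depend on [t]; beating [mu + t] instead of [mu] is the [1] in [1 + E]. *)
have [f0 Hf0] := Hmu2 (mu + t) (ltr_pwDr t0 (lexx _)); set f := rst A f0.
exists f; rewrite exprS.
rewrite [X in X * _](_ : _ = t ^+ k * (mu + (1 + E) * t)); last ring.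
rewrite evB -mulrA ltr_pM2l//.
move: Hf0; rewrite (qf_rst (A := A))//; last exact: supp_c0m; last first.
  by move=> i j; rewrite /c0m sB'.
rewrite (qf_rst (A := A) (M := c0m G)) -/f; last exact: supp_c0m; last first.
  by move=> i j; rewrite /c0m sG.
move=> Hf0.
have := HC1 f; rewrite ler_norml => /andP[_ h1].
have := muC f; rewrite ler_norml => /andP[h2 _].
have := HC2 f; rewrite ler_norml => /andP[h3 _].
have h4 := ler_wpM2l (ltW t0) (Dq f0); rewrite -/f in h4.
have h5 := ler_wpM2l (ltW t0) (Ds f0); rewrite -/f in h5.
have h6 : t * (qf (c0m G) f - qf (evm G t) f) <= t * (C2 * sqn f).
  rewrite ler_wpM2l ?(ltW t0)//; have h7 : C2 * t * sqn f <= C2 * sqn f.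
    by rewrite -mulrA ler_wpM2l ?(ltW C20)// ler_piMl ?sqn_ge0// ltW.
  lra.
have h8 : t * (D * sqn f) = t * ((`|mu| * C2 + C1) * sqn f) + t * (C2 * sqn f).
  by rewrite /D; ring.
lra.
Qed.
End PencilExpansion.

Section PencilExpansion2.
Context {R : realType} {V : finType}.
Implicit Types (A : {set V}) (M : V -> V -> R) (f g : V -> R).
Implicit Types (B G : V -> V -> fps R).
Local Notation "0+" := ((0 : R)^'+).

Lemma c0m_pivot_form u b i B :
  c0m (pivot_form u b i B) = pivot_form (u 0%N) (fun j => b j 0%N) i (c0m B).
Proof.
apply/funext => j; apply/funext => l.
by rewrite /c0m /pivot_form !expr2 !(fpsD, fpsN, fpsM0).
Qed.

(** On vectors vanishing at the pivot the substitution cannot shrink the norm, up to [u]; this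
    transports definiteness to the eliminated pencil. *)
Lemma sqn_pivot_subst_ge (u : R) b i f : f i = 0 ->
  u ^+ 2 * sqn f <= sqn (pivot_subst u b i f).
Proof.
move=> fi; rewrite /sqn mulr_sumr; apply: ler_sum => j _.
rewrite /pivot_subst /delta; case: eqP => [->|_].
  by rewrite fi expr0n mulr0 sqr_ge0.
by rewrite mulr0 subr0 exprMn.
Qed.

(** If [B] has order [e < k], the pivot direction carries a term of size [t^e] in [B], which
    dominates everything that [t^k G] can contribute along it. Eliminating this direction therefore
    changes the maximum only at order [k + 1]. Once the order of [B] reaches [k], the base case
    applies. *)
Lemma pencil_expansion A B G k : bounded_pencil A B G k -> (0 < k)%N ->
  has_expansion B G k.
Proof.
have [n] := ubnP #|A|; elim: n A B G => // n IH A B G; rewrite ltnS => An SO k0.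
have [B0|[e [[[i0 j0] /= Be0] Be]]] := min_order (fun ij => B ij.1 ij.2).
  apply: (expansion_base SO) => // i j.
  by rewrite (B0 (i, j)) shf0 mulr0.
have [ke|ek] := leqP k e.
  apply: (expansion_base SO) => // i j; apply: fpsXn_dvd => l lk.
  by rewrite (Be (i, j)) fpsXnM_lt// (leq_trans lk).
have [[sB sG cB cG [sAB sAG]] [pG [c [C0 [c0 C00 Hc]]] [C3 H3] [C4 H4]]] := SO.
pose B' i j := shf e (B i j).
have cB' : mconv B' by move=> i j; apply: conv_shf.
have sB' : msym B' by move=> i j; rewrite /B' sB.
have sAB' : supp A B' by move=> j l jA; rewrite /B' sAB// shf0.
have evB := near_evm_shf cB (fun i j => Be (i, j)); rewrite -/B' in evB.
have [Cg Cg0 HCg] := near_qf_bound cG.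
have H01 := near0_lt (@ltr01 R).
(* Since [e < k], the lower bound in [t^k G] is still [O(t)] after division by [t^e], so the
   constant matrix of [B'] is psd. *)
have [i ui] : exists i, 0 < B' i i 0%N.
  have pB' : psd (c0m B').
    apply: (@c0m_psd _ _ _ (`|C3| * Cg)) => //.
    apply: filterS4 (@near0_gt R) H3 evB (filterI HCg H01).
    move=> t t0 {}H3 {}evB [{}HCg {}H01] f; have := H3 f; rewrite evB.
    have -> : t ^+ k = t ^+ e * (t * t ^+ (k - e.+1)).
      by rewrite -exprS -exprD subnSK// subnKC// ltnW.
    set q := t ^+ (k - e.+1); rewrite [X in _ + X]mulrAC mulrCA -mulrA -mulrDr.
    rewrite pmulr_rge0 ?exprn_gt0// => h.
    have q1 : `|q| <= 1 by rewrite ger0_norm ?exprn_ge0 ?exprn_ile1// ltW.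
    have : `|t * q * (qf (evm G t) f * C3)| <= t * 1 * (Cg * sqn f * `|C3|).
      by rewrite !normrM (gtr0_norm t0) !ler_pM ?mulr_ge0// ltW.
    by rewrite ler_norml => /andP[_ h2]; lra.
  exists i0; apply: (psd_diag_gt0 (j := j0) _ pB').
    by move=> i j; rewrite /c0m sB'.
  by rewrite /c0m /B' /shf addn0; apply/eqP.
have iA : i \in A.
  apply/negPn/negP => iA; move: ui.
  by rewrite (sAB' _ _ iA) fps0 ltxx.
(* The factor [X^e] is restored after pivoting, so that the order [k] stays the same through the
   induction. *)
pose Bn j l := fpsX ^+ e * pivot_form (B' i i) (B' i) i B' j l.
pose Gn := pivot_form (B' i i) (B' i) i G.
pose T t f := pivot_subst (ev (B' i i) t) (fun j => ev (B' i j) t) i f.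
have cE : mconv (pivot_form (B' i i) (B' i) i B') by apply: conv_pivot_form.
have cBn : mconv Bn by move=> j l; apply: convM; [exact: conv_fpsXn|exact: cE].
have cGn : mconv Gn by apply: conv_pivot_form.
have evBn : \forall t \near 0+, forall f,
    qf (evm Bn t) f = t ^+ e * qf (evm B' t) (T t f).
  have XE j l : Bn j l = fpsX ^+ e * shf e (Bn j l) by rewrite /Bn shf_fpsXn.
  move: (near_evm_shf cBn XE) (near_qf_pivot_form i (cB' i i) (cB' i) cB').
  apply: filterS2 => t h1 h2 f; rewrite h1 -h2; congr (_ * qf _ _).
  by apply/funext => j; apply/funext => l; rewrite /evm /Bn shf_fpsXn.
have evGn : \forall t \near 0+, forall f, qf (evm Gn t) f = qf (evm G t) (T t f).
  exact: near_qf_pivot_form.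
pose u0 := B' i i 0%N.
have evu : \forall t \near 0+, u0 / 2 <= ev (B' i i) t by apply: near_ev_pos.
have psG t : msym (evm G t) by move=> j l; rewrite /evm sG.
have psB t : msym (evm B' t) by move=> j l; rewrite /evm sB'.
(* Substituted vectors are orthogonal to [delta i] for [B']: the form of [B'] splits without a cross
   term, only [G] keeps one. *)
have mvT t f : mv (evm B' t) (T t f) i = 0.
  by rewrite /T mv_pivot_subst /mv /evm; ring.
have bi0 j : j \notin A -> B' i j = 0 by move=> jA; rewrite sB' sAB'.
have decB t f : ev (B' i i) t ^+ 2 * qf (evm B' t) f = qf (evm B' t) (T t f)
    + mv (evm B' t) f i ^+ 2 * ev (B' i i) t.
  rewrite (pivot_form_decomp _ (fun j => ev (B' i j) t) i)// -/(T t f) mvT mulr0 addr0.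
  by [].
have decG t f : ev (B' i i) t ^+ 2 * qf (evm G t) f = qf (evm G t) (T t f)
    + 2 * mv (evm B' t) f i * mv (evm G t) (T t f) i
    + mv (evm B' t) f i ^+ 2 * evm G t i i.
  by rewrite (pivot_form_decomp _ (fun j => ev (B' i j) t) i).
have Gii t : psd (evm G t) -> (forall f, `|qf (evm G t) f| <= Cg * sqn f) ->
    0 <= evm G t i i <= Cg.
  move=> pGt HCgt; have := HCgt (delta i); have := pGt (delta i).
  rewrite qf_delta => -> /=; rewrite ler_norml => /andP[_].
  rewrite [sqn _](_ : _ = 1) ?mulr1// /sqn.
  under eq_bigr do rewrite expr2; rewrite sum_delta /delta eqxx//.
have u02 : 0 < u0 / 2 by rewrite divr_gt0.
have u04 : 0 < u0 / 4 by rewrite divr_gt0.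
have tke (t : R) : t ^+ k = t ^+ e * (t * t ^+ (k - e.+1)).
  by rewrite -exprS -exprD subnSK// subnKC// ltnW.
have SOn : bounded_pencil (A :\ i) Bn Gn k.
  split; split=> //.
  - by move=> j l; rewrite /Bn msym_pivot_form.
  - exact: msym_pivot_form.
  - split; last exact: (supp_pivot_form sAG).
    by move=> j l jA; rewrite /Bn (supp_pivot_form sAB' erefl bi0) ?mulr0.
  - by move: pG evGn; apply: filterS2 => t pGt evGnt f; rewrite evGnt.
  - exists (c * u0 ^+ 2), C0; split; rewrite ?mulr_gt0 ?exprn_gt0// => f fA.
    pose T0 := pivot_subst u0 (fun j => B' i j 0%N) i f.
    have T0A j : j \notin A -> T0 j = 0.
      move=> jA; rewrite /T0 /pivot_subst /delta fA ?inE ?(negbTE jA) ?andbF// mulr0.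
      by case: eqP => [ji|]; [move: jA; rewrite ji iA|rewrite mulr0 subr0].
    have -> : qf (c0m Gn) f = qf (c0m G) T0 by rewrite /Gn c0m_pivot_form qf_pivot_form.
    have -> : qf (c0m Bn) f = qf (c0m B) T0.
      have cBE : c0m B = fun j l => (fpsX ^+ e : fps R) 0%N * c0m B' j l + 0 * c0m B' j l.
        apply/funext => j; apply/funext => l.
        by rewrite /c0m (Be (j, l)) fpsM0 mul0r addr0.
      have cBnE : c0m Bn = fun j l => (fpsX ^+ e : fps R) 0%N *
          c0m (pivot_form (B' i i) (B' i) i B') j l + 0 * c0m B' j l.
        by apply/funext => j; apply/funext => l; rewrite /c0m /Bn fpsM0 mul0r addr0.
      by rewrite cBE cBnE !qf_matlin !mul0r !addr0 /T0 -qf_pivot_form -c0m_pivot_form.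
    apply: le_trans (Hc _ T0A); rewrite -mulrA ler_wpM2l ?(ltW c0)//.
    by rewrite sqn_pivot_subst_ge// fA// !inE eqxx.
  - exists C3; apply: filterS3 H3 evB (filterI evBn evGn).
    by move=> t h3 h1 [h2 h4] f; rewrite h2 h4 -h1.
  (* Young's inequality with weight 1 at most doubles the two squares in [u^2 G f]; for small [t]
     the one along the pivot is paid by the pivot term of [B]. *)
  exists (2 * `|C4|).
  have small : \forall t \near 0+, 2 * `|C4| * Cg * t < u0 / 2.
    exact: near_mul_lt.
  apply: filterS4 (filterI (@near0_gt R) (filterI H4 evB)) (filterI evBn evGn)
    (filterI pG (filterI HCg H01)) (filterI small evu).
  move=> t [t0 [[f Hf] evBt]] [evBnt evGnt] [pGt [HCgt t1]] [st ut].
  exists f; rewrite evBnt evGnt.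
  have upos : 0 < ev (B' i i) t by rewrite (lt_le_trans _ ut).
  have te : 0 < t ^+ e by rewrite exprn_gt0.
  have /andP[g0 gC] := Gii t pGt HCgt.
  move: Hf; rewrite evBt (tke t); set p := t * _; rewrite !(mulrCA _ (t ^+ e)).
  rewrite -!(mulrA (t ^+ e)) !ltr_pM2l// => Hf.
  have /andP[p0 pt] : 0 <= p <= t.
    rewrite mulr_ge0 ?exprn_ge0 ?(ltW t0)//= ler_piMr ?(ltW t0)//.
    by rewrite exprn_ile1// ltW.
  set s := mv (evm B' t) f i; set w := T t f in g0 gC *.
  have dG := decG t f; rewrite -/s -/w in dG.
  have dB := decB t f; rewrite -/s -/w in dB.
  have := psd_cross i w s ltr01 (psG t) pGt.
  rewrite mul1r divr1 ler_norml => /andP[_ cr].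
  have u2 : 0 < ev (B' i i) t ^+ 2 by rewrite exprn_gt0.
  have h1 : ev (B' i i) t ^+ 2 * qf (evm B' t) f
      < ev (B' i i) t ^+ 2 * (`|C4| * p * qf (evm G t) f).
    rewrite ltr_pM2l// (lt_le_trans Hf)// ler_wpM2r// ler_wpM2r//.
    exact: ler_norm.
  have cp0 : 0 <= `|C4| * p by rewrite mulr_ge0.
  have h2 : `|C4| * p * (ev (B' i i) t ^+ 2 * qf (evm G t) f)
      <= `|C4| * p * (2 * qf (evm G t) w + 2 * s ^+ 2 * evm G t i i).
    by rewrite ler_wpM2l// dG; lra.
  have h3 : 2 * (`|C4| * p) * evm G t i i <= ev (B' i i) t.
    apply: le_trans ut; apply: le_trans (ltW st).
    have h : p * evm G t i i <= t * Cg by rewrite ler_pM.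
    by have := ler_wpM2l (normr_ge0 C4) h; lra.
  have h4 := ler_wpM2l (sqr_ge0 s) h3.
  lra.
have [mu [C HC]] : has_expansion Bn Gn k.
  by apply: (IH _ _ _ _ SOn k0); move: An; rewrite (cardsD1 i) iA.
(* [D] bounds [|mu - C' t|] for small [t]. The cross term of [G] is split with weight [N t]: its [G]
   part costs [D N t^(k+1)], hence [C'], and [N] is such that its pivot part is at most a quarter of
   [u0]. Another quarter pays for the square along the pivot, and the pivot term of [B] provides
   both. *)
pose D := `|mu| + 1; have D0 : 0 < D by rewrite ltr_wpDl.
pose N := 4 * D * Cg / u0; have N0 : 0 < N by rewrite divr_gt0// !mulr_gt0.
pose C' := `|C| + D * N; have C'0 : 0 < C'.
  by apply: ltr_wpDl => //; apply: mulr_gt0.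
exists mu, C'.
have sm1 := near_mul_lt C' (@ltr01 R).
have sm2 := near_mul_lt (D * Cg) u04.
apply: filterS4 (filterI (@near0_gt R) (filterI HC evB)) (filterI evBn evGn)
    (filterI pG (filterI HCg H01)) (filterI (filterI sm1 sm2) evu).
move=> t [t0 [[HC1 [f0 HC2]] evBt]] [evBnt evGnt] [pGt [HCgt t1]] [[st1 st2] ut].
have upos : 0 < ev (B' i i) t by rewrite (lt_le_trans _ ut).
have te : 0 < t ^+ e by rewrite exprn_gt0.
have tk : 0 < t ^+ k by rewrite exprn_gt0.
have tk1 : 0 < t ^+ k.+1 by rewrite exprn_gt0.
have /andP[g0 gC] := Gii t pGt HCgt.
split; last first.
  exists (T t f0); move: HC2; rewrite evBnt evGnt evBt => /lt_le_trans; apply.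
  rewrite ler_wpM2r// lerD2l ler_wpM2r ?(ltW tk1)// /C'.
  by rewrite (le_trans (ler_norm _))// lerDl mulr_ge0 ?ltW.
move=> f; have := HC1 f; rewrite evBnt evGnt evBt.
rewrite exprS (tke t); set q := t ^+ (k - e.+1).
have q0 : 0 <= q by rewrite exprn_ge0 ?ltW.
have q1 : q <= 1 by rewrite exprn_ile1 ?ltW.
set w := T t f; set s := mv (evm B' t) f i.
rewrite [X in X * _ <= _ -> _](_ : _ = t ^+ e * (t * q * (mu - C * t))); last ring.
rewrite [X in _ -> X * _ <= _](_ : _ = t ^+ e * (t * q * (mu - C' * t))); last ring.
rewrite -(mulrA (t ^+ e)) -[X in _ -> X <= _](mulrA (t ^+ e)) !ler_pM2l// => h.
have dG := decG t f; rewrite -/s -/w in dG.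
have dB := decB t f; rewrite -/s -/w in dB.
have u2 : 0 < ev (B' i i) t ^+ 2 by rewrite exprn_gt0.
rewrite -(ler_pM2l u2) dB mulrCA dG.
have e0 : 0 < N * t by rewrite mulr_gt0.
have cr := psd_cross i w s e0 (psG t) pGt.
have G0 : 0 <= qf (evm G t) w by exact: pGt.
have s0 := sqr_ge0 s.
have p0 : 0 <= t * q by rewrite mulr_ge0// ltW.
have kD : `|t * q * (mu - C' * t)| <= t * q * D.
  rewrite normrM (ger0_norm p0) ler_wpM2l// (le_trans (ler_normB _ _))//.
  by rewrite lerD2l normrM (gtr0_norm C'0) (gtr0_norm t0) ltW.
set mvw := mv (evm G t) w i in dG cr *.
have k1 : t * q * (mu - C' * t) * (2 * s * mvw)
    <= t * q * D * (N * t * qf (evm G t) w + s ^+ 2 * evm G t i i / (N * t)).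
  by apply: (le_trans (ler_norm _)); rewrite normrM ler_pM.
have k2 : t * q * (mu - C' * t) * (s ^+ 2 * evm G t i i)
    <= t * q * D * (s ^+ 2 * evm G t i i).
  have sG0 : 0 <= s ^+ 2 * evm G t i i by rewrite mulr_ge0.
  by apply: ler_wpM2r => //; apply: (le_trans (ler_norm _)).
have k3 : t * q * D * (s ^+ 2 * evm G t i i / (N * t)) <= s ^+ 2 * (u0 / 4).
  have -> : t * q * D * (s ^+ 2 * evm G t i i / (N * t))
      = s ^+ 2 * (q * (evm G t i i / Cg) * (u0 / 4)).
    by rewrite /N; field; rewrite ?gt_eqF.
  rewrite ler_wpM2l// ler_piMl ?(ltW u04)// mulr_ile1// ?divr_ge0 ?(ltW Cg0)//.
  by rewrite ler_pdivrMr// mul1r.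
have k4 : t * q * D * (s ^+ 2 * evm G t i i) <= s ^+ 2 * (u0 / 4).
  have -> : t * q * D * (s ^+ 2 * evm G t i i)
      = s ^+ 2 * (q * (D * (evm G t i i) * t)) by ring.
  rewrite ler_wpM2l// (le_trans _ (ltW st2))//.
  apply: (@le_trans _ _ (D * evm G t i i * t)).
    by rewrite ler_piMl// !mulr_ge0 ?(ltW D0) ?(ltW t0).
  by rewrite ler_wpM2r ?(ltW t0)// ler_wpM2l ?(ltW D0).
have k5 : t * q * (t * ((C' - C - D * N) * qf (evm G t) w)) >= 0.
  rewrite !mulr_ge0 ?(ltW t0)// /C'; have := ler_norm C; lra.
have k6 : s ^+ 2 * (u0 / 2) <= s ^+ 2 * ev (B' i i) t by rewrite ler_wpM2l.
have k7 : s ^+ 2 * (u0 / 4) + s ^+ 2 * (u0 / 4) = s ^+ 2 * (u0 / 2) by field.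
lra.
Qed.

End PencilExpansion2.

(** * Pencils and their curvature *)

Section Pencil.
Context {R : realType} {V : finType}.
Variables (B : V -> V -> V -> R) (G : V -> V -> R).
Implicit Types (a : V -> R) (f : V -> R).
Local Notation "0+" := ((0 : R)^'+).

Definition lform a f : R := \sum_v a v * qf (B v) f.

(** What is retained of the curvature at one vertex: [lform a] stands for the Bakry-Emery form,
    linear in the inverse vertex weight [a], and [G] for the gradient form. The bound by [- C G]
    makes the maximum finite and Lipschitz in [a]; definiteness is what elimination at time 0 starts
    from. *)
Definition pencil := [/\ forall v, msym (B v), msym G /\ psd G,
  exists2 C : R, 0 <= C & forall v f, - (C * qf G f) <= qf (B v) f,
  exists f, 0 < qf G f &
  forall a, (forall v, 0 < a v) -> exists c C : R, [/\ 0 < c, 0 < C &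
    forall f, c * sqn f <= lform a f + C * qf G f]].

Definition is_kap a K := (forall f, K * qf G f <= lform a f) /\
  forall L, K < L -> exists f, lform a f < L * qf G f.

Definition kap a : R := xget 0 [set K | is_kap a K].

Hypothesis P : pencil.

Lemma lform_ge : exists2 C : R, 0 <= C &
  forall a f, (forall v, 0 <= a v) -> - (C * \sum_v a v) * qf G f <= lform a f.
Proof.
have [_ _ [C C0 HC] _ _] := P; exists C => // a f a0.
rewrite /lform mulNr mulrAC mulr_sumr -sumrN; apply: ler_sum => v _.
by rewrite mulrC -mulrN ler_wpM2l.
Qed.

Lemma kapP a : (forall v, 0 <= a v) -> is_kap a (kap a).
Proof.
move=> a0; have [_ [_ pG] _ Gf _] := P.
have [K HK] : exists K, is_kap a K.
  apply: pencil_max => //; have [C _ HC] := lform_ge.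
  by exists (- (C * \sum_v a v)) => f; exact: HC.
by rewrite /kap; case: xgetP => [L _ //|/(_ K)].
Qed.

Lemma kap_ge a K : (forall v, 0 <= a v) -> (forall f, K * qf G f <= lform a f) ->
  K <= kap a.
Proof.
move=> a0 HK; rewrite leNgt; apply/negP => /(kapP a0).2 [f].
by rewrite ltNge HK.
Qed.

Lemma lformD a b f (s t : R) :
  lform (fun v => s * a v + t * b v) f = s * lform a f + t * lform b f.
Proof.
rewrite /lform !mulr_sumr -big_split; apply: eq_bigr => v _ /=; ring.
Qed.

Lemma kap_bound : exists2 C : R, 0 <= C &
  forall a, (forall v, 0 <= a v) -> `|kap a| <= C * \sum_v a v.
Proof.
have [C C0 HC] := lform_ge; have [_ _ _ [f Gf] _] := P.
pose D := (\sum_v `|qf (B v) f|) / qf G f.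
have D0 : 0 <= D by rewrite divr_ge0 ?(ltW Gf)// sumr_ge0.
exists (C + D); first by rewrite addr_ge0.
move=> a a0; have S0 : 0 <= \sum_v a v by rewrite sumr_ge0.
rewrite ler_norml; apply/andP; split.
  apply: (@le_trans _ _ (- (C * \sum_v a v))).
    by rewrite lerN2 ler_wpM2r// lerDl.
  by apply: kap_ge => // g; exact: HC.
apply: (@le_trans _ _ (D * \sum_v a v)); last by rewrite ler_wpM2r// lerDr.
have := (kapP a0).1 f; rewrite -ler_pdivlMr// => /le_trans; apply.
rewrite /D mulrAC ler_wpM2r ?invr_ge0 ?(ltW Gf)// /lform mulr_sumr.
apply: ler_sum => v _; rewrite mulrC ler_wpM2r//.
rewrite (le_trans (ler_norm _))// (bigD1 v)//= lerDl sumr_ge0//.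
Qed.

(* As every [B v] is at least [- C G], one has [kap (th a + e) >= th kap a - C sum e]
   for [e >= 0]; apply it with [th = 1 - d / lo]. *)
Lemma kap_lip (lo hi : R) : 0 < lo -> lo <= hi -> exists2 L : R, 0 <= L &
  forall a b d, 0 <= d -> (forall v, lo <= a v <= hi) -> (forall v, lo <= b v <= hi) ->
    (forall v, `|a v - b v| <= d) -> `|kap a - kap b| <= L * d.
Proof.
move=> lo0 lohi; have hi0 := lt_le_trans lo0 lohi.
have [C C0 HC] := lform_ge; have [D D0 HD] := kap_bound.
pose n : R := #|V|%:R; have n0 : 0 <= n by [].
have sumV a (c : R) : (forall v, a v <= c) -> \sum_v a v <= n * c.
  move=> ac; rewrite /n mulr_natl -sumr_const; exact: ler_sum.
(* The first summand pays for the remainder [b - th a], the second for [(1 - th) kap a] and for the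
   case of large [d]. *)
pose L := (C * (n * (1 + hi / lo))) + 2 * (D * (n * hi)) / lo.
have L1 : 0 <= C * (n * (1 + hi / lo)).
  by rewrite !mulr_ge0// addr_ge0// divr_ge0 ?ltW.
have L2 : 0 <= D * (n * hi) / lo by rewrite !mulr_ge0// ?invr_ge0 ltW.
have bnd a : (forall v, lo <= a v <= hi) -> `|kap a| <= D * (n * hi).
  move=> Ha; have a0 v : 0 <= a v.
    by have /andP[h _] := Ha v; apply: le_trans h; exact: ltW.
  apply: (le_trans (HD _ a0)); rewrite ler_wpM2l// sumV// => v.
  by have /andP[] := Ha v.
exists L; first by rewrite /L; lra.
suff H a b d : 0 <= d -> (forall v, lo <= a v <= hi) ->
    (forall v, lo <= b v <= hi) -> (forall v, `|a v - b v| <= d) ->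
    kap a - kap b <= L * d.
  move=> a b d d0 Ha Hb ab; rewrite ler_norml; apply/andP; split; last exact: H.
  by rewrite lerNl opprB; apply: H => // v; rewrite distrC.
move=> d0 Ha Hb ab; have := bnd _ Ha; have := bnd _ Hb.
rewrite !ler_norml => /andP[hb1 hb2] /andP[ha1 ha2].
have Ld : L * d = C * (n * (1 + hi / lo)) * d + 2 * (D * (n * hi) / lo * d).
  by rewrite /L; ring.
have L1d : 0 <= C * (n * (1 + hi / lo)) * d by rewrite mulr_ge0.
(* For [d > lo] the factor [th] would be negative; there the uniform bound on [kap] is enough. *)
have [lod|dlo] := ltP lo d.
  have : D * (n * hi) <= D * (n * hi) / lo * d.
    by rewrite mulrAC -mulrA ler_peMr ?mulr_ge0 ?(ltW hi0)// ler_pdivlMr// mul1r ltW.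
  by rewrite Ld; lra.
pose th := 1 - d / lo.
have dlo0 : 0 <= d / lo by rewrite divr_ge0// ltW.
have th0 : 0 <= th by rewrite /th subr_ge0 ler_pdivrMr// mul1r.
have a0 v : 0 <= a v by have /andP[h _] := Ha v; apply: le_trans h; exact: ltW.
have b0 v : 0 <= b v by have /andP[h _] := Hb v; apply: le_trans h; exact: ltW.
have e0 v : 0 <= 1 * b v + - th * a v.
  have := ab v; rewrite ler_norml => /andP[_ h1]; have /andP[h2 _] := Ha v.
  have : d / lo * lo <= d / lo * a v by rewrite ler_wpM2l.
  by rewrite /th divfK ?gt_eqF//; lra.
have ehi : \sum_v (1 * b v + - th * a v) <= n * (d * (1 + hi / lo)).
  apply: sumV => v; have := ab v; rewrite ler_norml => /andP[h1 _].
  have /andP[_ h2] := Ha v.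
  have : d / lo * a v <= d / lo * hi by rewrite ler_wpM2l.
  have -> : d * (1 + hi / lo) = d + d / lo * hi by field; rewrite gt_eqF.
  by rewrite /th; lra.
have : th * kap a - C * \sum_v (1 * b v + - th * a v) <= kap b.
  apply: kap_ge => // f; have := HC _ f e0; rewrite lformD.
  by have := ler_wpM2l th0 ((kapP a0).1 f); lra.
have : C * \sum_v (1 * b v + - th * a v) <= C * (n * (d * (1 + hi / lo))).
  by rewrite ler_wpM2l.
have : d / lo * kap a <= d / lo * (D * (n * hi)) by rewrite ler_wpM2l.
have : 0 <= D * (n * hi) / lo * d by rewrite mulr_ge0.
by rewrite Ld /th; lra.
Qed.

(** The matrix [M a K] of the overview, with power series for [a] and [K]. *)
Definition pform (p : V -> fps R) (l : fps R) : V -> V -> fps R :=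
  fun i j => (\sum_v p v * fpsC (B v i j)) - l * fpsC (G i j).

Lemma pform_sym p l : msym (pform p l).
Proof.
have [sB [sG _] _ _ _] := P => i j; rewrite /pform sG; congr (_ - _).
by apply: eq_bigr => v _; rewrite sB.
Qed.

Lemma pform_conv p l : (forall v, conv (p v)) -> conv l -> mconv (pform p l).
Proof.
move=> cp cl i j; apply: convB; last by apply: convM => //; exact: conv_fpsC.
by apply: conv_sum => v; apply: convM => //; exact: conv_fpsC.
Qed.

Lemma qf_sum_mat (F : V -> V -> V -> R) (c : V -> R) f :
  qf (fun i j => \sum_v c v * F v i j) f = \sum_v c v * qf (F v) f.
Proof.
have mvE i : mv (fun i j => \sum_v c v * F v i j) f i = \sum_v c v * mv (F v) f i.
  rewrite /mv; under [RHS]eq_bigr do rewrite mulr_sumr.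
  rewrite exchange_big; apply: eq_bigr => j _ /=; rewrite mulr_suml.
  by apply: eq_bigr => v _; rewrite mulrA.
rewrite /qf /bil; under [RHS]eq_bigr do rewrite mulr_sumr.
rewrite exchange_big; apply: eq_bigr => i _ /=; rewrite mvE mulr_sumr.
by apply: eq_bigr => v _; rewrite mulrCA.
Qed.

Lemma qf_lform a (K : R) f :
  qf (fun i j => \sum_v a v * B v i j - K * G i j) f = lform a f - K * qf G f.
Proof.
have -> : (fun i j => \sum_v a v * B v i j - K * G i j)
    = (fun i j => 1 * (\sum_v a v * B v i j) + - K * G i j).
  by apply/funext => i; apply/funext => j; rewrite mul1r mulNr.
by rewrite qf_matlin qf_sum_mat mul1r mulNr.
Qed.

Lemma near_pform p l : (forall v, conv (p v)) -> conv l ->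
  \forall t \near 0+, forall i j, evm (pform p l) t i j
    = \sum_v ev (p v) t * B v i j - ev l t * G i j.
Proof.
move=> cp cl; apply: near_all => i; apply: near_all => j.
have cC c : conv (fpsC c : fps R) by exact: conv_fpsC.
have cpB v : conv (p v * fpsC (B v i j)) by exact: convM.
have evpB : \forall t \near 0+, forall v,
    ev (p v * fpsC (B v i j)) t = ev (p v) t * B v i j.
  apply: near_all => v; apply: filterS (near_evM (cp v) (cC (B v i j))) => t ->.
  by rewrite ev_fpsC.
apply: filterS4 (near_evB (conv_sum (index_enum V) cpB) (convM cl (cC (G i j))))
  (near_ev_sum cpB) evpB (near_evM cl (cC (G i j))) => t h1 h2 h3 h4.
rewrite /evm /pform h1 h2 h4 ev_fpsC; congr (_ - _).
by apply: eq_bigr => v _; rewrite h3.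
Qed.

Lemma near_qf_pform p l : (forall v, conv (p v)) -> conv l ->
  \forall t \near 0+, forall f, qf (evm (pform p l) t) f
    = lform (fun v => ev (p v) t) f - ev l t * qf G f.
Proof.
move=> cp cl; apply: filterS (near_pform cp cl) => t H f.
rewrite -qf_lform; congr qf; apply/funext => i; apply/funext => j.
exact: H.
Qed.

(** Replacing [lform] by [lform - l G] lowers the maximum by [l]. What is left is [O(t^(k+1))], and
    the expansion of the shifted pencil gives its leading coefficient. *)
Lemma kap_step p l k : (forall v, conv (p v)) -> (forall v, 0 < p v 0%N) ->
  conv l ->
  (exists C : R, \forall t \near 0+,
     `|kap (fun v => ev (p v) t) - ev l t| <= C * t ^+ k.+1) ->
  exists mu : R, exists C : R, \forall t \near 0+,
    `|kap (fun v => ev (p v) t) - ev l t - mu * t ^+ k.+1| <= C * t ^+ k.+2.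
Proof.
move=> cp p0 cl [C HC].
have [_ [sG pG] _ _ HP] := P.
pose Gf i j : fps R := fpsC (G i j).
have evG t : evm Gf t = G.
  by apply/funext => i; apply/funext => j; rewrite /evm ev_fpsC.
have pos : \forall t \near 0+, forall v, 0 <= ev (p v) t.
  apply: near_all => v; apply: filterS (near_ev_pos (cp v) (p0 v)) => t.
  by apply: le_trans; rewrite divr_ge0// ltW.
have evP := near_qf_pform cp cl.
have SO : bounded_pencil (setTfor V) (pform p l) Gf k.+1.
  split; split.
  - exact: pform_sym.
  - by move=> i j; rewrite /Gf sG.
  - exact: pform_conv.
  - by move=> i j; exact: conv_fpsC.
  - by split=> i j; rewrite inE.
  - by apply: filterS (@near0_gt R) => t _; rewrite evG.
  - have [c [D [c0 D0 HcD]]] := HP (fun v => p v 0%N) p0.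
    exists c, (D + `|l 0%N|); split=> //; first by rewrite ltr_pwDl.
    move=> f _; have -> : c0m (pform p l) = fun i j =>
        \sum_v p v 0%N * B v i j - l 0%N * G i j.
      apply/funext => i; apply/funext => j; rewrite /c0m /pform fpsB fps_sum fpsM0.
      by congr (_ - _); apply: eq_bigr => v _; rewrite fpsM0.
    rewrite qf_lform -[c0m Gf]/G; have := HcD f.
    by have := ler_wpM2r (pG f) (ler_norm (l 0%N)); lra.
  - exists C; apply: filterS4 (@near0_gt R) HC pos evP => t t0 {}HC {}pos {}evP f.
    rewrite evG evP; move: HC; rewrite ler_norml => /andP[h _].
    have := (kapP pos).1 f.
    have : (ev l t - C * t ^+ k.+1) * qf G f
        <= kap (fun v => ev (p v) t) * qf G f by rewrite ler_wpM2r//; lra.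
    lra.
  - exists (C + 1); apply: filterS4 (@near0_gt R) HC pos evP.
    move=> t t0 {}HC {}pos {}evP; move: HC; rewrite ler_norml => /andP[_ h].
    have tk : 0 < t ^+ k.+1 by rewrite exprn_gt0.
    have [|f Hf] := (kapP pos).2 (ev l t + (C + 1) * t ^+ k.+1); first lra.
    by exists f; rewrite evG evP; lra.
have [mu [D HD]] := pencil_expansion SO (ltn0Sn k); exists mu, D.
apply: filterS4 (@near0_gt R) HD pos evP => t t0 {HC} [H1 [f H2]] {}pos {}evP.
rewrite ler_norml; apply/andP; split.
  have : ev l t + mu * t ^+ k.+1 - D * t ^+ k.+2 <= kap (fun v => ev (p v) t).
    by apply: kap_ge => // g; have := H1 g; rewrite evG evP; lra.
  lra.
have : kap (fun v => ev (p v) t) < ev l t + mu * t ^+ k.+1 + D * t ^+ k.+2.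
  rewrite ltNge; apply/negP => h; move: H2; rewrite evG evP ltNge => /negP; apply.
  by have := ler_wpM2r (pG f) h; have := (kapP pos).1 f; lra.
lra.
Qed.

End Pencil.

(** * The formal solution *)

Section FormalSolution.
Context {R : realType} {V : finType}.
Variables (B : V -> V -> V -> V -> R) (G : V -> V -> V -> R) (phi : V -> V -> R).
Hypothesis P : forall x, pencil (B x) (G x).
Variables (a0 : V -> R).
Hypothesis a0_gt0 : forall v, 0 < a0 v.
Local Notation "0+" := ((0 : R)^'+).

Definition drift (l : V -> fps R) (x : V) : fps R := \sum_y fpsC (phi x y) * l y.

Lemma trfE k (f : fps R) i : (i < k)%N -> trf k f i = f i.
Proof. by rewrite /trf => ->. Qed.

Lemma fpsM_eq k (f f' g g' : fps R) : (forall i, (i <= k)%N -> f i = f' i) ->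
  (forall i, (i <= k)%N -> g i = g' i) -> (f * g) k = (f' * g') k.
Proof.
move=> ff' gg'; rewrite !fpsM; apply: eq_bigr => i _.
by rewrite ff' ?leq_ord// gg'// leq_subr.
Qed.

Definition rhs_coef (s : (V -> fps R) * (V -> fps R)) x : fps R :=
  s.1 x ^+ 2 * drift s.2 x.

Definition next_a k (s : (V -> fps R) * (V -> fps R)) : V -> fps R := fun x =>
  s.1 x + fpsX ^+ k.+1 * fpsC (- rhs_coef s x k / k.+1%:R).

Definition next_mu k (s : (V -> fps R) * (V -> fps R)) x : R :=
  xget 0 [set mu | exists C : R, \forall t \near 0+,
    `|kap (B x) (G x) (fun v => ev (next_a k s v) t) - ev (s.2 x) t
      - mu * t ^+ k.+1| <= C * t ^+ k.+2].

(** Coefficient [k + 1] of [a] depends on both series up to order [k] only, because of the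
    derivative, while coefficient [k + 1] of [l] is read off from the curvature along [a] up to
    order [k + 1]. So [a] is extended before [l]. *)
Fixpoint state k : (V -> fps R) * (V -> fps R) := match k with
  | 0 => (fun x => fpsC (a0 x), fun x => fpsC (kap (B x) (G x) a0))
  | k.+1 => let s := state k in
     (next_a k s, fun x => s.2 x + fpsX ^+ k.+1 * fpsC (next_mu k s x))
  end.

Lemma fpsXnC k (c : R) i : (fpsX ^+ k * fpsC c) i = if i == k then c else 0.
Proof.
rewrite fpsXnM /fpsC subn_eq0; case: ltngtP => // _; exact: eqxx.
Qed.

Lemma state1S k x i :
  (state k.+1).1 x i = if i == k.+1 then (state k).1 x i - rhs_coef (state k) x k / k.+1%:R
    else (state k).1 x i.
Proof.
by rewrite /= /next_a fpsD fpsXnC; case: eqP => _; rewrite ?addr0// mulNr.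
Qed.

Lemma state2S k x i : (state k.+1).2 x i
  = if i == k.+1 then (state k).2 x i + next_mu k (state k) x else (state k).2 x i.
Proof. by rewrite /= fpsD fpsXnC; case: eqP => _; rewrite ?addr0. Qed.

Lemma state_fin k x i : (k < i)%N -> (state k).1 x i = 0 /\ (state k).2 x i = 0.
Proof.
elim: k i => [|k IH] i ki; first by rewrite /= /fpsC gtn_eqF.
by rewrite state1S state2S gtn_eqF//; apply: IH; exact: ltnW.
Qed.

Lemma state_conv k x : conv ((state k).1 x) /\ conv ((state k).2 x).
Proof.
by split; apply: (@conv_fin _ _ k.+1) => i ki; have [] := state_fin x ki.
Qed.

Lemma state0 k x : (state k).1 x 0%N = a0 x.
Proof. by elim: k => // k IH; rewrite state1S. Qed.

Definition sola x : fps R := fun k => (state k).1 x k.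
Definition soll x : fps R := fun k => (state k).2 x k.

Lemma stateE k i x : (i <= k)%N ->
  (state k).1 x i = sola x i /\ (state k).2 x i = soll x i.
Proof.
elim: k => [|k IH]; first by rewrite leqn0 => /eqP ->.
rewrite leq_eqVlt ltnS => /predU1P[-> //|ik].
by rewrite state1S state2S ltn_eqF//; exact: IH.
Qed.

Lemma state_trf k x :
  (state k).1 x = trf k.+1 (sola x) /\ (state k).2 x = trf k.+1 (soll x).
Proof.
split; apply/funext => i; rewrite /trf ltnS; case: leqP => ik.
- by have [] := stateE x ik.
- by have [] := state_fin x ik.
- by have [] := stateE x ik.
- by have [] := state_fin x ik.
Qed.

Lemma state_near_pos k : \forall t \near 0+, forall v,
  a0 v / 2 <= ev ((state k).1 v) t <= a0 v / 2 * 3.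
Proof.
apply: near_all => v; have [cv _] := state_conv k v.
have a02 : 0 < a0 v / 2 by rewrite divr_gt0.
have [C C0 HC] := near_ev_cst cv.
move: HC (near_mul_lt C a02); apply: filterS2 => t.
rewrite state0 ler_norml => /andP[h1 h2] h3; apply/andP; split; lra.
Qed.

(** Adding a term in [t^(k+1)] to [a] moves the curvature by [O(t^(k+1))], by the Lipschitz bound,
    so the old [l] remains precise enough to extract the next coefficient. *)
Lemma state_kap k x : exists C : R, \forall t \near 0+,
  `|kap (B x) (G x) (fun v => ev ((state k).1 v) t) - ev ((state k).2 x) t|
    <= C * t ^+ k.+1.
Proof.
elim: k => [|k [C HC]].
  exists 0; apply: filterS (@near0_gt R) => t _ /=.
  under [X in kap _ _ X]eq_fun do rewrite ev_fpsC.
  by rewrite ev_fpsC subrr normr0 mul0r.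
have [lo [hi [lo0 lohi lohiP]]] : exists lo hi : R, [/\ 0 < lo, lo <= hi &
    forall v, lo <= a0 v / 2 /\ a0 v / 2 * 3 <= hi].
  (* Both bounds start from 1, whence [lo <= 1 <= hi]. *)
  exists (\big[Num.min/1]_v (a0 v / 2)), (\big[Num.max/1]_v (a0 v / 2 * 3)).
  split.
  - by apply: lt_bigmin => // v _; rewrite divr_gt0.
  - by apply: (@le_trans _ _ 1); [exact: bigmin_le_id|exact: bigmax_ge_id].
  move=> v; split; [exact: bigmin_le_cond|exact: (le_bigmax _ (fun v => a0 v / 2 * 3))].
have [L L0 HL] := kap_lip (P x) lo0 lohi.
pose D := \sum_v `|rhs_coef (state k) v k / k.+1%:R|.
have step : exists mu C : R, \forall t \near 0+,
    `|kap (B x) (G x) (fun v => ev ((state k.+1).1 v) t) - ev ((state k).2 x) t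
     - mu * t ^+ k.+1| <= C * t ^+ k.+2.
  apply: kap_step => //.
  - by move=> v; have [] := state_conv k.+1 v.
  - by move=> v; rewrite state0.
  - by have [] := state_conv k x.
  exists (C + L * D).
  have evX : \forall t \near 0+, forall v, ev ((state k.+1).1 v) t
      = ev ((state k).1 v) t + t ^+ k.+1 * (- rhs_coef (state k) v k / k.+1%:R).
    apply: near_all => v /=; rewrite /next_a.
    have cX := @conv_fpsXn R k.+1.
    have cC : conv (fpsC (- rhs_coef (state k) v k / k.+1%:R)) by exact: conv_fpsC.
    apply: filterS2 (near_evD (state_conv k v).1 (convM cX cC))
      (near_evM cX cC) => t -> ->.
    by rewrite ev_fpsXn ev_fpsC.
  apply: filterS4 (filterI HC (@near0_gt R)) (state_near_pos k)
    (state_near_pos k.+1) evX => t [{}HC t0] h1 h2 h3.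
  have : `|kap (B x) (G x) (fun v => ev ((state k.+1).1 v) t)
      - kap (B x) (G x) (fun v => ev ((state k).1 v) t)| <= L * (D * t ^+ k.+1).
    apply: HL.
  - by rewrite mulr_ge0 ?exprn_ge0 ?(ltW t0)// sumr_ge0.
  - move=> v; have /andP[h4 h5] := h2 v; have [h6 h7] := lohiP v.
    by rewrite (le_trans h6)//= (le_trans h5).
  - move=> v; have /andP[h4 h5] := h1 v; have [h6 h7] := lohiP v.
    by rewrite (le_trans h6)//= (le_trans h5).
  move=> v; rewrite h3 addrC addKr normrM (gtr0_norm (exprn_gt0 _ t0)) mulrC.
  rewrite ler_wpM2r ?exprn_ge0 ?(ltW t0)// mulNr normrN.
    by rewrite /D (bigD1 v)//= lerDl sumr_ge0.
  by move: HC; rewrite !ler_norml => /andP[u1 u2] /andP[u3 u4]; apply/andP; split; lra.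
have : exists C : R, \forall t \near 0+,
    `|kap (B x) (G x) (fun v => ev ((state k.+1).1 v) t) - ev ((state k).2 x) t
     - next_mu k (state k) x * t ^+ k.+1| <= C * t ^+ k.+2.
  have [mu Hmu] := step.
  by rewrite /next_mu; case: xgetP => [nu _ //|/(_ mu)].
move=> [D' HD']; exists D'.
have cX := @conv_fpsXn R k.+1.
have cC : conv (fpsC (next_mu k (state k) x)) by exact: conv_fpsC.
apply: filterS3 HD' (near_evD (state_conv k x).2 (convM cX cC))
      (near_evM cX cC) => t + /= -> ->.
by rewrite ev_fpsXn ev_fpsC opprD addrA (mulrC (t ^+ _)).
Qed.

Lemma formal_solution : exists a l : V -> fps R,
  [/\ forall x, a x 0%N = a0 x,
   forall x k, k.+1%:R * a x k.+1 = - (a x ^+ 2 * drift l x) k &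
   forall k x, exists C : R, \forall t \near 0+,
     `|kap (B x) (G x) (fun v => ev (trf k.+1 (a v)) t) - ev (trf k.+1 (l x)) t|
       <= C * t ^+ k.+1].
Proof.
exists sola, soll; split=> [x|x k|k x]; first exact: state0.
  rewrite /sola state1S eqxx (state_fin x (ltnSn k)).1 add0r mulrN; congr (- _).
  rewrite mulrC divfK ?pnatr_eq0// /rhs_coef; apply: fpsM_eq => i ik.
    by rewrite !expr2; apply: fpsM_eq => j ji;
      rewrite (stateE x (leq_trans ji ik)).1.
  rewrite /drift !fps_sum; apply: eq_bigr => y _.
  by rewrite !fpsCM (stateE y ik).2.
have [C HC] := state_kap k x; exists C; move: HC; apply: filterS => t.
rewrite (state_trf k x).2.
by under [X in kap _ _ X]eq_fun => v do rewrite (state_trf k v).1.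
Qed.

End FormalSolution.

(** * Kernel vectors over formal power series *)

Section ColumnReduction.
Context {R : realType} {V : finType}.
Implicit Types (M N : V -> V -> fps R).

(** Gaussian elimination of columns over a valuation ring. Pivoting on an entry of minimal order
    keeps the coefficients [c] free of denominators, so dependent columns are combinations with
    power series coefficients. The columns in [J] are independent, with a left inverse [N] up to the
    denominator [X^r]. *)
Lemma column_reduction (S : {set V}) M : exists (J : {set V}) (r : nat) N,
  [/\ J \subset S,
   forall j l, j \in J -> l \in J ->
     \sum_p N j p * M p l = fpsX ^+ r * delta j l &
   forall z, z \in S -> z \notin J ->
     exists c : V -> fps R, forall p, M p z = \sum_(j in J) M p j * c j].
Proof.
have [n] := ubnP #|S|; elim: n S M => // n IH S M; rewrite ltnS => Sn.
pose MS (pz : V * V) := if pz.2 \in S then M pz.1 pz.2 else 0.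
have [M0|[e [[[p0 q] Mpq] Me]]] := min_order MS.
  exists finset.set0, 0%N, (fun _ _ => 0); split.
  - exact: finset.sub0set.
  - by move=> j l; rewrite inE.
  move=> z zS _; exists (fun=> 0) => p; rewrite big_set0.
  by have := M0 (p, z); rewrite /MS /= zS.
have {Mpq}[qS Mpq] : q \in S /\ M p0 q e <> 0.
  by move: Mpq; rewrite /MS /=; case: ifP => // _; rewrite fps0.
pose M' p z := shf e (M p z).
have {Me MS}Me p z : z \in S -> M p z = fpsX ^+ e * M' p z.
  by move=> zS; have := Me (p, z); rewrite /MS /= zS.
have [g ug] : exists g, M' p0 q * g = 1.
  by apply: fps_unitP; rewrite /M' /shf addn0; apply/eqP.
pose a p := M' p q * g; pose M1 p z := M p z - a p * M p0 z.
have aE p : M p q = a p * M p0 q.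
  by rewrite !Me// /a -mulrA (mulrCA g) (mulrC g) ug mulr1 mulrC.
have [J1 [r1 [N1 [J1S HN1 Hc1]]]] : exists (J : {set V}) (r : nat) N,
  [/\ J \subset (S :\ q)%SET,
   forall j l, j \in J -> l \in J ->
     \sum_p N j p * M1 p l = fpsX ^+ r * delta j l &
   forall z, z \in (S :\ q)%SET -> z \notin J ->
     exists c : V -> fps R, forall p, M1 p z = \sum_(j in J) M1 p j * c j].
  by apply: IH; move: Sn; rewrite (cardsD1 q) qS.
have qJ1 : q \notin J1.
  by apply/negP => /(fintype.subsetP J1S); rewrite !inE eqxx.
have J1S' j : j \in J1 -> j \in S by move=> /(fintype.subsetP J1S); rewrite !inE => /andP[].
have J1q j : j \in J1 -> (j == q) = false.
  by move=> jJ; apply: contraNF qJ1 => /eqP <-.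
(* Rows of [N1] corrected along [p0] so as to see [M] as [M1], which has a zero column [q]; the
   factor [X^e] brings them to the common exponent [r1 + e]. *)
pose N2 j p := fpsX ^+ e * (N1 j p - delta p0 p * \sum_p' N1 j p' * a p').
have N2E j l : \sum_p N2 j p * M p l = fpsX ^+ e * \sum_p N1 j p * M1 p l.
  have -> : \sum_p N1 j p * M1 p l
      = \sum_p N1 j p * M p l - (\sum_p N1 j p * a p) * M p0 l.
    by rewrite mulr_suml -sumrB; apply: eq_bigr => p _; rewrite /M1; ring.
  have -> : (\sum_p N1 j p * a p) * M p0 l
      = \sum_p (\sum_p' N1 j p' * a p') * M p l * delta p0 p.
    by rewrite sum_delta.
  rewrite -sumrB mulr_sumr; apply: eq_bigr => p _; rewrite /N2; ring.
have N2q j : \sum_p N2 j p * M p q = 0.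
  by rewrite N2E big1 ?mulr0// => p _; rewrite /M1 aE subrr mulr0.
(* Row [p0] itself, cleared of the columns in [J1] by the rows [N2] and normalized at [q] by the
   inverse [g] of the unit. *)
pose Nq p := g * (fpsX ^+ r1 * delta p0 p - \sum_(j in J1) M' p0 j * N2 j p).
have NqE l : \sum_p Nq p * M p l = g * (fpsX ^+ r1 * M p0 l
    - \sum_(j in J1) M' p0 j * \sum_p N2 j p * M p l).
  have -> : fpsX ^+ r1 * M p0 l = \sum_p fpsX ^+ r1 * M p l * delta p0 p.
    by rewrite sum_delta.
  under [X in _ = g * (_ - X)]eq_bigr do rewrite mulr_sumr.
  rewrite [X in _ = g * (_ - X)]exchange_big -sumrB mulr_sumr.
  apply: eq_bigr => p _ /=; rewrite /Nq -mulrA; congr (g * _).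
  rewrite mulrBl mulr_suml; congr (_ - _); first ring.
  by apply: eq_bigr => j _; rewrite mulrA.
exists (q |: J1)%SET, (r1 + e)%N, (fun j => if j == q then Nq else N2 j); split.
- by apply/fintype.subsetP => j; rewrite !inE => /predU1P[->//|/J1S'].
- move=> j l; rewrite !inE => jJ lJ; have [->|jq] := eqVneq j q.
    rewrite NqE; move: lJ => /predU1P[->|lJ].
      rewrite big1 ?subr0 => [|k _]; last by rewrite N2q mulr0.
      by rewrite /delta eqxx mulr1 Me// exprD -[RHS]mulr1 -ug; ring.
    rewrite (bigD1 l)//= N2E HN1// big1 ?addr0 => [|k /andP[kJ kl]].
      have -> : delta q l = 0 :> fps R by rewrite /delta J1q.
      have -> : delta l l = 1 :> fps R by rewrite /delta eqxx.
      rewrite Me ?J1S'//; ring.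
    rewrite N2E HN1// /delta eq_sym (negbTE kl) !mulr0 //.
  have {jJ}jJ : j \in J1 by move: jJ; rewrite (negbTE jq).
  move: lJ => /predU1P[->|lJ].
    by rewrite N2q /delta eq_sym (negbTE jq) mulr0.
  by rewrite N2E HN1// mulrA -exprD addnC.
move=> z zS; rewrite !inE negb_or => /andP[zq zJ].
have [|c Hc] := Hc1 z _ zJ; first by rewrite !inE zq.
(* The residue of column [z] in the pivot row, divided by [X^e]; the pivot column must make up for
   it. *)
pose d := M' p0 z - \sum_(j in J1) M' p0 j * c j.
exists (fun j => if j == q then g * d else c j) => p.
rewrite big_setU1//= eqxx.
rewrite (eq_bigr (fun j => M p j * c j)); last by move=> j jJ; rewrite J1q.
have Mz : M p z - \sum_(j in J1) M p j * c j
    = a p * (M p0 z - \sum_(j in J1) M p0 j * c j).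
  have := Hc p; rewrite /M1.
  rewrite (eq_bigr (fun j => M p j * c j - a p * (M p0 j * c j))).
    by rewrite sumrB -mulr_sumr => h; rewrite mulrBr -[X in X - _](subrK (a p * M p0 z)) h; ring.
  by move=> j _; ring.
have M0z : M p0 z - \sum_(j in J1) M p0 j * c j = fpsX ^+ e * d.
  rewrite /d mulrBr -Me// mulr_sumr; congr (_ - _).
  by apply: eq_bigr => j jJ; rewrite mulrA -Me// J1S'.
rewrite -[LHS](subrK (\sum_(j in J1) M p j * c j)) Mz M0z; congr (_ + _).
rewrite aE Me//.
have -> : a p * (fpsX ^+ e * M' p0 q) * (g * d)
  = a p * (fpsX ^+ e * d) * (M' p0 q * g) by ring.
by rewrite ug mulr1.
Qed.

End ColumnReduction.

(** * Singularity of the formal matrix and its kernel vector *)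

Section Kernel.
Context {R : realType} {V : finType}.
Implicit Types (M : V -> V -> R) (f g : V -> R).
Local Notation "0+" := ((0 : R)^'+).

Lemma sqnD f g (s t : R) : sqn (fun j => s * f j + t * g j)
  <= 2 * (s ^+ 2 * sqn f) + 2 * (t ^+ 2 * sqn g).
Proof.
rewrite /sqn !mulr_sumr -big_split; apply: ler_sum => j _ /=.
by have := sqr_ge0 (s * f j - t * g j); nra.
Qed.

Lemma sqn_eq0 f : sqn f = 0 -> f = fun=> 0.
Proof.
move=> /eqP; rewrite psumr_eq0 => [/allP f0|j _]; last exact: sqr_ge0.
apply/funext => j; have := f0 j (mem_index_enum j).
by rewrite /= sqrf_eq0 => /eqP.
Qed.

Lemma sqn_mv_le M f : sqn (mv M f)
  <= (\sum_p \sum_l \sum_m `|M p l * M p m|) * sqn f.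
Proof. by rewrite mulr_suml; apply: ler_sum => p _; exact: sqn_dot_le. Qed.

Lemma near_entries (B : V -> V -> fps R) : mconv B -> exists2 C : R, 0 < C &
  \forall t \near 0+, forall i j, `|evm B t i j| <= C.
Proof.
move=> cB; have /choice[D HD] : forall ij : V * V, exists D : R, 0 < D /\
    \forall t \near 0+, `|evm B t ij.1 ij.2| <= D.
  by move=> ij; have [D] := near_ev_bound (cB ij.1 ij.2); exists D.
exists (1 + \sum_ij D ij).
  by rewrite ltr_wpDr// sumr_ge0// => ij _; have [/ltW] := HD ij.
apply: near_all => i; apply: near_all => j; have [_] := HD (i, j).
apply: filterS => t /le_trans; apply.
rewrite (bigD1 (i, j))//= addrCA lerDl addr_ge0// sumr_ge0// => ij _.
by have [/ltW] := HD ij.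
Qed.

Lemma near_sqn_mv (B : V -> V -> fps R) : mconv B -> exists2 C : R, 0 < C &
  \forall t \near 0+, forall f, sqn (mv (evm B t) f) <= C * sqn f.
Proof.
move=> cB; have [C C0 HC] := near_entries cB.
exists (1 + \sum_(p : V) \sum_(l : V) \sum_(m : V) C * C).
  rewrite ltr_wpDr//; do 3 (apply: sumr_ge0 => ? _).
  by rewrite mulr_ge0 ?ltW.
apply: filterS HC => t HC f; apply: (le_trans (sqn_mv_le _ _)).
rewrite ler_wpM2r ?sqn_ge0// ler_wpDl//; do 3 (apply: ler_sum => ? _).
by rewrite normrM ler_pM.
Qed.

Lemma near_mv_mul (N M : V -> V -> fps R) : mconv N -> mconv M ->
  \forall t \near 0+, forall f j, mv (evm N t) (mv (evm M t) f) j
    = mv (evm (fun j l => \sum_p N j p * M p l) t) f j.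
Proof.
move=> cN cM; have : \forall t \near 0+, forall j l,
    ev (\sum_p N j p * M p l) t = \sum_p ev (N j p) t * ev (M p l) t.
  apply: near_all => j; apply: near_all => l.
  have cNM p : conv (N j p * M p l) by exact: convM.
  have : \forall t \near 0+, forall p,
      ev (N j p * M p l) t = ev (N j p) t * ev (M p l) t.
    by apply: near_all => p; exact: near_evM.
  move: (near_ev_sum cNM); apply: filterS2 => t -> H.
  by apply: eq_bigr => p _.
apply: filterS => t H f j; rewrite /mv; under [RHS]eq_bigr do rewrite /evm H mulr_suml.
rewrite exchange_big; apply: eq_bigr => p _ /=; rewrite mulr_sumr.
by apply: eq_bigr => l _; rewrite mulrA.
Qed.

Variables (B : V -> V -> V -> R) (G : V -> V -> R).
Hypothesis P : pencil B G.
Variables (a : V -> fps R) (l : fps R).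
Hypothesis a0 : forall v, 0 < a v 0%N.
Hypothesis al : forall k, exists C : R, \forall t \near 0+,
     `|kap B G (fun v => ev (trf k.+1 (a v)) t) - ev (trf k.+1 l) t|
       <= C * t ^+ k.+1.

(** Near the maximum [kap] some [f] almost annihilates the psd form, hence the matrix: [M f] is
    [O(t^(r+1))] times [f]. A left inverse up to [X^r] would bound [t^r |f|] by a multiple of
    [t^(r+1) |f|]. *)
Lemma pform_no_left_inverse N r :
  ~ (forall j m, \sum_p N j p * pform B G a l p m = fpsX ^+ r * delta j m).
Proof.
(* Convergence is not known yet, so [a], [l] and [N] are truncated. Modulo [X^(r+1)] the product is
   unchanged, and [E] collects the rest. *)
move=> NE; pose p v := trf r.+1 (a v); pose lp := trf r.+1 l.
have cp v : conv (p v) by exact: conv_trf.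
have clp : conv lp by exact: conv_trf.
pose N' j q := trf r.+1 (N j q).
have cN' : mconv N' by move=> j q; exact: conv_trf.
pose M := pform B G p lp; have cM : mconv M by exact: pform_conv.
pose E j m := shf r.+1 (\sum_q N' j q * M q m).
have cE : mconv E.
  by move=> j m; apply: conv_shf; apply: conv_sum => q; exact: convM.
have coefNM j m i : (i <= r)%N -> (\sum_q N' j q * M q m) i = (fpsX ^+ r * delta j m) i.
  move=> ir; rewrite -NE !fps_sum; apply: eq_bigr => q _; apply: fpsM_eq => i' i'i.
    by rewrite /N' trfE// ltnS (leq_trans i'i).
  have i'r : (i' < r.+1)%N by rewrite ltnS (leq_trans i'i).
  rewrite /M /pform !fpsB !fps_sum; congr (_ - _).
    apply: eq_bigr => v _; apply: fpsM_eq => // i2 i2i'.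
    by rewrite /p trfE// (leq_ltn_trans i2i').
  apply: fpsM_eq => // i2 i2i'.
  by rewrite /lp trfE// (leq_ltn_trans i2i').
have NME j m : \sum_q N' j q * M q m = fpsX ^+ r * delta j m + fpsX ^+ r.+1 * E j m.
  rewrite {1}(trf_shf r.+1 (\sum_q N' j q * M q m)); congr (_ + _).
  apply/funext => i; rewrite /trf; case: ltnP => ir; first by rewrite coefNM.
  rewrite fpsXnM ltnNge (ltnW ir) /= /delta; case: (m == j).
    by rewrite mulr1n fps1 subn_eq0 leqNgt ir.
  by rewrite mulr0n fps0.
have evNM : \forall t \near 0+, forall f j, mv (evm N' t) (mv (evm M t) f) j
    = t ^+ r * f j + t ^+ r.+1 * mv (evm E t) f j.
  have cX k : conv (fpsX ^+ k : fps R) by exact: conv_fpsXn.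
  have cd (j m : V) : conv (delta j m : fps R).
    rewrite (_ : delta j m = fpsC (delta j m)); first exact: conv_fpsC.
    by rewrite /delta; case: eqP; rewrite ?rmorph1 ?rmorph0.
  have : \forall t \near 0+, forall j m,
      ev (\sum_q N' j q * M q m) t = t ^+ r * delta m j + t ^+ r.+1 * ev (E j m) t.
    apply: near_all => j; apply: near_all => m.
    have e1 := near_evD (convM (cX r) (cd j m)) (convM (cX r.+1) (cE j m)).
    have e2 := near_evM (cX r) (cd j m).
    have e3 := near_evM (cX r.+1) (cE j m).
    apply: filterS3 e1 e2 e3 => t; rewrite -NME => -> -> ->; rewrite !ev_fpsXn; congr (_ * _ + _).
    rewrite (_ : delta j m = fpsC (delta m j)) ?ev_fpsC//.
    by rewrite /delta eq_sym; case: eqP; rewrite ?rmorph1 ?rmorph0.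
  move: (near_mv_mul cN' cM); apply: filterS2 => t H1 H2 f j; rewrite H1.
  rewrite -(sum_delta f) /mv !mulr_sumr -big_split; apply: eq_bigr => m _ /=.
  by rewrite /evm H2 /delta (eq_sym m j); ring.
have [C HC] := al r; have [_ [sG pG] _ _ _] := P.
have [CN CN0 HCN] := near_sqn_mv cN'.
have [CE CE0 HCE] := near_sqn_mv cE.
have [CM CM0 HCM] := near_entries cM.
pose gG := \sum_i \sum_j `|G i j|.
have gG0 : 0 <= gG by rewrite sumr_ge0// => i _; rewrite sumr_ge0.
pose mG := \sum_p \sum_l \sum_m `|G p l * G p m|.
have mG0 : 0 <= mG by do 3 (rewrite sumr_ge0// => ? _).
have pos : \forall t \near 0+, forall v, 0 <= ev (p v) t.
  apply: near_all => v; have pv0 : 0 < p v 0%N by exact: a0.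
  apply: filterS (near_ev_pos (cp v) pv0) => t.
  by apply: le_trans; rewrite divr_ge0// ltW.
pose n : R := #|V|%:R; have n0 : 0 <= n by [].
pose C1 := n * ((CM + `|C| * gG) * gG).
have C10 : 0 <= C1 by rewrite !mulr_ge0// addr_ge0 ?mulr_ge0// ltW.
pose C2 := 2 * C1 + 2 * (C ^+ 2 * mG).
pose C3 := 2 * (CN * C2) + 2 * CE.
have H01 := near0_lt (@ltr01 R).
have small := near_mul_lt C3 (@ltr01 R).
have : \forall t \near 0+, False.
  apply: filterS4 (filterI (@near0_gt R) (filterI HC pos)) (filterI evNM HCN)
    (filterI HCE HCM) (filterI H01 (filterI small (near_qf_pform B G cp clp))).
  move=> t [t0 [{}HC {}pos]] [{}evNM {}HCN] [{}HCE {}HCM] [t1 [st evM]].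
  set K := kap _ _ _ in HC.
  have t2 : 0 < t ^+ (r.+1 * 2) by rewrite exprn_gt0.
  (* The exponent is doubled because [psd_mv] controls the square of the matrix applied to [f] by
     the value of the form. *)
  have [|f Hf] := (kapP P pos).2 (K + t ^+ (r.+1 * 2)); first by rewrite ltrDl.
  have K1 := (kapP P pos).1; rewrite -/K in K1.
  pose MK i j := 1 * evm M t i j + - (K - ev lp t) * G i j.
  have qMK g : qf MK g = lform B (fun v => ev (p v) t) g - K * qf G g.
    by rewrite qf_matlin evM; ring.
  have sMK : msym MK.
    by move=> i j; rewrite /MK sG /evm /M (pform_sym P p lp i j).
  have pMK : psd MK by move=> g; rewrite qMK subr_ge0.
  have qf_small : qf MK f <= t ^+ (r.+1 * 2) * (gG * sqn f).
    have := norm_qf G f; rewrite ler_norml => /andP[_ h].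
    by have := ler_wpM2l (ltW t2) h; rewrite qMK /gG; lra.
  have MKpp i : 0 <= MK i i <= CM + `|C| * gG.
    have := pMK (delta i); rewrite qf_delta => -> /=.
    have := HCM i i; rewrite ler_norml => /andP[_ h].
    have : `|(K - ev lp t) * G i i| <= `|C| * gG.
      rewrite normrM ler_pM//.
        apply: (le_trans HC); rewrite (le_trans (ler_norm _))// normrM.
        rewrite ler_piMr// (ger0_norm (exprn_ge0 _ (ltW t0))).
        by rewrite exprn_ile1// ltW.
      rewrite /gG (bigD1 i)//= (bigD1 i)//= -addrA lerDl addr_ge0//.
        by rewrite sumr_ge0.
      by rewrite sumr_ge0// => ? _; rewrite sumr_ge0.
    by rewrite ler_norml => /andP[h2 _]; rewrite /MK; lra.
  have h1 : sqn (mv MK f) <= C1 * (t ^+ (r.+1 * 2) * sqn f).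
    have -> : C1 * (t ^+ (r.+1 * 2) * sqn f)
       = \sum_(i : V) ((CM + `|C| * gG) * gG) * (t ^+ (r.+1 * 2) * sqn f).
      by rewrite sumr_const /C1 /n; rewrite -[RHS]mulr_natl; ring.
    apply: ler_sum => i _; apply: (le_trans (psd_mv f i sMK pMK)).
    have /andP[m0 m1] := MKpp i.
    apply: (@le_trans _ _ (MK i i * (t ^+ (r.+1 * 2) * (gG * sqn f)))).
      by rewrite ler_wpM2l.
    apply: (@le_trans _ _ ((CM + `|C| * gG) * (t ^+ (r.+1 * 2) * (gG * sqn f)))).
      by rewrite ler_wpM2r// mulr_ge0 ?(ltW t2)// mulr_ge0 ?sqn_ge0.
    by rewrite le_eqVlt; apply/orP; left; apply/eqP; ring.
  have h2 : sqn (mv (evm M t) f) <= C2 * (t ^+ (r.+1 * 2) * sqn f).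
    have -> : mv (evm M t) f = fun i => 1 * mv MK f i + (K - ev lp t) * mv G f i.
      apply/funext => i; rewrite /mv !mulr_sumr -big_split; apply: eq_bigr => j _.
      by rewrite /MK /=; ring.
    apply: (le_trans (sqnD _ _ _ _)).
    have k1 : (K - ev lp t) ^+ 2 <= C ^+ 2 * t ^+ (r.+1 * 2).
      rewrite exprM -exprMn -(real_normK (num_real (K - _))).
      by rewrite lerXn2r ?nnegrE// (le_trans _ HC).
    have k2 := sqn_mv_le G f; rewrite -/mG in k2.
    have : (K - ev lp t) ^+ 2 * sqn (mv G f)
        <= C ^+ 2 * t ^+ (r.+1 * 2) * (mG * sqn f).
      by rewrite ler_pM ?sqr_ge0 ?sqn_ge0.
    by rewrite expr1n mul1r /C2; lra.
  have h3 : t ^+ (r * 2) * sqn f <= C3 * (t ^+ (r.+1 * 2) * sqn f).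
    have -> : t ^+ (r * 2) * sqn f = sqn (fun j => 1 * mv (evm N' t) (mv (evm M t) f) j
        + - t ^+ r.+1 * mv (evm E t) f j).
      rewrite /sqn mulr_sumr; apply: eq_bigr => j _; rewrite evNM exprM -exprMn.
      by congr (_ ^+ 2); ring.
    apply: (le_trans (sqnD _ _ _ _)); rewrite expr1n mul1r sqrrN -exprM.
    have k1 := HCN (mv (evm M t) f).
    have k2 := ler_wpM2l (ltW CN0) h2.
    have k3 := ler_wpM2l (ltW t2) (HCE f).
    by rewrite /C3; lra.
  have fpos : 0 < sqn f.
    rewrite lt_def sqn_ge0 andbT; apply/eqP => /sqn_eq0 f0.
    move: Hf; rewrite f0 /lform /qf /bil big1 => [|v _].
      by rewrite big1 ?mulr0 ?ltxx// => i _; rewrite mul0r.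
    by rewrite big1 ?mulr0// => i _; rewrite mul0r.
  move: h3; rewrite mulrA ler_pM2r// mulSn exprD -[leLHS]mul1r mulrA.
  rewrite ler_pM2r ?exprn_gt0// leNgt => /negP; apply.
  apply: le_lt_trans st; rewrite expr2 mulrA ler_piMr ?(ltW t1)//.
  rewrite mulr_ge0 ?(ltW t0)// /C3 /C2.
  have k1 : 0 <= C ^+ 2 * mG by rewrite mulr_ge0 ?sqr_ge0.
  have k2 : 0 <= CN * (2 * C1 + 2 * (C ^+ 2 * mG)).
    by rewrite mulr_ge0 ?(ltW CN0)//; lra.
  lra.
by move=> /filter_ex[].
Qed.

(** The independent columns cannot be all of them, as [N] would be a left inverse. A column [i]
    outside [J] is a combination of those in [J], and [v] is this relation, normalized by
    [v i = 1]. *)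
Lemma kernel_vector : exists (J : {set V}) (r : nat) (N : V -> V -> fps R)
    (i : V) (v : V -> fps R),
  [/\ i \notin J, v i = 1, forall j, j \notin J -> j != i -> v j = 0,
   forall p, \sum_z pform B G a l p z * v z = 0 &
   forall j m, j \in J -> m \in J ->
     \sum_p N j p * pform B G a l p m = fpsX ^+ r * delta j m].
Proof.
have [J [r [N [_ HN Hc]]]] := column_reduction (setTfor V) (pform B G a l).
have [i iJ] : exists i, i \notin J.
  apply: contrapT => /forallNP H; apply: (@pform_no_left_inverse N r) => j m.
  by apply: HN; apply/negPn/negP/H.
have [c cE] := Hc i (finset.in_setT i) iJ.
exists J, r, N, i, (fun j => if j == i then 1 else if j \in J then - c j else 0).
split=> //; first by rewrite eqxx.
  by move=> j jJ /negbTE ->; rewrite (negbTE jJ).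
move=> p; rewrite (bigD1 i)//= eqxx mulr1 cE.
rewrite [X in _ + X](bigID (mem J)) /= [X in _ + (_ + X)]big1 ?addr0; last first.
  by move=> j /andP[/negbTE -> /negbTE ->]; rewrite mulr0.
rewrite [X in _ + X](eq_bigl (mem J)); last first.
  by move=> j /=; case: eqP => [->|//]; rewrite (negbTE iJ).
rewrite -big_split big1// => j jJ /=; rewrite jJ ifN ?mulrN ?subrr//.
by apply: contraNneq iJ => <-.
Qed.
End Kernel.

(** * Convergence of the formal solution *)

Section Majorant.
Context {R : realType} {I : finType}.
Variable z : I -> fps R.
Implicit Types f g : fps R.

(** Stands for [f = h(z)] with [h] a polynomial in [z] over series converging at 1, without naming
    [h]: a bound on [z] gives one on [f], uniformly in the radius and in the truncation. *)
Definition dominated f := forall D : R, exists M : R, forall r n, 0 < r -> r <= 1 ->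
  (forall i, nrm r n (z i) <= D) -> nrm r n f <= M.

Lemma dom_z i : dominated (z i).
Proof. by move=> D; exists D => r n _ _. Qed.

Lemma domD f g : dominated f -> dominated g -> dominated (f + g).
Proof.
move=> df dg D; have [M HM] := df D; have [N HN] := dg D; exists (M + N).
move=> r n r0 r1 Hz; apply: (le_trans (nrmD _ _ _ (ltW r0))).
by rewrite lerD ?HM ?HN.
Qed.

Lemma domN f : dominated f -> dominated (- f).
Proof.
by move=> df D; have [M HM] := df D; exists M => r n *; rewrite nrmN HM.
Qed.

Lemma domM f g : dominated f -> dominated g -> dominated (f * g).
Proof.
move=> df dg D; have [M HM] := df D; have [N HN] := dg D; exists (M * N).
move=> r n r0 r1 Hz; apply: (le_trans (nrmM _ _ _ (ltW r0))).
by rewrite ler_pM ?HM ?HN ?nrm_ge0 ?(ltW r0).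
Qed.

Lemma dom_convr f : convr 1 f -> dominated f.
Proof.
move=> [C fC] D; exists C => r n r0 r1 _.
by rewrite (le_trans _ (fC n))// ler_nrm_r ?(ltW r0).
Qed.

Lemma dom0 : dominated 0.
Proof. by apply: dom_convr; apply: (@convr_fin _ _ _ 0) => // k _; rewrite fps0. Qed.

Lemma dom_sum (T : Type) (s : seq T) (F : T -> fps R) :
  (forall i, dominated (F i)) -> dominated (\sum_(i <- s) F i).
Proof. by move=> dF; apply: big_ind => //; [exact: dom0|exact: domD]. Qed.

Lemma dom_le f g : (forall k, `|f k| <= `|g k|) -> dominated g -> dominated f.
Proof.
move=> fg dg D; have [M HM] := dg D; exists M => r n r0 r1 Hz.
by apply: le_trans (HM _ _ r0 r1 Hz); apply: ler_nrm => //; exact: ltW.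
Qed.

Definition contracting f :=
  exists c h, [/\ f = c + fpsX * h, convr 1 c & dominated h].

(** Truncation [n + 1] of [X h] involves [h] only up to [n] and gains a factor [r]. For small [r]
    the bound [D] on all [z] thus reproduces itself by induction on [n]. *)
Lemma majorant : (forall i, contracting (z i)) ->
  exists2 r : R, 0 < r & forall i, convr r (z i).
Proof.
move=> H; have /choice[c /choice[h Hch]] : forall i, exists c h,
  [/\ z i = c + fpsX * h, convr 1 c & dominated h] by [].
have /choice[C HC] : forall i, exists C : R, forall n, nrm 1 n (c i) <= C.
  by move=> i; have [_ [C HC] _] := Hch i; exists C.
have C0 i : 0 <= C i by apply: le_trans (HC i 0%N); exact: nrm_ge0.
(* The constants [c] take up [C i], which leaves 1 for the terms [X h]; the radius [S^-1] is chosen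
   to keep these below 1. *)
pose D := 1 + \sum_i C i.
have /choice[M HM] : forall i, exists M : R, forall r n, 0 < r -> r <= 1 ->
    (forall i, nrm r n (z i) <= D) -> nrm r n (h i) <= M.
  by move=> i; have [_ _ /(_ D)] := Hch i.
pose S := 1 + \sum_i `|M i|; have S1 : 1 <= S by rewrite lerDl sumr_ge0.
have S0 : 0 < S by exact: lt_le_trans S1.
have r0 : 0 < S^-1 by rewrite invr_gt0.
have r1 : S^-1 <= 1 by rewrite invf_le1.
exists S^-1 => // i; exists D => n; elim: n i => [|n IH] i.
  by rewrite /nrm big_ord0 addr_ge0// sumr_ge0.
have [zE _ _] := Hch i; rewrite zE; apply: (le_trans (nrmD _ _ _ (ltW r0))).
have h1 : nrm S^-1 n.+1 (c i) <= C i.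
  by apply: le_trans (HC i n.+1); apply: ler_nrm_r => //; exact: ltW.
have h2 : nrm S^-1 n.+1 (fpsX * h i) <= 1.
  rewrite nrmXM ler_pdivrMl// mulr1 (le_trans (HM i _ _ r0 r1 IH))//.
  rewrite (le_trans (ler_norm _))// /S (bigD1 i)//= addrCA lerDl addr_ge0//.
  by rewrite sumr_ge0.
rewrite /D addrC lerD// (le_trans h1)// (bigD1 i)//= lerDl sumr_ge0//.
Qed.

End Majorant.

(** * Contracting equations for the curvature and the kernel vector at one vertex *)

Section OneVertex.
Context {R : realType} {V I : finType}.
Variables (B : V -> V -> V -> R) (G : V -> V -> R).
Hypothesis P : pencil B G.
Variables (a : V -> fps R) (l : fps R) (z : I -> fps R).
Hypothesis a0 : forall v, 0 < a v 0%N.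
Variables (J : {set V}) (r : nat) (N : V -> V -> fps R) (i : V) (v : V -> fps R).
Hypotheses (iJ : i \notin J) (vi : v i = 1)
  (vJ : forall j, j \notin J -> j != i -> v j = 0).
Hypothesis ker : forall p, \sum_q pform B G a l p q * v q = 0.
Hypothesis HN : forall j m, j \in J -> m \in J ->
  \sum_p N j p * pform B G a l p m = fpsX ^+ r * delta j m.

(* [a] and [l] are split at order [K] and the kernel vector at order [L].  The
   left inverse [N] loses [r] orders; with these values, after division by the
   powers of [X] common to all terms, every nonlinear term keeps a factor [X]. *)
Let L := r.+2.
Let K := (L + r.+1)%N.
Let y u := shf K (a u).
Let mu := shf K l.
Let om j := shf L (v j).
Hypotheses (dy : forall u, dominated z (y u)) (dmu : dominated z mu)
  (dom : forall j, dominated z (om j)) (dy1 : forall u, dominated z (shf 1 (y u))).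

Lemma convr1_trf k (f : fps R) : convr 1 (trf k f).
Proof. by apply: (@convr_fin _ _ _ k) => // n kn; rewrite /trf ltnNge kn. Qed.
Lemma convr1_M (f g : fps R) : convr 1 f -> convr 1 g -> convr 1 (f * g).
Proof. exact: convrM. Qed.
Lemma convr1_D (f g : fps R) : convr 1 f -> convr 1 g -> convr 1 (f + g).
Proof. exact: convrD. Qed.
Lemma convr1_sum (T : Type) (s : seq T) (F : T -> fps R) :
  (forall i, convr 1 (F i)) -> convr 1 (\sum_(i <- s) F i).
Proof.
move=> cF; apply: big_ind => //; last by move=> *; exact: convr1_D.
by apply: (@convr_fin _ _ _ 0) => // k _; rewrite fps0.
Qed.
Lemma convr1_C (c : R) : convr 1 (fpsC c). Proof. exact: convr_fpsC. Qed.
Lemma convr1_Xn k : convr 1 (fpsX ^+ k : fps R).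
Proof. by apply: (@convr_fin _ _ _ k.+1) => // n kn; rewrite fpsXnE gtn_eqF. Qed.
Lemma convr1_shf k (f : fps R) : convr 1 f -> convr 1 (shf k f).
Proof. exact: convr_shf. Qed.

Let M0 := pform B G (fun u => trf K (a u)) (trf K l).
Let E := pform B G y mu.
Let W j := trf L (v j).

Lemma pform_split p q : pform B G a l p q = M0 p q + fpsX ^+ K * E p q.
Proof.
rewrite /M0 /E /pform mulrBr addrACA -opprD mulr_sumr -big_split; congr (_ - _).
  by apply: eq_bigr => u _ /=; rewrite {1}(trf_shf K (a u)); rewrite /y; ring.
by rewrite {1}(trf_shf K l) /mu; ring.
Qed.

Lemma v_split j : v j = W j + fpsX ^+ L * om j.
Proof. exact: trf_shf. Qed.

Lemma convr_M0 p q : convr 1 (M0 p q).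
Proof.
apply: convr1_D; first apply: convr1_sum => u; last apply: convrN.
  by apply: convr1_M; [exact: convr1_trf|exact: convr1_C].
by apply: convr1_M; [exact: convr1_trf|exact: convr1_C].
Qed.

Lemma dom_E p q : dominated z (E p q).
Proof.
apply: domD; first apply: dom_sum => u; last apply: domN.
  by apply: domM => //; apply: dom_convr; exact: convr1_C.
by apply: domM => //; apply: dom_convr; exact: convr1_C.
Qed.

Lemma convr_W j : convr 1 (W j). Proof. exact: convr1_trf. Qed.

Lemma om_supp j : j \notin J -> om j = 0.
Proof.
move=> jJ; rewrite /om; have [->|ji] := eqVneq j i.
  by rewrite vi; apply/funext => k; rewrite /shf fps1 fps0.
by rewrite vJ// shf0.
Qed.

Lemma ker_split p : mv M0 W p + fpsX ^+ K * mv E W p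
  + fpsX ^+ L * mv M0 om p + fpsX ^+ (K + L) * mv E om p = 0.
Proof.
rewrite -[RHS](ker p) /mv !mulr_sumr -!big_split; apply: eq_bigr => q _ /=.
by rewrite pform_split v_split exprD; ring.
Qed.

(** In the kernel equation all other terms visibly carry the factor [X^L]. *)
Lemma mv_M0W p : mv M0 W p = fpsX ^+ L * shf L (mv M0 W p).
Proof.
have [h E'] : exists h, mv M0 W p = fpsX ^+ L * h; last by rewrite E' shf_fpsXn.
exists (- (fpsX ^+ r.+1 * mv E W p + mv M0 om p + fpsX ^+ K * mv E om p)).
have := ker_split p; rewrite /K !exprD => /eqP; rewrite -!addrA addr_eq0 => /eqP ->.
ring.
Qed.

Lemma sM0 : msym M0. Proof. exact: pform_sym. Qed.

(** The truncated left inverse, applied to the kernel equation, turns the term linear in [om] into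
    [X^(L + r) om j] up to higher order, and the equation can be divided by this power of [X]. *)
Lemma contracting_om j : contracting z (om j).
Proof.
have [jJ|jJ] := boolP (j \in J); last first.
  exists 0, 0; rewrite om_supp// mulr0 addr0; split=> //; last exact: dom0.
  by apply: (@convr_fin _ _ _ 0) => // k _; rewrite fps0.
pose N0 p := trf K (N j p).
have [Q [cQ QE]] : exists Q : V -> fps R, (forall m, convr 1 (Q m)) /\
  forall m, m \in J ->
    \sum_p N0 p * M0 p m = fpsX ^+ r * delta j m + fpsX ^+ K * Q m.
  exists (fun m => shf K (\sum_p N0 p * M0 p m - fpsX ^+ r * delta j m)); split.
    move=> m; apply: convr1_shf; apply: convr1_D.
      apply: convr1_sum => p; apply: convr1_M; last exact: convr_M0.
      exact: convr1_trf.
    apply: convrN; apply: convr1_M; first exact: convr1_Xn.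
    rewrite (_ : delta j m = fpsC (delta j m)); first exact: convr1_C.
    by rewrite /delta; case: eqP; rewrite ?rmorph1 ?rmorph0.
  move=> m mJ; have [h E'] : exists h, \sum_p N0 p * M0 p m - fpsX ^+ r * delta j m
      = fpsX ^+ K * h.
    exists (- \sum_p (N0 p * E p m + shf K (N j p) * pform B G a l p m)).
    rewrite -HN// -sumrB mulrN mulr_sumr -sumrN; apply: eq_bigr => p _.
    by rewrite {1}(trf_shf K (N j p)) -/(N0 p) pform_split; ring.
  by rewrite E' shf_fpsXn -E' addrC subrK.
have NM : \sum_p N0 p * mv M0 om p = fpsX ^+ r * om j + fpsX ^+ K * \sum_m Q m * om m.
  transitivity (\sum_m (\sum_p N0 p * M0 p m) * om m).
    under [RHS]eq_bigr do rewrite mulr_suml.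
    rewrite exchange_big; apply: eq_bigr => p _; rewrite mulr_sumr.
    by apply: eq_bigr => m _; rewrite mulrA.
  rewrite -[om j](sum_delta om) mulr_sumr mulr_sumr -big_split.
  apply: eq_bigr => m _ /=; have [mJ|/om_supp ->] := boolP (m \in J).
    by rewrite QE//; ring.
  by rewrite !mul0r !mulr0 addr0.
pose P0 := \sum_p N0 p * mv M0 W p.
pose T1 := \sum_p N0 p * mv E W p; pose T2 := \sum_p N0 p * mv E om p.
have tot : P0 + fpsX ^+ K * T1 + fpsX ^+ L * (\sum_p N0 p * mv M0 om p)
    + fpsX ^+ (K + L) * T2 = 0.
  rewrite -[RHS](_ : \sum_p N0 p * 0 = 0); last by rewrite big1// => p _; rewrite mulr0.
  rewrite /P0 /T1 /T2 !mulr_sumr -!big_split; apply: eq_bigr => p _ /=.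
  by rewrite -(ker_split p); ring.
rewrite NM in tot.
pose S := \sum_m Q m * om m.
(* As [K = L + r + 1], this division leaves [om j] bare and a factor [X] on every other unknown
   term. *)
have P0E : P0 = fpsX ^+ (L + r) * (- (om j + fpsX * T1 + fpsX ^+ r.+3 * (S + T2))).
  move: tot; rewrite -/S => /eqP; rewrite -!addrA addr_eq0 => /eqP ->.
  by rewrite /K /L !exprD !exprS; ring.
exists (- shf (L + r) P0), (- (T1 + fpsX ^+ r.+2 * (S + T2))); split.
- by rewrite P0E shf_fpsXn exprS; ring.
- apply: convrN; apply: convr1_shf; apply: convr1_sum => p; apply: convr1_M.
    exact: convr1_trf.
  apply: convr1_sum => q; apply: convr1_M; [exact: convr_M0|exact: convr_W].
have dN0 p : dominated z (N0 p) by apply: dom_convr; exact: convr1_trf.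
have dmv (f : V -> fps R) p : (forall q, dominated z (f q)) -> dominated z (mv E f p).
  by move=> df; apply: dom_sum => q; apply: domM => //; exact: dom_E.
apply: domN; apply: domD.
  apply: dom_sum => p; apply: domM => //; apply: dmv => q; apply: dom_convr.
  exact: convr_W.
apply: domM; first by apply: dom_convr; exact: convr1_Xn.
apply: domD; apply: dom_sum => p; apply: domM => //; last exact: dmv.
by apply: dom_convr.
Qed.

(** The constant vector of [v] is nonzero and lies in the kernel at time 0. If [G] vanished on it,
    so would [lform], against definiteness. *)
Lemma form_kernel_gt0 : 0 < qf G (fun j => v j 0%N).
Proof.
have [_ [sG pG] _ _ HP] := P; set w := fun j => _.
have [c [C [c0 C0 Hc]]] := HP (fun u => a u 0%N) a0.
have : lform B (fun u => a u 0%N) w - l 0%N * qf G w = 0.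
  rewrite -qf_lform /qf /bil big1// => p _; rewrite [X in _ * X](_ : _ = 0) ?mulr0//.
  have := congr1 (fun f : fps R => f 0%N) (ker p); rewrite fps0 fps_sum => k0.
  rewrite -[RHS]k0; apply: eq_bigr => q _; rewrite fpsM0 /pform fpsB fps_sum fpsM0; congr ((_ - _) * _).
  by apply: eq_bigr => u _; rewrite fpsM0.
have w1 : 1 <= sqn w.
  by apply: le_trans (ler_sqn w i); rewrite /w vi fps1 expr1n.
have := Hc w; rewrite lt_def pG andbT => h1 h2; apply/eqP => q0.
by move: h1 h2; rewrite q0 !mulr0; nra.
Qed.

(** Pair the kernel equation with the truncation [W] of [v]. By symmetry [W . M0 om] is [om . M0 W],
    which gains [L] further orders, and [2 L = K + 1]. After division by [X^K] the unknown [mu] has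
    the coefficient [gam], positive at 0. *)
Lemma contracting_mu : contracting z mu.
Proof.
have [sB [sG pG] _ _ _] := P.
pose beta u := \sum_p \sum_q W p * fpsC (B u p q) * W q.
pose gam := \sum_p \sum_q W p * fpsC (G p q) * W q.
have gam0 : gam 0%N = qf G (fun j => v j 0%N).
  rewrite /gam fps_sum /qf /bil; apply: eq_bigr => p _; rewrite fps_sum /mv mulr_sumr.
  by apply: eq_bigr => q _; rewrite !fpsM0 fpsC0 mulrA.
have g0 : gam 0%N != 0 by rewrite gam0 gt_eqF// form_kernel_gt0.
pose m1 p := shf L (mv M0 W p).
pose q0 := \sum_p W p * mv M0 W p.
pose S1 := \sum_p om p * m1 p; pose S2 := \sum_p W p * mv E om p.
have WEW : \sum_p W p * mv E W p = \sum_u y u * beta u - mu * gam.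
  rewrite /beta /gam; under [X in _ = X - _]eq_bigr do rewrite mulr_sumr.
  rewrite [X in _ = X - _]exchange_big /= mulr_sumr -sumrB; apply: eq_bigr => p _.
  under [X in _ = X - _]eq_bigr do rewrite mulr_sumr.
  rewrite [X in _ = X - _]exchange_big [X in _ = _ - X]mulr_sumr /= -sumrB /mv mulr_sumr.
  apply: eq_bigr => q _ /=.
  rewrite /E /pform mulrBl mulrBr; congr (_ - _); last ring.
  by rewrite mulr_suml mulr_sumr; apply: eq_bigr => u _; ring.
have WM : \sum_p W p * mv M0 om p = fpsX ^+ L * S1.
  transitivity (\sum_p om p * mv M0 W p); first exact: (bilC _ _ sM0).
  rewrite /S1 mulr_sumr; apply: eq_bigr => p _.
  by rewrite {1}mv_M0W /m1; ring.
have tot : q0 + fpsX ^+ K * (\sum_u y u * beta u - mu * gam)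
    + fpsX ^+ L * (fpsX ^+ L * S1) + fpsX ^+ (K + L) * S2 = 0.
  rewrite -[RHS](_ : \sum_p W p * 0 = 0); last by rewrite big1// => p _; rewrite mulr0.
  rewrite -WEW -WM /q0 /S2 !mulr_sumr -!big_split; apply: eq_bigr => p _ /=.
  by rewrite -(ker_split p); ring.
have q0E : q0 = fpsX ^+ K * (mu * gam - \sum_u y u * beta u - fpsX * S1 - fpsX ^+ L * S2).
  move: tot => /eqP; rewrite -!addrA addr_eq0 => /eqP ->.
  by rewrite /K /L !exprD !exprS; ring.
pose m0 := shf K q0.
have m0E : m0 = mu * gam - \sum_u y u * beta u - fpsX * S1 - fpsX ^+ L * S2.
  by rewrite /m0 q0E shf_fpsXn.
have gamE : gam = fpsC (gam 0%N) + fpsX * shf 1 gam.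
  rewrite {1}(trf_shf 1 gam) expr1; congr (_ + _).
  by apply/funext => -[|k]; rewrite /trf.
have yE : \sum_u y u * beta u = \sum_u fpsC (y u 0%N) * beta u
    + fpsX * \sum_u shf 1 (y u) * beta u.
  rewrite mulr_sumr -big_split; apply: eq_bigr => u _ /=.
  rewrite {1}(trf_shf 1 (y u)) expr1 mulrDl mulrA; congr (_ * _ + _).
  by apply/funext => -[|k]; rewrite /trf.
have cbeta u : convr 1 (beta u).
  by do 2 (apply: convr1_sum => ?); do ?apply: convr1_M; rewrite ?/W;
    try exact: convr1_trf; exact: convr1_C.
have cgam : convr 1 gam.
  by do 2 (apply: convr1_sum => ?); do ?apply: convr1_M; rewrite ?/W;
    try exact: convr1_trf; exact: convr1_C.
have cMW p : convr 1 (mv M0 W p).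
  by apply: convr1_sum => q; apply: convr1_M; [exact: convr_M0|exact: convr_W].
(* Only the constant term of [gam] is inverted. Its other terms, and those of [y u], carry a factor
   [X] and join the remainder. *)
exists (fpsC (gam 0%N)^-1 * (m0 + \sum_u fpsC (y u 0%N) * beta u)).
exists (fpsC (gam 0%N)^-1 * (\sum_u shf 1 (y u) * beta u + S1 + fpsX ^+ r.+1 * S2
  - shf 1 gam * mu)); split.
- rewrite -[LHS]mul1r -(rmorph1 fpsC) -(mulVf g0) rmorphM -mulrA.
  rewrite [fpsX * (_ * _)]mulrCA -mulrDr; congr (_ * _).
  have {}gamE : fpsC (gam 0%N) = gam - fpsX * shf 1 gam.
    by rewrite {2}gamE addrK.
  rewrite /= gamE m0E yE /L !exprS; ring.
- apply: convr1_M; first exact: convr1_C.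
  apply: convr1_D.
    apply: convr1_shf; apply: convr1_sum => p; apply: convr1_M => //.
    exact: convr_W.
  by apply: convr1_sum => u; apply: convr1_M => //; exact: convr1_C.
apply: domM; first by apply: dom_convr; exact: convr1_C.
apply: domD; last first.
  apply: domN; apply: domM => //; apply: dom_convr; exact: convr1_shf.
apply: domD; last first.
  apply: domM; first by apply: dom_convr; exact: convr1_Xn.
  apply: dom_sum => p; apply: domM; first by apply: dom_convr; exact: convr_W.
  by apply: dom_sum => q; apply: domM => //; exact: dom_E.
apply: domD.
  by apply: dom_sum => u; apply: domM => //; exact: dom_convr.
by apply: dom_sum => p; apply: domM => //; apply: dom_convr; exact: convr1_shf.
Qed.

End OneVertex.

(** * Simultaneous convergence at all vertices *)

Section Convergence.
Context {R : realType} {V : finType}.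
Variables (B : V -> V -> V -> V -> R) (G : V -> V -> V -> R) (phi : V -> V -> R).
Hypothesis P : forall x, pencil (B x) (G x).
Variables (a l : V -> fps R).
Hypothesis a0 : forall v, 0 < a v 0%N.
Hypothesis aS : forall x k,
  k.+1%:R * a x k.+1 = - (a x ^+ 2 * drift phi l x) k.
Hypothesis al : forall k x, exists C : R, \forall t \near (0 : R)^'+,
  `|kap (B x) (G x) (fun v => ev (trf k.+1 (a v)) t) - ev (trf k.+1 (l x)) t|
    <= C * t ^+ k.+1.

Lemma shf_drift K x : drift phi l x = drift phi (fun y => trf K (l y)) x
  + fpsX ^+ K * drift phi (fun y => shf K (l y)) x.
Proof.
rewrite /drift mulr_sumr -big_split; apply: eq_bigr => y _ /=.
by rewrite {1}(trf_shf K (l y)); ring.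
Qed.

(** Integration gains one order: the flow equation gives coefficient [n + 1] of [a] from coefficient
    [n] of [a^2 drift], divided by [n + 1 >= 1]. So even [y / X] is dominated. *)
Lemma dom_shf_a (I : finType) (z : I -> fps R) K x :
  (forall u, dominated z (shf K (a u))) -> (forall u, dominated z (shf K (l u))) ->
  dominated z (shf 1 (shf K (a x))).
Proof.
move=> da dl; apply: (@dom_le _ _ _ _ (shf K (a x ^+ 2 * drift phi l x))).
  move=> k; rewrite /shf add1n addnS.
  have := aS x (K + k)%N => /(congr1 Num.norm); rewrite normrN normrM => <-.
  by rewrite ler_peMl// ger0_norm// ler1n.
pose X := trf K (a x); pose F := drift phi (fun y => trf K (l y)) x.
pose F' := drift phi (fun y => shf K (l y)) x; pose y := shf K (a x).
have cX : convr 1 X by exact: convr1_trf.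
have cF : convr 1 F.
  apply: convr1_sum => u; apply: convr1_M; first exact: convr1_C.
  exact: convr1_trf.
have dF' : dominated z F'.
  by apply: dom_sum => u; apply: domM => //; apply: dom_convr; exact: convr1_C.
have cK : convr 1 (fpsX ^+ K : fps R) by exact: convr1_Xn.
have -> : shf K (a x ^+ 2 * drift phi l x) = shf K (X ^+ 2 * F)
    + (X * X * F' + y * (X + X + fpsX ^+ K * y) * (F + fpsX ^+ K * F')).
  rewrite {1}(trf_shf K (a x)) (shf_drift K) -/X -/F -/F' -/y.
  rewrite -[X in _ = _ + X](shf_fpsXn K) -shfD; congr shf; ring.
have dy : dominated z y by exact: da.
have dX := dom_convr z cX; have dF := dom_convr z cF; have dK := dom_convr z cK.
apply: domD.
  apply: dom_convr; apply: convr1_shf; rewrite expr2.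
  by apply: convr1_M => //; exact: convr1_M.
apply: domD; first by apply: domM => //; apply: domM.
apply: domM; last by apply: domD => //; apply: domM.
apply: domM => //; apply: domD; first exact: domD.
by apply: domM.
Qed.

Lemma formal_converges : exists2 rho : R, 0 < rho & forall x,
  [/\ convr rho (a x), convr rho (l x) & exists i (v : V -> fps R),
    [/\ v i = 1, forall j, convr rho (v j) &
     forall p, \sum_q pform (B x) (G x) a (l x) p q * v q = 0]].
Proof.
have /choice[J /choice[r /choice[N /choice[i /choice[v Hx]]]]] := fun x =>
  kernel_vector (P x) a0 (fun k => al k x).
(* The series [a] are shared by all vertices, so the truncation orders must not depend on [x]: every
   left inverse is rescaled to the exponent [rr]. *)
pose rr := (\sum_x r x)%N; have rrx x : (r x <= rr)%N by rewrite /rr (bigD1 x)//= leq_addr.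
pose N' x j p := fpsX ^+ (rr - r x) * N x j p.
have HN' x j m : j \in J x -> m \in J x ->
    \sum_p N' x j p * pform (B x) (G x) a (l x) p m = fpsX ^+ rr * delta j m.
  move=> jJ mJ; have [_ _ _ _ HN] := Hx x.
  rewrite -[in RHS](subnK (rrx x)) exprD -mulrA -HN// mulr_sumr.
  by apply: eq_bigr => p _; rewrite mulrA.
pose K := (rr.+2 + rr.+1)%N.
pose z (s : V + V + V * V) := match s with
  | inl (inl u) => shf K (a u) | inl (inr x) => shf K (l x)
  | inr (x, j) => shf rr.+2 (v x j) end.
have dy u : dominated z (shf K (a u)) by exact: (dom_z z (inl (inl u))).
have dmu x : dominated z (shf K (l x)) by exact: (dom_z z (inl (inr x))).
have dom x j : dominated z (shf rr.+2 (v x j)) by exact: (dom_z z (inr (x, j))).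
have dy1 u : dominated z (shf 1 (shf K (a u))) by exact: dom_shf_a.
have [rho rho0 Hrho] : exists2 r : R, 0 < r & forall s, convr r (z s).
  apply: majorant => -[[u|x]|[x j]] /=.
  - exists (fpsC (a u K)), (shf 1 (shf K (a u))); split=> //; last exact: convr1_C.
    rewrite {1}(trf_shf 1 (shf K (a u))) expr1; congr (_ + _).
    by apply/funext => -[|k]; rewrite /trf /shf /fpsC//= addn0.
  - have [iJ vi vJ ker _] := Hx x.
    exact: (contracting_mu (P x) a0 vi ker dy (dmu x) (dom x) dy1).
  - have [iJ vi vJ ker _] := Hx x.
    exact: (contracting_om vi vJ ker (HN' x) dy (dmu x) (dom x)).
exists rho => // x; have rho0' := ltW rho0; split.
- exact: (convr_trf_shf rho0' (Hrho (inl (inl x)))).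
- exact: (convr_trf_shf rho0' (Hrho (inl (inr x)))).
exists (i x), (v x); have [iJ vi vJ ker _] := Hx x; split=> // j.
exact: (convr_trf_shf rho0' (Hrho (inr (x, j)))).
Qed.

End Convergence.

(** * Derivatives and the analytic solution *)

Section Derivation.
Context {R : realType}.
Implicit Types f g h : fps R.

Definition dfps f : fps R := fun k => k.+1%:R * f k.+1.

Lemma dfpsM f g : dfps (f * g) = dfps f * g + f * dfps g.
Proof.
apply/funext => k; rewrite fpsD /dfps [(f * g) k.+1](@fps_mul_poly _ _ _ _ k.+2)//.
rewrite mulr_natl -coef_deriv derivM coefD !coefM !fpsM; congr (_ + _).
  apply: eq_bigr => i _; rewrite coef_deriv !coef_poly mulr_natl.
  by rewrite !ltnS (leq_ord i) (leq_trans (leq_subr _ _))// ltnS ltnW.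
apply: eq_bigr => i _; rewrite coef_deriv !coef_poly mulr_natl.
by rewrite !ltnS leq_subr (leq_trans (leq_ord i)).
Qed.

(** Uniqueness for a linear formal differential equation; it yields [a m = 1] from the two flow
    equations. *)
Lemma dfps_eq0 f h : dfps h = f * h -> h 0%N = 0 -> h = 0.
Proof.
move=> dh h0; apply/funext => k; rewrite fps0; have [n] := ubnP k.
elim: n k => // n IH [//|k]; rewrite ltnS => kn.
have : dfps h k = 0.
  rewrite dh fpsM big1// => i _; rewrite IH ?mulr0//.
  by apply: leq_ltn_trans kn; exact: leq_subr.
by move=> /eqP; rewrite mulf_eq0 pnatr_eq0 => /eqP.
Qed.

(** The loss of radius pays for the factor [k + 1]: [(k + 1) r^k (s - r) <= s^(k+1)]. *)
Lemma convr_dfps (r s : R) f : 0 <= r -> r < s -> convr s f -> convr r (dfps f).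
Proof.
move=> r0 rs [C fC]; have sr : 0 < s - r by rewrite subr_gt0.
have s0 : 0 < s by exact: le_lt_trans rs.
exists (C / (s - r)) => n; rewrite ler_pdivlMr//.
apply: le_trans (fC n.+1); rewrite /nrm big_ord_recl ler_wpDl//.
  by rewrite mulr_ge0 ?exprn_ge0 ?(ltW s0).
rewrite mulr_suml; apply: ler_sum => i _; rewrite /dfps normrM ger0_norm//.
have k1 : i.+1%:R * r ^+ i * (s - r) <= s ^+ i.+1.
  have := subrXX s r i.+1; set S := \sum_(_ < _) _ => h.
  have : i.+1%:R * r ^+ i <= S.
    rewrite mulr_natl -[X in _ *+ X]card_ord -sumr_const; apply: ler_sum => j _.
    have -> : r ^+ i = r ^+ (i.+1.-1 - j) * r ^+ j.
      by rewrite -exprD subnK// -ltnS.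
    by rewrite ler_wpM2r ?exprn_ge0// lerXn2r ?nnegrE// ltW.
  move=> /(ler_wpM2r (ltW sr)) /le_trans; apply; rewrite mulrC -h.
  by rewrite gerBl exprn_ge0.
have -> : i.+1%:R * `|f i.+1| * r ^+ i * (s - r)
  = `|f i.+1| * (i.+1%:R * r ^+ i * (s - r)) by ring.
by rewrite ler_wpM2l.
Qed.

(* Unlike [convr r], this class is stable under derivation. *)
Definition convlt (r : R) f := forall s, 0 < s -> s < r -> convr s f.

Lemma convlt_dfps r f : convlt r f -> convlt r (dfps f).
Proof.
move=> cf s s0 sr; apply: (@convr_dfps s ((s + r) / 2)); [exact: ltW|lra|].
apply: cf; lra.
Qed.

Lemma convlt_cvg r f t : `|t| < r -> convlt r f -> cvgn (pseries f t).
Proof.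
move=> tr cf; have t0 := normr_ge0 t.
apply: (@cvg_pseries _ ((`|t| + r) / 2)); [lra|apply: cf; lra].
Qed.

Lemma is_derive_ev r f t : `|t| < r -> convlt r f ->
  is_derive t (1 : R) (ev f) (ev (dfps f) t).
Proof.
move=> tr cf; have t0 := normr_ge0 t; pose K := (`|t| + r) / 2.
have Kr : `|K| < r by rewrite /K ger0_norm; lra.
apply: (@pseries_snd_diffs _ f K t).
- exact: convlt_cvg cf.
- exact: convlt_cvg (convlt_dfps cf).
- exact: convlt_cvg (convlt_dfps (convlt_dfps cf)).
- by rewrite /K [ltRHS]ger0_norm; lra.
Qed.

Lemma near_withinP (A P : set R) t :
  (\forall s \near within A t^', P s) <->
  exists2 d, 0 < d & forall s, `|s - t| < d -> s != t -> A s -> P s.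
Proof.
split=> [/nbhs_ballP[d d0 H]|[d d0 H]].
  by exists d => // s sd st As; apply: H => //; rewrite /ball /= distrC.
by apply/nbhs_ballP; exists d => // s sd st As; apply: H => //; rewrite distrC.
Qed.

Lemma derive_withinP (A : set R) (f : R -> R) t l :
  is_derive_within A f t l <-> forall eps, 0 < eps -> exists2 d, 0 < d &
    forall s, `|s - t| < d -> s != t -> A s ->
      `|l - (s - t)^-1 * (f s - f t)| <= eps.
Proof.
split=> [/cvgrPdist_le H eps e0|H]; first exact/near_withinP/H.
by apply/cvgrPdist_le => eps e0; exact/near_withinP/H.
Qed.

Lemma is_deriveP (f : R -> R) t l : is_derive t (1 : R) f l <->
  is_derive_within setT f t l.
Proof.
rewrite derive_withinP; split=> [[df <-] eps e0|H].
  move: df => /cvgrPdist_le /(_ eps e0) /nbhs_ballP[d d0 Hd]; exists d => // s sd st _.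
  have := Hd (s - t); rewrite /ball /= sub0r normrN => /(_ sd).
  rewrite subr_eq0 => /(_ st); rewrite /shift /= /GRing.scale /= mulr1 subrK.
  exact.
have cv : h^-1 *: ((f \o shift t) (h *: (1 : R)) - f t) @[h --> (0 : R)^'] --> l.
  apply/cvgrPdist_le => eps e0; have [d d0 Hd] := H _ e0.
  apply/nbhs_ballP; exists d => // h; rewrite /ball /= sub0r normrN => hd h0.
  have := Hd (h + t); rewrite addrK => /(_ hd); rewrite -subr_eq0 addrK.
  by move=> /(_ h0 I); rewrite /GRing.scale /= mulr1.
have df : derivable f t 1 by apply/cvg_ex; exists l.
by split=> //; apply: cvg_lim cv.
Qed.

Lemma is_derive_within_sub (A A' : set R) (f : R -> R) t l : A `<=` A' ->
  is_derive_within A' f t l -> is_derive_within A f t l.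
Proof.
move=> AA' /derive_withinP H; apply/derive_withinP => eps /H[d d0 Hd].
by exists d => // s sd st /AA'; exact: Hd.
Qed.

Lemma is_derive_within_interior (a b : R) (f : R -> R) t l :
  a < t < b -> is_derive_within [set` `[a, b[] f t l -> is_derive t (1 : R) f l.
Proof.
move=> /andP[at_ tb] /derive_withinP H; apply/is_deriveP/derive_withinP => eps /H[d d0 Hd].
exists (Num.min d (Num.min (t - a) (b - t))).
  by rewrite !lt_min d0 !subr_gt0 at_.
move=> s; rewrite !lt_min => /and3P[sd]; rewrite ltr_norml => /andP[s1 _].
rewrite ltr_norml => /andP[_ s2] st _; apply: Hd => //=.
by rewrite in_itv /=; apply/andP; split; lra.
Qed.

Lemma is_derive_within_continuous (A : set R) (f : R -> R) : 
  (forall t, A t -> exists l, is_derive_within A f t l) ->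
  {within A, continuous f}.
Proof.
move=> H; apply/subspace_continuousP => t At.
have [l /derive_withinP /(_ 1 ltr01)[d d0 Hd]] := H t At.
apply/cvgrPdist_le => eps e0; apply/nbhs_ballP => /=.
have L0 : 0 < `|l| + 1 by rewrite ltr_wpDl.
exists (Num.min d (eps / (`|l| + 1))).
  by rewrite /= lt_min d0 divr_gt0.
move=> s; rewrite /ball /= lt_min distrC => /andP[sd].
rewrite ltr_pdivlMr// => se As; have [->|st] := eqVneq s t.
  by rewrite subrr normr0 ltW.
have st0 : 0 < `|s - t| by rewrite normr_gt0 subr_eq0.
have := Hd s sd st As; set q := _ * _ => Hq.
have -> : f t - f s = - ((s - t) * q).
  by rewrite /q mulrA divff ?mul1r ?opprB// subr_eq0.
rewrite normrN normrM (le_trans _ (ltW se))// ler_wpM2l//.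
have -> : q = l - (l - q) by ring.
by rewrite (le_trans (ler_normB _ _))// lerD2l.
Qed.

End Derivation.

(** * The curvature along the convergent series *)

Section CurvatureAlongSeries.
Context {R : realType} {V : finType}.
Variables (B : V -> V -> V -> R) (G : V -> V -> R).
Hypothesis P : pencil B G.
Variables (a : V -> fps R) (l : fps R).
Hypothesis a0 : forall v, 0 < a v 0%N.
Hypothesis al : forall k, exists C : R, \forall t \near (0 : R)^'+,
  `|kap B G (fun v => ev (trf k.+1 (a v)) t) - ev (trf k.+1 l) t|
    <= C * t ^+ k.+1.
Hypotheses (ca : forall v, conv (a v)) (cl : conv l).
Variables (i : V) (v : V -> fps R).
Hypotheses (vi : v i = 1) (cv : forall j, conv (v j)).
Hypothesis ker : forall p, \sum_q pform B G a l p q * v q = 0.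
Local Notation "0+" := ((0 : R)^'+).

Lemma near_box (p : V -> fps R) : (forall u, conv (p u)) ->
  (forall u, p u 0%N = a u 0%N) -> \forall t \near 0+, forall u,
    a u 0%N / 2 <= ev (p u) t <= a u 0%N / 2 * 3.
Proof.
move=> cp p0; apply: near_all => u.
have a2 : 0 < a u 0%N / 2 by rewrite divr_gt0.
have [C C0 HC] := near_ev_cst (cp u).
move: HC (near_mul_lt C a2); apply: filterS2 => t.
by rewrite p0 ler_norml => /andP[h1 h2] h3; apply/andP; split; lra.
Qed.

Lemma near_ev_pos_all : \forall t \near 0+, forall u, 0 < ev (a u) t.
Proof.
apply: filterS (near_box ca (fun=> erefl)) => t H u.
by have /andP[h _] := H u; apply: lt_le_trans h; rewrite divr_gt0.
Qed.

(** Passage from truncations to sums: near 0 both stay in a box where [kap] is Lipschitz. *)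
Lemma kap_near_trf k : exists C : R, \forall t \near 0+,
  `|kap B G (fun u => ev (a u) t) - ev l t| <= C * t ^+ k.+1.
Proof.
have [lo [hi [lo0 lohi lohiP]]] : exists lo hi : R, [/\ 0 < lo, lo <= hi &
    forall u, lo <= a u 0%N / 2 /\ a u 0%N / 2 * 3 <= hi].
  exists (\big[Num.min/1]_u (a u 0%N / 2)), (\big[Num.max/1]_u (a u 0%N / 2 * 3)).
  split.
  - by apply: lt_bigmin => // u _; rewrite divr_gt0.
  - by apply: (@le_trans _ _ 1); [exact: bigmin_le_id|exact: bigmax_ge_id].
  move=> u; split; [exact: bigmin_le_cond|].
  exact: (le_bigmax _ (fun u => a u 0%N / 2 * 3)).
have [L L0 HL] := kap_lip P lo0 lohi.
have [C HC] := al k; have [Cl Cl0 HCl] := near_ev_trf k.+1 cl.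
have /choice[D HD] : forall u, exists D : R, 0 < D /\ \forall t \near 0+,
    `|ev (a u) t - ev (trf k.+1 (a u)) t| <= D * t ^+ k.+1.
  by move=> u; have [D] := near_ev_trf k.+1 (ca u); exists D.
have D0 u : 0 <= D u by have [/ltW] := HD u.
have /near_all HD' : forall u, \forall t \near 0+,
    `|ev (a u) t - ev (trf k.+1 (a u)) t| <= D u * t ^+ k.+1.
  by move=> u; have [] := HD u.
exists (C + L * (\sum_u D u) + Cl).
have bx1 := near_box ca (fun=> erefl).
have bx2 : \forall t \near 0+, forall u,
    a u 0%N / 2 <= ev (trf k.+1 (a u)) t <= a u 0%N / 2 * 3.
  by apply: near_box => // u; exact: conv_trf.
apply: filterS4 (filterI HC (@near0_gt R)) HCl (filterI bx1 bx2) HD'.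
move=> t [{}HC t0] {}HCl [h1 h2] {}HD'.
have tk : 0 <= t ^+ k.+1 by rewrite exprn_ge0// ltW.
have : `|kap B G (fun u => ev (a u) t) - kap B G (fun u => ev (trf k.+1 (a u)) t)|
    <= L * ((\sum_u D u) * t ^+ k.+1).
  apply: HL.
  - by rewrite mulr_ge0// sumr_ge0.
  - move=> u; have /andP[h4 h5] := h1 u; have [h6 h7] := lohiP u.
    by rewrite (le_trans h6)//= (le_trans h5).
  - move=> u; have /andP[h4 h5] := h2 u; have [h6 h7] := lohiP u.
    by rewrite (le_trans h6)//= (le_trans h5).
  move=> u; rewrite (le_trans (HD' u))// ler_wpM2r//.
  by rewrite (bigD1 u)//= lerDl sumr_ge0.
move: HC HCl; rewrite !ler_norml => /andP[a1 a2] /andP[b1 b2] /andP[c1 c2].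
by apply/andP; split; lra.
Qed.

Lemma near_form_kernel :
  \forall t \near 0+, 0 < qf G (fun j => ev (v j) t).
Proof.
pose g := \sum_p \sum_q v p * (fpsC (G p q) * v q).
have cg1 p q : conv (v p * (fpsC (G p q) * v q)).
  by apply: convM => //; apply: convM => //; exact: conv_fpsC.
have cg2 p : conv (\sum_q v p * (fpsC (G p q) * v q)) by exact: conv_sum.
have cg : conv g by exact: conv_sum.
have g0 : g 0%N = qf G (fun j => v j 0%N).
  rewrite /g fps_sum; apply: eq_bigr => p _; rewrite fps_sum /mv mulr_sumr.
  by apply: eq_bigr => q _; rewrite !fpsM0.
have gpos : 0 < g 0%N by rewrite g0; exact: (form_kernel_gt0 P a0 vi ker).
have ev1 : \forall t \near 0+, forall p q,
    ev (v p * (fpsC (G p q) * v q)) t = ev (v p) t * (G p q * ev (v q) t).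
  apply: near_all => p; apply: near_all => q.
  have cGv : conv (fpsC (G p q) * v q) by apply: convM => //; exact: conv_fpsC.
  move: (near_evM (cv p) cGv) (near_evM (conv_fpsC (G p q)) (cv q)).
  by apply: filterS2 => t -> ->; rewrite ev_fpsC.
have ev2 : \forall t \near 0+, forall p, ev (\sum_q v p * (fpsC (G p q) * v q)) t
    = \sum_q ev (v p * (fpsC (G p q) * v q)) t.
  by apply: near_all => p; exact: near_ev_sum.
apply: filterS4 (near_ev_sum cg2) ev1 ev2 (near_ev_pos cg gpos).
move=> t h1 h2 h3 h4; apply: (@lt_le_trans _ _ (g 0%N / 2)); first exact: divr_gt0.
apply: (le_trans h4); rewrite /g h1 le_eqVlt; apply/orP; left; apply/eqP.
apply: eq_bigr => p _; rewrite h3 /mv mulr_sumr; apply: eq_bigr => q _.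
exact: h2.
Qed.

Lemma near_ker : \forall t \near 0+, qf (evm (pform B G a l) t) (fun j => ev (v j) t) = 0.
Proof.
have cM := pform_conv B G ca cl.
have cMv p q : conv (pform B G a l p q * v q) by exact: convM.
have : \forall t \near 0+, forall p, mv (evm (pform B G a l) t) (fun j => ev (v j) t) p = 0.
  apply: near_all => p.
  have : \forall t \near 0+, forall q, ev (pform B G a l p q * v q) t
      = ev (pform B G a l p q) t * ev (v q) t.
    by apply: near_all => q; exact: near_evM.
  move: (near_ev_sum (cMv p)); apply: filterS2 => t h1 h2.
  rewrite -[RHS](_ : ev 0 t = 0); last by rewrite -(rmorph0 fpsC) ev_fpsC.
  by rewrite -(ker p) h1; apply: eq_bigr => q _; rewrite h2.
by apply: filterS => t H; rewrite /qf /bil big1// => p _; rewrite H mulr0.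
Qed.

Lemma kap_series : \forall t \near 0+, kap B G (fun u => ev (a u) t) = ev l t.
Proof.
have [_ [sG pG] _ _ _] := P.
have cM := pform_conv B G ca cl; have evM := near_qf_pform B G ca cl.
have pM : \forall t \near 0+, psd (evm (pform B G a l) t).
  apply: psd_flat => //; first exact: pform_sym.
  move=> k; have [C HC] := kap_near_trf k.
  exists (`|C| * \sum_i \sum_j `|G i j|).
  apply: filterS4 (filterI (@near0_gt R) (near0_lt (@ltr01 R))) HC near_ev_pos_all evM.
  move=> t [t0 t1] {}HC pos {}evM f; rewrite evM.
  have pos' u : 0 <= ev (a u) t by exact: ltW.
  have := (kapP P pos').1 f; set kk := kap _ _ _ in HC * => h1.
  have tk : 0 <= t ^+ k by rewrite exprn_ge0// ltW.
  have tk1 : t ^+ k.+1 <= t ^+ k by rewrite exprS ler_piMl// ltW.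
  have h2 : - (`|C| * t ^+ k) <= kk - ev l t.
    move: HC; rewrite ler_norml => /andP[h2 _]; apply: le_trans h2; rewrite lerN2.
    apply: (@le_trans _ _ (`|C| * t ^+ k.+1)).
      by rewrite ler_wpM2r ?exprn_ge0 ?(ltW t0)// ler_norm.
    by rewrite ler_wpM2l.
  have h3 := ler_wpM2r (pG f) h2.
  have : qf G f <= (\sum_i \sum_j `|G i j|) * sqn f.
    by apply: le_trans (norm_qf _ _); exact: ler_norm.
  have ctk : 0 <= `|C| * t ^+ k by rewrite mulr_ge0.
  move=> /(ler_wpM2l ctk) h4; lra.
apply: filterS4 (filterI pM evM) near_ev_pos_all near_form_kernel near_ker.
move=> t [{}pM {}evM] pos Gpos kert.
have pos' u : 0 <= ev (a u) t by exact: ltW.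
apply/eqP; rewrite eq_le; apply/andP; split.
  rewrite -(ler_pM2r Gpos); apply: (le_trans ((kapP P pos').1 _)).
  by move: kert; rewrite evM => /eqP; rewrite subr_eq0 => /eqP ->.
by apply: kap_ge => // f; have := pM f; rewrite evM subr_ge0.
Qed.

(** A germ at 0+ says nothing at [t = 0], where the flow equation is also required; there the
    approximation of order 0 decides. *)
Lemma kap_series0 : kap B G (fun u => a u 0%N) = l 0%N.
Proof.
have [C HC] := al 0.
have tr0 (f : fps R) t : ev (trf 1 f) t = f 0%N.
  by rewrite (@ev_fin _ (trf 1 f) _ 1) ?big_ord1 ?expr0 ?mulr1// => -[].
have : 0 <= - `|kap B G (fun u => a u 0%N) - l 0%N|.
  apply: (@near_ge0_cst _ _ C); apply: filterS HC => t.
  under [X in kap _ _ X]eq_fun do rewrite tr0.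
  by rewrite tr0 expr1; lra.
by rewrite oppr_ge0 normr_le0 subr_eq0 => /eqP.
Qed.

End CurvatureAlongSeries.

(** * From the formal solution to a genuine one *)

Section AnalyticSolution.
Context {R : realType} {V : finType}.
Variables (B : V -> V -> V -> V -> R) (G : V -> V -> V -> R) (phi : V -> V -> R).
Hypothesis P : forall x, pencil (B x) (G x).

Lemma convr0 (r : R) : 0 <= r -> convr r (0 : fps R).
Proof. by move=> r0; apply: (@convr_fin _ _ _ 0) => // k _; rewrite fps0. Qed.

Lemma analytic_solution (m0 : V -> R) : (forall x, 0 < m0 x) ->
  exists2 T : R, 0 < T & exists m : V -> fps R,
  [/\ forall x, convlt T (m x), forall x, m x 0%N = m0 x,
   forall t x, 0 <= t < T -> 0 < ev (m x) t &
   forall t x, 0 <= t < T -> ev (dfps (m x)) t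
     = \sum_y phi x y * kap (B y) (G y) (fun v => (ev (m v) t)^-1)].
Proof.
move=> m0_gt0; pose a0 x := (m0 x)^-1.
have a0_gt0 x : 0 < a0 x by rewrite invr_gt0.
have [a [l [aE aS al]]] := formal_solution phi P a0_gt0.
have ap x : 0 < a x 0%N by rewrite aE.
have [rho rho0 Hrho] := formal_converges P ap aS al.
have ca x : convr rho (a x) by have [] := Hrho x.
have cl x : convr rho (l x) by have [] := Hrho x.
have ca' x : conv (a x) by exists rho.
have cl' x : conv (l x) by exists rho.
have rho0' := ltW rho0.
have cd x : convr rho (drift phi l x).
  rewrite /drift; apply: (big_ind (convr rho)) => [||y _].
  - exact: convr0.
  - by move=> f g; exact: convrD.
  - by apply: convrM => //; exact: convr_fpsC.
(* [m] is integrated from the drift instead of being computed as the inverse of [a]; this keeps the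
   radius of [l]. *)
pose m x : fps R := fun k => if k is j.+1 then drift phi l x j / j.+1%:R else m0 x.
have dm x : dfps (m x) = drift phi l x.
  by apply/funext => k; rewrite /dfps /m mulrC divfK// pnatr_eq0.
have da x : dfps (a x) = - (a x ^+ 2 * drift phi l x).
  by apply/funext => k; rewrite /dfps aS.
(* The difference [a m - 1] vanishes at 0 and solves [h' = - (a drift) h]. *)
have am x : a x * m x = 1.
  apply/eqP; rewrite -subr_eq0; apply/eqP.
  apply: (@dfps_eq0 _ (- (a x * drift phi l x))).
    have d1 : dfps (a x * m x - 1) = dfps (a x * m x).
      by apply/funext => k; rewrite /dfps fpsB fps1 subr0.
    by rewrite d1 dfpsM dm da; ring.
  by rewrite fpsB fpsM0 fps1 aE /a0 /m mulVf ?subrr// gt_eqF.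
have cm x : convr rho (m x).
  have -> : m x = fpsC (m0 x) + fpsX * shf 1 (m x).
    rewrite {1}(trf_shf 1 (m x)) expr1; congr (_ + _).
    by apply/funext => -[|k]; rewrite /trf.
  apply: convrD => //; first exact: convr_fpsC.
  apply: convrM => //.
    by rewrite -(expr1 fpsX); apply: (@convr_fin _ _ _ 2) => // k k2;
      rewrite fpsXnE; case: k k2 => [|[]].
  have [C HC] := cd x; exists C => n; apply: le_trans (HC n).
  apply: ler_nrm => // k; rewrite /shf add1n /m normrM ler_piMr//.
  by rewrite normfV invf_le1 ?normr_gt0 ?pnatr_eq0// ger0_norm// ler1n.
have nearK : \forall t \near (0 : R)^'+, forall x,
    kap (B x) (G x) (fun u => ev (a u) t) = ev (l x) t.
  apply: near_all => x; have [_ _ [i [v [vi cv ker]]]] := Hrho x.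
  apply: (kap_series (P x) ap _ ca' (cl' x) vi _ ker) => [k|j].
    exact: al.
  by exists rho.
have nearP := near_ev_pos_all ap ca'.
have : \forall t \near (0 : R)^'+, t < rho /\ (forall x, 0 < ev (a x) t) /\
    forall x, kap (B x) (G x) (fun u => ev (a u) t) = ev (l x) t.
  by move: (near0_lt rho0) nearP nearK; apply: filterS3.
move=> /nbhs_ballP[T' /= T'0 HT']; pose T := Num.min T' rho.
have T0 : 0 < T by rewrite lt_min T'0.
have HT t : 0 <= t < T -> [/\ t < rho, forall x, 0 < ev (a x) t &
    forall x, kap (B x) (G x) (fun u => ev (a u) t) = ev (l x) t].
  move=> /andP[]; rewrite le_eqVlt => /predU1P[<- _|t0].
    split=> // x; first by rewrite ev0.
    rewrite ev0; under [X in kap _ _ X]eq_fun do rewrite ev0.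
    by apply: kap_series0 => k; exact: al.
  rewrite lt_min => /andP[tT' tr].
  have [|//|_ [h1 h2]] := HT' t; last by split.
  by rewrite /ball /= sub0r normrN gtr0_norm.
have clT x : convlt T (m x).
  move=> s s0 sT; apply: convr_le (cm x); first exact: ltW.
  by rewrite ltW// (lt_le_trans sT)// ge_min lexx orbT.
have evam t x : 0 <= t < T -> ev (a x) t * ev (m x) t = 1.
  move=> tT; have [tr _ _] := HT t tT; have /andP[t0 _] := tT.
  by rewrite -(@evM _ rho) ?am -?(rmorph1 fpsC) ?ev_fpsC// ger0_norm.
exists T => //; exists m; split=> // [t x tT|t x tT].
  have [_ pa _] := HT t tT.
  by rewrite -(pmulr_rgt0 _ (pa x)) evam.
have [tr pa kE] := HT t tT; have /andP[t0 _] := tT.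
have tr' : `|t| < rho by rewrite ger0_norm.
have mV v : (ev (m v) t)^-1 = ev (a v) t.
  have := evam t v tT; have := pa v => ha /(congr1 (fun q => (ev (a v) t)^-1 * q)).
  by rewrite mulrA mulVf ?gt_eqF// mul1r mulr1 => ->; rewrite invrK.
rewrite dm /drift.
have -> : ev (\sum_y fpsC (phi x y) * l y) t = \sum_y phi x y * ev (l y) t.
  have cyl y : convr rho (fpsC (phi x y) * l y).
    by apply: convrM => //; exact: convr_fpsC.
  elim: (index_enum V) => [|y s IH].
    by rewrite !big_nil -(rmorph0 fpsC) ev_fpsC.
  rewrite !big_cons (@evD _ rho) ?(ltW tr')//.
    by rewrite IH (@evM _ rho)// ?ev_fpsC//; exact: convr_fpsC.
  by apply: (big_ind (convr rho)) => //;
    [exact: convr0|move=> f g; exact: convrD].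
apply: eq_bigr => y _; rewrite -kE; congr (_ * kap _ _ _).
by apply/funext => v; rewrite mV.
Qed.

End AnalyticSolution.

(** * Uniqueness *)

Section Uniqueness.
Context {R : realType} {V : finType}.
Implicit Types (t : R).

Lemma is_derive_psum (I : Type) (s : seq I) (F : I -> R -> R) (dF : I -> R) t :
  (forall i, is_derive t (1 : R) (F i) (dF i)) ->
  is_derive t (1 : R) (fun u => \sum_(i <- s) F i u) (\sum_(i <- s) dF i).
Proof.
move=> H; elim: s => [|i s IH].
  rewrite big_nil (_ : (fun u => _) = cst 0); first exact: is_derive_cst.
  by apply/funext => u; rewrite big_nil.
rewrite big_cons (_ : (fun u => _) = F i + (fun u => \sum_(i <- s) F i u)).
  exact: is_deriveD.
by apply/funext => u; rewrite big_cons.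
Qed.

Lemma cvg_psum (T I : Type) (Fi : set_system T) {FF : Filter Fi} (s : seq I)
  (F : I -> T -> R) (l : I -> R) : (forall i, F i x @[x --> Fi] --> l i) ->
  (\sum_(i <- s) F i x) @[x --> Fi] --> \sum_(i <- s) l i.
Proof.
move=> H; elim: s => [|i s IH].
  rewrite big_nil (_ : (fun u => _) = cst 0); first exact: cvg_cst.
  by apply/funext => u; rewrite big_nil.
rewrite big_cons (_ : (fun u => _) = F i \+ (fun u => \sum_(i <- s) F i u)).
  exact: cvgD.
by apply/funext => u; rewrite big_cons.
Qed.

(** The product of [phi] with [exp (- C t)] has nonpositive derivative inside the interval and
    starts from 0. *)
Lemma gronwall0 (phi dphi : R -> R) (C t0 : R) : 0 <= t0 ->
  (forall t, t \in `]0, t0[ -> is_derive t (1 : R) phi (dphi t)) ->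
  (forall t, t \in `]0, t0[ -> dphi t <= C * phi t) ->
  {within `[0, t0], continuous phi} -> phi 0 = 0 -> phi t0 <= 0.
Proof.
move=> t00 dP leP cP phi0.
pose psi := (expR \o (fun t => - C * t)) * phi : R -> R.
have dpsi t : t \in `]0, t0[ -> is_derive t (1 : R) psi
    (expR (- C * t) * (dphi t - C * phi t)).
  move=> tt; have d1 : is_derive t (1 : R) (fun t => - C * t) (- C).
    have := @is_deriveZ _ _ _ id (- C) t 1 1 (is_derive_id t 1).
    by rewrite /GRing.scale /= mulr1.
  have d2 := is_derive1_comp (is_derive_expR _) d1.
  have := is_deriveM d2 (dP t tt); move=> /is_derive_eq; apply; rewrite /GRing.scale /=; ring.
have cpsi : {within `[0, t0], continuous psi}.
  apply/subspace_continuousP => t tt; apply: cvgM; last first.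
    by move: cP => /subspace_continuousP; exact.
  apply: cvg_within_filter; apply: continuous_comp; last exact: continuous_expR.
  by apply: continuousM; [exact: cvg_cst|exact: cvg_id].
have := @ler0_derive1_le_cc _ psi 0 t0 _ _ cpsi t0 0.
rewrite !in_itv /= !lexx t00 /psi.
have -> : ((expR \o (fun t => - C * t)) * phi) 0 = 0 by rewrite /GRing.mul /= phi0 mulr0.
have -> : ((expR \o (fun t => - C * t)) * phi) t0 = expR (- C * t0) * phi t0 by [].
rewrite pmulr_rle0 ?expR_gt0//; apply=> // t tt.
  by have [] := dpsi t tt.
rewrite derive1E; have [_ ->] := dpsi t tt.
by rewrite pmulr_rle0 ?expR_gt0// subr_le0 leP.
Qed.

(** The field is Lipschitz only on boxes away from 0, so compactness of [[0, t0]] first confines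
    both solutions to one box. Gronwall is applied to the sum of squared differences, which is
    differentiable. *)
Lemma flow_unique (H : (V -> R) -> V -> R) (T : R) (m m' : R -> V -> R) :
  (forall lo hi : R, 0 < lo -> lo <= hi -> exists2 L : R, 0 <= L &
    forall a b d, 0 <= d -> (forall v, lo <= a v <= hi) ->
      (forall v, lo <= b v <= hi) -> (forall v, `|a v - b v| <= d) ->
      forall x, `|H a x - H b x| <= L * d) ->
  (forall t x, t \in `[0, T[ -> 0 < m t x) ->
  (forall t x, t \in `[0, T[ -> 0 < m' t x) ->
  (forall t x, t \in `[0, T[ ->
     is_derive_within [set` `[0, T[] (m ^~ x) t (H (m t) x)) ->
  (forall t x, t \in `[0, T[ ->
     is_derive_within [set` `[0, T[] (m' ^~ x) t (H (m' t) x)) ->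
  (forall x, m 0 x = m' 0 x) ->
  forall t x, t \in `[0, T[ -> m t x = m' t x.
Proof.
move=> HL mp mp' dm dm' m0 t0 x0; rewrite in_itv /= => /andP[t00 t0T].
have sub : [set` `[0, t0]] `<=` [set` `[0, T[].
  move=> t /=; rewrite !in_itv /= => /andP[-> tt0] /=; exact: le_lt_trans t0T.
have cm x : {within `[0, t0], continuous (m ^~ x)}.
  apply: is_derive_within_continuous => t tt; exists (H (m t) x).
  exact: (is_derive_within_sub sub (dm _ _ (sub _ tt))).
have cm' x : {within `[0, t0], continuous (m' ^~ x)}.
  apply: is_derive_within_continuous => t tt; exists (H (m' t) x).
  exact: (is_derive_within_sub sub (dm' _ _ (sub _ tt))).
have /choice[lo0 Hlo] : forall x, exists c : R, 0 < c /\
    forall t, t \in `[0, t0] -> c <= m t x /\ c <= m' t x.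
  move=> x; have [c ct Hc] := EVT_min t00 (cm x).
  have [c' ct' Hc'] := EVT_min t00 (cm' x).
  exists (Num.min (m c x) (m' c' x)); split.
    by rewrite lt_min mp ?mp'//; exact: sub.
  by move=> t tt; rewrite !ge_min Hc// Hc'// orbT.
have /choice[hi0 Hhi] : forall x, exists c : R, 
    forall t, t \in `[0, t0] -> m t x <= c /\ m' t x <= c.
  move=> x; have [c ct Hc] := EVT_max t00 (cm x).
  have [c' ct' Hc'] := EVT_max t00 (cm' x).
  exists (Num.max (m c x) (m' c' x)).
  by move=> t tt; rewrite !le_max Hc// Hc'// orbT.
pose lo := \big[Num.min/1]_x lo0 x; pose hi := \big[Num.max/1]_x hi0 x.
have lo_gt0 : 0 < lo by apply: lt_bigmin => // x _; have [] := Hlo x.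
have lohi : lo <= hi.
  by apply: (@le_trans _ _ 1); [exact: bigmin_le_id|exact: bigmax_ge_id].
have lox x : lo <= lo0 x by exact: bigmin_le_cond.
have hix x : hi0 x <= hi by exact: (le_bigmax _ hi0).
have [L L0 HLL] := HL lo hi lo_gt0 lohi.
pose dl t x := m t x - m' t x.
pose phi t := \sum_x dl t x * dl t x.
(* The squared number of vertices, in the shape that [sqn_dot_le] gives for the vector of ones. *)
pose S : R := \sum_(l : V) \sum_(k : V) `|1 * 1 : R|.
pose dphi t := \sum_x (dl t x * (H (m t) x - H (m' t) x)
   + dl t x * (H (m t) x - H (m' t) x)).
suff : phi t0 <= 0.
  move=> phi0; apply/eqP; rewrite -subr_eq0 -/(dl t0 x0) -sqrf_eq0 expr2.
  rewrite eq_le -expr2 sqr_ge0 andbT expr2 (le_trans _ phi0)//.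
  rewrite /phi (bigD1 x0)//= lerDl sumr_ge0// => x _.
  by rewrite -expr2 sqr_ge0.
apply: (@gronwall0 phi dphi (2 * L * S)) => //.
- move=> t; rewrite in_itv /= => /andP[tp tt0].
  have t0T' : 0 < t < T by rewrite tp (lt_trans tt0).
  have tT : t \in `[0, T[ by rewrite in_itv /= ltW//= (lt_trans tt0).
  apply: is_derive_psum => x.
  have d1 := is_derive_within_interior t0T' (dm t x tT).
  have d2 := is_derive_within_interior t0T' (dm' t x tT).
  have d3 : is_derive t (1 : R) (fun t => dl t x) (H (m t) x - H (m' t) x).
    exact: is_deriveB.
  exact: (is_deriveM d3 d3).
- move=> t; rewrite in_itv /= => /andP[tp tt0].
  have tt : t \in `[0, t0] by rewrite in_itv /= !ltW.
  pose d := \sum_x `|dl t x|.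
  have d0 : 0 <= d by rewrite sumr_ge0.
  have Hx x : `|H (m t) x - H (m' t) x| <= L * d.
    apply: HLL => // v.
    - have [_ /(_ t tt)[h1 _]] := Hlo v; have [h2 _] := Hhi v t tt.
      by rewrite (le_trans (lox v))//= (le_trans h2).
    - have [_ /(_ t tt)[_ h1]] := Hlo v; have [_ h2] := Hhi v t tt.
      by rewrite (le_trans (lox v))//= (le_trans h2).
    by rewrite /d (bigD1 v)//= lerDl sumr_ge0.
  have h1 : dphi t <= 2 * (L * d) * d.
    rewrite /d mulr_sumr; apply: ler_sum => x _; rewrite -/d.
    have : `|dl t x * (H (m t) x - H (m' t) x)| <= `|dl t x| * (L * d).
      by rewrite normrM ler_wpM2l.
    rewrite ler_norml => /andP[_]; lra.
  have h2 : d * d <= S * phi t.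
    have := sqn_dot_le (fun=> 1) (fun x => `|dl t x|).
    rewrite /sqn -/S; under eq_bigr do rewrite mul1r.
    by under [in leRHS]eq_bigr do rewrite real_normK ?num_real// expr2; rewrite expr2.
  by have := ler_wpM2l L0 h2; lra.
- apply/subspace_continuousP => t tt; apply: cvg_psum => x.
  have h1 : dl u x @[u --> within [set` `[0, t0]] (nbhs t)] --> dl t x.
    apply: cvgB.
      by have /subspace_continuousP := cm x; exact.
    by have /subspace_continuousP := cm' x; exact.
  exact: cvgM.
by rewrite /phi big1// => x _; rewrite /dl m0 subrr mulr0.
Qed.

End Uniqueness.

(** * The curvature of a weighted graph as a pencil *)

Section GraphPencil.
Context {R : realType} {V : finType}.
Variables (e : rel V) (w : V -> V -> R) (th : R).
Hypotheses (e_irr : irreflexive e) (w_pos : forall x y, e x y -> 0 < w x y).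
Implicit Types (f g h m : V -> R) (x y z v : V).

Definition wt x y : R := if e x y then w x y else 0.
Definition deg x : R := \sum_y wt x y.

Lemma wt_ge0 x y : 0 <= wt x y.
Proof.
by rewrite /wt; case: (boolP (e x y)) => [/w_pos/ltW|].
Qed.

Lemma wt_gt0 x y : (0 < wt x y) = e x y.
Proof.
by rewrite /wt; case: (boolP (e x y)) => [/w_pos|]; rewrite ?ltxx.
Qed.

Lemma deg_ge0 x : 0 <= deg x.
Proof. by apply: sumr_ge0 => y _; exact: wt_ge0. Qed.

Lemma laplacianE m f x : laplacian e w m f x = \sum_y wt x y / m x * (f y - f x).
Proof.
rewrite /laplacian big_mkcond; apply: eq_bigr => y _; rewrite /wt.
by case: (e x y); rewrite ?mul0r.
Qed.

Lemma GammaE m f g x : Gamma e w m f g x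
  = 2^-1 * \sum_y wt x y / m x * ((f y - f x) * (g y - g x)).
Proof.
rewrite /Gamma !laplacianE [f x * _]mulr_sumr [g x * _]mulr_sumr -!sumrB.
congr (_ * _).
by apply: eq_bigr => y _ /=; ring.
Qed.

(** With [f] for the differences to the value at [x] and [a = 1 / m], this is [2 m(x)] times
    [Gamma2 - th (Delta f)^2] at [x]. The sum over [z] runs over paths [x, v, z] of length two. *)
Definition sq2 x a f : R := \sum_v a v * \sum_z (wt x v * wt v z) *
    (2^-1 * (f z - 2 * f v) ^+ 2 - 2^-1 * f v ^+ 2)
  + a x * (- 2^-1 * deg x * (\sum_y wt x y * f y ^+ 2)
           + (1 - 2 * th) * (\sum_y wt x y * f y) ^+ 2).

Definition gsq x f : R := \sum_y wt x y * f y ^+ 2.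

(* The Bakry-Emery form at [x] is linear in the inverse vertex weight. *)
Lemma Gamma2_form m f x K : (forall v, m v != 0) ->
  2 * m x * (Gamma2 e w m f x - (th * laplacian e w m f x ^+ 2 + K * Gamma e w m f f x))
  = sq2 x (fun v => (m v)^-1) (fun z => f z - f x) - K * gsq x (fun z => f z - f x).
Proof.
move=> m0; pose h z := f z - f x.
have G2 y : Gamma e w m f f y = 2^-1 * (m y)^-1 * \sum_z wt y z * (h z - h y) ^+ 2.
  rewrite GammaE -mulrA; congr (_ * _); rewrite mulr_sumr; apply: eq_bigr => z _.
  by rewrite /h; ring.
have L y : laplacian e w m f y = (m y)^-1 * \sum_z wt y z * (h z - h y).
  rewrite laplacianE mulr_sumr; apply: eq_bigr => z _; by rewrite /h; ring.
have hx : h x = 0 by rewrite /h subrr.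
have Lx : laplacian e w m f x = (m x)^-1 * \sum_z wt x z * h z.
  by rewrite L; under eq_bigr do rewrite hx subr0.
have Gx : Gamma e w m f f x = 2^-1 * (m x)^-1 * gsq x h.
  by rewrite G2; under eq_bigr do rewrite hx subr0.
have LG : laplacian e w m (Gamma e w m f f) x
    = (m x)^-1 * (\sum_v wt x v * Gamma e w m f f v - deg x * Gamma e w m f f x).
  rewrite laplacianE /deg mulr_suml -sumrB mulr_sumr; apply: eq_bigr => y _; ring.
have GL : Gamma e w m (laplacian e w m f) f x = 2^-1 * (m x)^-1 *
    (\sum_v wt x v * (laplacian e w m f v * h v)
      - laplacian e w m f x * \sum_z wt x z * h z).
  rewrite GammaE -mulrA; congr (_ * _).
  rewrite [laplacian _ _ _ _ _ * _]mulr_sumr -sumrB mulr_sumr.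
  by apply: eq_bigr => y _; rewrite /h; ring.
(* Along each edge from [v] to [z] the square in [h z - h v] is completed. *)
have S1 : \sum_v wt x v * Gamma e w m f f v - \sum_v wt x v * (laplacian e w m f v * h v)
    = \sum_v (m v)^-1 * \sum_z (wt x v * wt v z) *
    (2^-1 * (h z - 2 * h v) ^+ 2 - 2^-1 * h v ^+ 2).
  rewrite -sumrB; apply: eq_bigr => v _; rewrite G2 L.
  transitivity ((m v)^-1 * (wt x v * (2^-1 * (\sum_z wt v z * (h z - h v) ^+ 2)
      - (\sum_z wt v z * (h z - h v)) * h v))); first ring.
  congr (_ * _); rewrite mulr_sumr mulr_suml -sumrB mulr_sumr.
  by apply: eq_bigr => z _; field.
rewrite /Gamma2 LG GL /sq2 -/h -S1 Gx Lx -/(gsq x h).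
by field.
Qed.

(** The coordinate form at [z] after [f] has been set to 0 at [x]; products of such forms give the
    matrices below. *)
Definition dm x z : V -> R := fun p => (z != x)%:R * delta z p.
Definition msk x f : V -> R := fun z => if z == x then 0 else f z.

Lemma dm_sum x z f : \sum_p dm x z p * f p = msk x f z.
Proof.
rewrite /dm /msk; under eq_bigr do rewrite -mulrA (mulrC (delta _ _)).
by rewrite -mulr_sumr sum_delta; case: eqP; rewrite ?mul0r ?mul1r.
Qed.

Lemma qf_sq (l f : V -> R) : qf (fun i j => l i * l j) f = (\sum_p l p * f p) ^+ 2.
Proof.
rewrite expr2 mulr_suml /qf /bil; apply: eq_bigr => i _.
rewrite /mv !mulr_sumr; apply: eq_bigr => j _; ring.
Qed.

Definition far x z := (z == x) || ~~ (e x z || [exists y, e x y && e y z]).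

Definition mN x v z : V -> V -> R := fun p q =>
  2^-1 * ((dm x z p - 2 * dm x v p) * (dm x z q - 2 * dm x v q))
  + - 2^-1 * (dm x v p * dm x v q).
Definition mW x : V -> V -> R := fun p q => \sum_y wt x y * (dm x y p * dm x y q).
Definition mL x : V -> V -> R := fun p q =>
  (\sum_y wt x y * dm x y p) * (\sum_y wt x y * dm x y q).
(* The form at [x] does not involve [f] at [x] (after masking) and outside the
   ball of radius 2; these squares make it definite without changing the
   curvature. *)
Definition mF x : V -> V -> R := fun p q =>
  \sum_z (far x z)%:R * (delta z p * delta z q).
(** The factors 1, here and in [mB], put the matrices in the shape of [qf_matlin]. *)
Definition mD x : V -> V -> R := fun p q =>
  1 * (- 2^-1 * deg x * mW x p q + (1 - 2 * th) * mL x p q) + 1 * mF x p q.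
Definition mB x v : V -> V -> R := fun p q =>
  1 * (\sum_z (wt x v * wt v z) * mN x v z p q) + (v == x)%:R * mD x p q.

Lemma qf_mW x f : qf (mW x) f = gsq x (msk x f).
Proof.
rewrite qf_sum_mat; apply: eq_bigr => y _.
by rewrite (qf_sq (dm x y)) dm_sum.
Qed.

Lemma qf_mN x v z f : qf (mN x v z) f
  = 2^-1 * (msk x f z - 2 * msk x f v) ^+ 2 - 2^-1 * msk x f v ^+ 2.
Proof.
rewrite qf_matlin (qf_sq (fun p => dm x z p - 2 * dm x v p)) (qf_sq (dm x v)).
rewrite dm_sum mulNr; congr (_ * _ ^+ 2 - _).
under eq_bigr do rewrite mulrBl; rewrite sumrB dm_sum; congr (_ - _).
by rewrite -dm_sum mulr_sumr; apply: eq_bigr => p _; ring.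
Qed.

Lemma qf_mL x f : qf (mL x) f = (\sum_y wt x y * msk x f y) ^+ 2.
Proof.
rewrite (qf_sq (fun p => \sum_y wt x y * dm x y p)); congr (_ ^+ 2).
under eq_bigr do rewrite mulr_suml; rewrite exchange_big; apply: eq_bigr => y _ /=.
by rewrite -dm_sum mulr_sumr; apply: eq_bigr => p _; ring.
Qed.

Lemma qf_mF x f : qf (mF x) f = \sum_z (far x z)%:R * f z ^+ 2.
Proof.
rewrite qf_sum_mat; apply: eq_bigr => z _; rewrite (qf_sq (delta z)).
by under eq_bigr do rewrite mulrC; rewrite sum_delta.
Qed.

Lemma lform_mB x a f : lform (mB x) a f
  = sq2 x a (msk x f) + a x * \sum_z (far x z)%:R * f z ^+ 2.
Proof.
rewrite /lform /sq2 -addrA -mulrDr.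
have qE v : a v * qf (mB x v) f = a v * (\sum_z (wt x v * wt v z) *
    (2^-1 * (msk x f z - 2 * msk x f v) ^+ 2 - 2^-1 * msk x f v ^+ 2))
    + a v * qf (mD x) f * delta x v.
  rewrite qf_matlin qf_sum_mat mul1r /delta mulrDr; congr (_ + _); last by ring.
  by congr (_ * _); apply: eq_bigr => z _; rewrite qf_mN.
under eq_bigr do rewrite qE; rewrite big_split sum_delta /=; congr (_ + _ * _).
by rewrite qf_matlin qf_matlin qf_mW qf_mL qf_mF !mul1r.
Qed.

Lemma wt_CS x f : (\sum_y wt x y * f y) ^+ 2 <= deg x * gsq x f.
Proof.
have H (s : R) : 0 <= deg x + 2 * s * (\sum_y wt x y * f y) + s ^+ 2 * gsq x f.
  have -> : deg x + 2 * s * (\sum_y wt x y * f y) + s ^+ 2 * gsq x f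
      = \sum_y wt x y * (1 + s * f y) ^+ 2.
    by rewrite /deg /gsq !mulr_sumr -!big_split; apply: eq_bigr => y _ /=; ring.
  by apply: sumr_ge0 => y _; rewrite mulr_ge0 ?wt_ge0 ?sqr_ge0.
exact: discriminant_le.
Qed.

Lemma gsq_ge0 x f : 0 <= gsq x f.
Proof. by apply: sumr_ge0 => y _; rewrite mulr_ge0 ?wt_ge0 ?sqr_ge0. Qed.

Lemma wt_le_gsq x y f : wt x y * f y ^+ 2 <= gsq x f.
Proof.
rewrite /gsq (bigD1 y)//= lerDl sumr_ge0// => z _.
by rewrite mulr_ge0 ?wt_ge0 ?sqr_ge0.
Qed.

Definition degree_part_bound x : R := 2^-1 * deg x + `|1 - 2 * th| * deg x.

Lemma mD_lower x f : \sum_z (far x z)%:R * f z ^+ 2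
    - degree_part_bound x * gsq x (msk x f) <= qf (mD x) f.
Proof.
rewrite qf_matlin qf_matlin qf_mW qf_mL qf_mF !mul1r /degree_part_bound.
set S := _ ^+ 2; have S0 : 0 <= S by exact: sqr_ge0.
have := wt_CS x (msk x f); rewrite -/S => h1.
have := ler_wpM2l (normr_ge0 (1 - 2 * th)) h1.
have : `|(1 - 2 * th) * S| <= `|1 - 2 * th| * S by rewrite normrM (ger0_norm S0).
by rewrite ler_norml => /andP[]; lra.
Qed.

(** Negative contributions to the form come only from neighbours of [x], where a multiple of [gsq]
    compensates them. Vertices at distance two are positive through the squares along paths, all
    remaining coordinates through [mF]. *)
Lemma pencil_graph x : (exists y, e x y) -> pencil (mB x) (mW x).
Proof.
move=> [y0 xy0]; have y0x : y0 != x by apply: contraTneq xy0 => ->; rewrite e_irr.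
have b0 : 0 <= degree_part_bound x.
  by rewrite addr_ge0 ?mulr_ge0 ?deg_ge0.
split.
- move=> v p q; rewrite /mB /mD /mW /mL /mF /mN; congr (_ * _ + _ * (_ * (_ + _) + _ * _)).
  + by apply: eq_bigr => z _; ring.
  + by congr (_ * _); apply: eq_bigr => z _; ring.
  + ring.
  + by apply: eq_bigr => z _; ring.
- split; first by move=> p q; apply: eq_bigr => z _; ring.
  by move=> f; rewrite qf_mW gsq_ge0.
- exists (2^-1 * (\sum_v deg v) + degree_part_bound x).
    by rewrite addr_ge0// mulr_ge0// sumr_ge0// => v _; exact: deg_ge0.
  move=> v f; rewrite qf_mW qf_matlin mul1r qf_sum_mat.
  have h0 := gsq_ge0 x (msk x f).
  have h1 : - (degree_part_bound x * gsq x (msk x f)) <= (v == x)%:R * qf (mD x) f.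
    have bg : 0 <= degree_part_bound x * gsq x (msk x f) by rewrite mulr_ge0.
    case: eqP => _; rewrite ?mul1r ?mul0r ?oppr_le0//.
    apply: le_trans (mD_lower x f); rewrite lerDr sumr_ge0// => z _.
    by rewrite mulr_ge0 ?sqr_ge0.
  (* Only the negative parts [- h v^2 / 2] of the squares are kept. *)
  have h2 : - (2^-1 * (\sum_v deg v) * gsq x (msk x f))
      <= \sum_z wt x v * wt v z * qf (mN x v z) f.
    apply: (@le_trans _ _ (\sum_z wt x v * wt v z * (- 2^-1 * msk x f v ^+ 2))).
      rewrite -mulr_suml -mulr_sumr -/(deg v).
      have k1 : deg v * (wt x v * msk x f v ^+ 2) <= deg v * gsq x (msk x f).
        by rewrite ler_wpM2l ?deg_ge0// wt_le_gsq.
      have k2 : deg v * gsq x (msk x f) <= (\sum_v deg v) * gsq x (msk x f).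
        rewrite ler_wpM2r// (bigD1 v)//= lerDl sumr_ge0// => u _; exact: deg_ge0.
      lra.
    apply: ler_sum => z _; rewrite qf_mN ler_wpM2l ?mulr_ge0 ?wt_ge0//.
    by have := sqr_ge0 (msk x f z - 2 * msk x f v); lra.
  lra.
- exists (delta y0); rewrite qf_mW; apply: lt_le_trans (wt_le_gsq x y0 _).
  by rewrite /msk (negbTE y0x) /delta eqxx expr1n mulr1 wt_gt0.
(* [k z] is the coefficient of [f z ^+ 2] that can be guaranteed. It is positive by [mF] if [z] is
   far or [x] itself, by [wt x z] for a neighbour, and by a path through some [v] at distance
   two. *)
move=> a a0; pose k z : R := (z != x)%:R * (4^-1 * (\sum_v a v * (wt x v * wt v z)) + wt x z)
  + a x * (far x z)%:R.
have s0 z : 0 <= \sum_v a v * (wt x v * wt v z).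
  by apply: sumr_ge0 => v _; rewrite !mulr_ge0 ?wt_ge0// ltW.
have k0 z : 0 < k z.
  have p1 : 0 <= (z != x)%:R * (4^-1 * (\sum_v a v * (wt x v * wt v z)) + wt x z).
    by rewrite mulr_ge0// addr_ge0 ?wt_ge0// mulr_ge0.
  rewrite /k; case: (boolP (far x z)) => [_|]; first by rewrite mulr1 ltr_wpDl.
  rewrite /far negb_or negbK => /andP[zx H]; rewrite mulr0 addr0 zx mul1r.
  case/orP: H => [xz|/existsP[y /andP[xy yz]]].
    by rewrite ltr_wpDl ?mulr_ge0// wt_gt0.
  rewrite ltr_wpDr ?wt_ge0// mulr_gt0// (bigD1 y)//= ltr_wpDr//.
    by apply: sumr_ge0 => v _; rewrite !mulr_ge0 ?wt_ge0// ltW.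
  by rewrite !mulr_gt0// wt_gt0.
(* The [5 / 2] is the loss at neighbours in [L3], the second summand the loss in [mD_lower]; the
   extra 1 in [C1 + 1] supplies the terms [wt x z] of [k]. *)
pose C1 := 5 / 2 * (\sum_v a v * deg v) + a x * degree_part_bound x.
have C10 : 0 <= C1.
  rewrite addr_ge0//; last by rewrite mulr_ge0// ltW.
  by rewrite mulr_ge0// sumr_ge0// => v _; rewrite mulr_ge0 ?deg_ge0// ltW.
exists (\big[Num.min/1]_z k z), (C1 + 1); split.
- by apply: lt_bigmin => // z _.
- by rewrite ltr_wpDl.
move=> f; rewrite qf_mW; set h := msk x f.
have hz z : h z ^+ 2 = (z != x)%:R * f z ^+ 2.
  by rewrite /h /msk; case: eqP => _ /=; rewrite ?mul0r ?mul1r ?expr0n.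
have L1 : lform (mB x) a f = \sum_v a v * (\sum_z (wt x v * wt v z) *
    (2^-1 * (h z - 2 * h v) ^+ 2 - 2^-1 * h v ^+ 2)) + a x * qf (mD x) f.
  rewrite lform_mB /sq2 -/h -addrA -mulrDr; congr (_ + _ * _).
  by rewrite qf_matlin qf_matlin qf_mW qf_mL qf_mF !mul1r.
have L2 := ler_wpM2l (ltW (a0 x)) (mD_lower x f); rewrite -/h in L2.
(* Each bracket is at least [h z^2 / 4 - 5 h v^2 / 2], the difference being the square of
   [h z / 2 - 2 h v]. *)
have L3 : \sum_z 4^-1 * (\sum_v a v * (wt x v * wt v z)) * h z ^+ 2
    - 5 / 2 * (\sum_v a v * deg v) * gsq x h
    <= \sum_v a v * (\sum_z (wt x v * wt v z) *
    (2^-1 * (h z - 2 * h v) ^+ 2 - 2^-1 * h v ^+ 2)).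
  apply: (@le_trans _ _ (\sum_v a v * (\sum_z (wt x v * wt v z) *
    (4^-1 * h z ^+ 2 - 5 / 2 * h v ^+ 2)))); last first.
    apply: ler_sum => v _; rewrite ler_wpM2l ?(ltW (a0 v))//.
    apply: ler_sum => z _; rewrite ler_wpM2l ?mulr_ge0 ?wt_ge0//.
    by have := sqr_ge0 (2^-1 * h z - 2 * h v); lra.
  have -> : \sum_v a v * (\sum_z (wt x v * wt v z) * (4^-1 * h z ^+ 2 - 5 / 2 * h v ^+ 2))
    = \sum_z 4^-1 * (\sum_v a v * (wt x v * wt v z)) * h z ^+ 2
      - 5 / 2 * \sum_v a v * deg v * (wt x v * h v ^+ 2).
    have -> : \sum_z 4^-1 * (\sum_v a v * (wt x v * wt v z)) * h z ^+ 2
        = \sum_v a v * \sum_z (wt x v * wt v z) * (4^-1 * h z ^+ 2).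
      under [RHS]eq_bigr do rewrite mulr_sumr.
      rewrite exchange_big; apply: eq_bigr => z _ /=.
      by rewrite mulrAC mulr_sumr; apply: eq_bigr => v _; ring.
    rewrite mulr_sumr -sumrB; apply: eq_bigr => v _.
    transitivity (a v * (\sum_z (wt x v * wt v z) * (4^-1 * h z ^+ 2)
      - (\sum_z wt v z) * (5 / 2 * wt x v * h v ^+ 2))).
      congr (_ * _); rewrite mulr_suml -sumrB; apply: eq_bigr => z _; ring.
    by rewrite -/(deg v); ring.
  have : \sum_v a v * deg v * (wt x v * h v ^+ 2) <= (\sum_v a v * deg v) * gsq x h.
    rewrite mulr_suml; apply: ler_sum => v _.
    by rewrite ler_wpM2l ?mulr_ge0 ?deg_ge0 ?(ltW (a0 v))// wt_le_gsq.
  lra.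
have L4 : (\big[Num.min/1]_z k z) * sqn f <= \sum_z k z * f z ^+ 2.
  rewrite /sqn mulr_sumr; apply: ler_sum => z _.
  by rewrite ler_wpM2r ?sqr_ge0//; exact: bigmin_le_cond.
have L5 : \sum_z k z * f z ^+ 2
    = \sum_z 4^-1 * (\sum_v a v * (wt x v * wt v z)) * h z ^+ 2 + gsq x h
      + a x * \sum_z (far x z)%:R * f z ^+ 2.
  rewrite /gsq mulr_sumr -!big_split; apply: eq_bigr => z _ /=.
  by rewrite hz /k; ring.
by rewrite /C1; lra.
Qed.

(** The squares added by [mF] do not alter the curvature: they are nonnegative, which settles one
    direction, and vanish on functions cut off outside the ball of radius 2, which settles the
    other. *)
Lemma Ric_kap (n : \bar R) m x : th = fine (n^-1)%E -> (forall v, 0 < m v) ->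
  (exists y, e x y) -> Ric e w n m x = kap (mB x) (mW x) (fun v => (m v)^-1).
Proof.
move=> thE m0 ex; have P := pencil_graph ex; apply: RicE.
have m0' v : m v != 0 by rewrite gt_eqF.
have a0 v : 0 <= (m v)^-1 by rewrite invr_ge0 ltW.
have mx2 : 0 < 2 * m x by rewrite mulr_gt0.
have cdE K : curvature_dim e w n m x K <->
    forall f, K * qf (mW x) f <= lform (mB x) (fun v => (m v)^-1) f.
  split=> H f.
    have := H (msk x f); rewrite -thE -subr_ge0 -(pmulr_rge0 _ mx2) Gamma2_form//.
    have -> : (fun z => msk x f z - msk x f x) = msk x f.
      by apply/funext => z; rewrite {2}/msk eqxx subr0.
    rewrite subr_ge0 qf_mW lform_mB => /le_trans; apply.
    by rewrite lerDl mulr_ge0// sumr_ge0// => z _; rewrite mulr_ge0 ?sqr_ge0.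
  (* [f - f x] cut off on [far x]: the added squares vanish, while [sq2] and [gsq] see only paths of
     length at most two from [x]. *)
  pose g z := if far x z then 0 else f z - f x.
  rewrite -thE -subr_ge0 -(pmulr_rge0 _ mx2) Gamma2_form// subr_ge0.
  have := H g; rewrite qf_mW lform_mB [X in _ + _ * X]big1 ?mulr0 ?addr0; last first.
    by move=> z _; rewrite /g; case: ifP => _; rewrite ?mul0r ?expr0n ?mulr0.
  have gE z : (z == x) || (e x z || [exists y, e x y && e y z]) ->
      msk x g z = f z - f x.
    rewrite /msk /g /far; have [->|_ /= ->] := eqVneq z x; first by rewrite subrr.
    by [].
  have wE (F F' : V -> R) y : (e x y -> F y = F' y) -> wt x y * F y = wt x y * F' y.
    rewrite /wt; case: (e x y) => H'; last by rewrite !mul0r.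
    by rewrite H'.
  have g1 y : e x y -> msk x g y = f y - f x by move=> xy; rewrite gE// xy !orbT.
  have -> : gsq x (msk x g) = gsq x (fun z => f z - f x).
    apply: eq_bigr => y _; apply: (wE (fun y => msk x g y ^+ 2)
      (fun y => (f y - f x) ^+ 2)) => xy; by rewrite g1.
  move/le_trans; apply; rewrite le_eqVlt; apply/orP; left; apply/eqP.
  rewrite /sq2; congr (_ + _ * (_ * _ + _ * _ ^+ 2)).
  - apply: eq_bigr => v _; congr (_ * _); apply: eq_bigr => z _.
    rewrite /wt; have [xv|_] := boolP (e x v); last by rewrite !mul0r.
    have [vz|_] := boolP (e v z); last by rewrite !(mul0r, mulr0).
    rewrite (g1 v)// (gE z)//; apply/orP; right; apply/orP; right.
    by apply/existsP; exists v; rewrite xv.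
  - apply: eq_bigr => y _; apply: (wE (fun y => msk x g y ^+ 2)
      (fun y => (f y - f x) ^+ 2)) => xy; by rewrite g1.
  apply: eq_bigr => y _; exact: (wE (msk x g) (fun y => f y - f x) y (g1 y)).
have [k1 k2] := kapP P a0; split; first exact/cdE.
move=> L /cdE HL; rewrite leNgt; apply/negP => /k2 [f].
by rewrite ltNge HL.
Qed.

End GraphPencil.

(** * The normalized flow as a system linear in the curvatures *)

Section Flow.
Context {R : realType} {V : finType}.
Implicit Types (x y v : V) (t : R).

(** The matrix of averaging minus the identity, the instance of [phi] for the normalized flow. *)
Definition flow_coef x y : R := #|V|%:R^-1 - (y == x)%:R.

Lemma flow_coefE (k : V -> R) x :
  \sum_y flow_coef x y * k y = - k x + #|V|%:R^-1 * \sum_y k y.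
Proof.
rewrite addrC mulr_sumr -(sum_delta k x) -sumrB; apply: eq_bigr => y _.
by rewrite /flow_coef /delta; ring.
Qed.

Lemma inv_box (lo hi a : R) : 0 < lo -> lo <= a <= hi -> hi^-1 <= a^-1 <= lo^-1.
Proof.
move=> lo0 /andP[la ah]; have a0 := lt_le_trans lo0 la.
have hi0 := lt_le_trans a0 ah.
by apply/andP; split; rewrite lef_pV2.
Qed.

Lemma inv_lip (lo a b : R) : 0 < lo -> lo <= a -> lo <= b ->
  `|a^-1 - b^-1| <= `|a - b| / lo ^+ 2.
Proof.
move=> lo0 la lb; have a0 := lt_le_trans lo0 la; have b0 := lt_le_trans lo0 lb.
have -> : a^-1 - b^-1 = (b - a) / (a * b) by field; rewrite !gt_eqF.
rewrite normrM distrC ler_wpM2l// normfV normrM !gtr0_norm//.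
by rewrite lef_pV2 ?posrE ?mulr_gt0 ?exprn_gt0// expr2 ler_pM// ltW.
Qed.

Lemma drift_lip (B : V -> V -> V -> V -> R) (G : V -> V -> V -> R)
    (phi : V -> V -> R) (lo hi : R) :
  (forall x, pencil (B x) (G x)) -> 0 < lo -> lo <= hi ->
  exists2 L : R, 0 <= L &
    forall (a b : V -> R) d, 0 <= d -> (forall v, lo <= a v <= hi) ->
      (forall v, lo <= b v <= hi) -> (forall v, `|a v - b v| <= d) ->
      forall x, `|\sum_y phi x y * kap (B y) (G y) (fun v => (a v)^-1)
        - \sum_y phi x y * kap (B y) (G y) (fun v => (b v)^-1)| <= L * d.
Proof.
move=> P lo0 lohi; have hi0 := lt_le_trans lo0 lohi.
have vhi0 : 0 < hi^-1 by rewrite invr_gt0.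
have vlohi : hi^-1 <= lo^-1 by rewrite lef_pV2.
have /choice[L HL] : forall y, exists L : R, 0 <= L /\ forall a b d, 0 <= d ->
    (forall v, hi^-1 <= a v <= lo^-1) -> (forall v, hi^-1 <= b v <= lo^-1) ->
    (forall v, `|a v - b v| <= d) ->
    `|kap (B y) (G y) a - kap (B y) (G y) b| <= L * d.
  by move=> y; have [L] := kap_lip (P y) vhi0 vlohi; exists L.
have L0 y : 0 <= L y by have [] := HL y.
have S0 x : 0 <= \sum_y `|phi x y| * L y.
  by apply: sumr_ge0 => y _; rewrite mulr_ge0.
exists ((\sum_x \sum_y `|phi x y| * L y) / lo ^+ 2).
  by rewrite divr_ge0 ?exprn_ge0 ?(ltW lo0)// sumr_ge0.
move=> a b d d0 Ha Hb ab x; rewrite -sumrB.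
have d2 : 0 <= d / lo ^+ 2 by rewrite divr_ge0 ?exprn_ge0 ?(ltW lo0).
apply: (@le_trans _ _ ((\sum_y `|phi x y| * L y) * (d / lo ^+ 2))).
  rewrite (le_trans (ler_norm_sum _ _ _))// mulr_suml; apply: ler_sum => y _.
  rewrite -mulrBr normrM -mulrA ler_wpM2l//; have [_] := HL y; apply=> // v.
  - exact: inv_box.
  - exact: inv_box.
  have /andP[la _] := Ha v; have /andP[lb _] := Hb v.
  apply: (le_trans (inv_lip lo0 la lb)).
  by rewrite ler_wpM2r ?ab// invr_ge0 exprn_ge0// ltW.
by rewrite -mulrA (mulrC _^-1) ler_wpM2r// [leRHS](bigD1 x)//= lerDl sumr_ge0.
Qed.

Lemma convlt_iter_dfps (T : R) k (f : fps R) : convlt T f ->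
  convlt T (iter k (@dfps R) f).
Proof. by move=> cf; elim: k => //= k; exact: convlt_dfps. Qed.

Lemma smooth_on_ev (T : R) (f : fps R) : convlt T f ->
  smooth_on [set` `[0, T[] (ev f).
Proof.
move=> cf; exists (fun k => ev (iter k (@dfps R) f)); split=> // k t /=.
rewrite in_itv /= => /andP[t0 tT]; apply: (@is_derive_within_sub _ _ setT) => //.
apply/is_deriveP; apply: (@is_derive_ev _ T); first by rewrite ger0_norm.
exact: convlt_iter_dfps.
Qed.

Lemma one_vertex (e : rel V) x0 : (forall x y, connect e x y) ->
  ~ (exists y, e x0 y) -> forall x, x = x0.
Proof.
move=> conn no x; have /connectP[[|y p] /=] := conn x0 x; first by [].
by move=> /andP[xy _]; case: no; exists y.
Qed.

End Flow.

Theorem theorem2p5 (R : realType) (V : finType) (e : rel V)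
    (e_sym : symmetric e) (e_irr : irreflexive e)
    (e_conn : forall x y : V, connect e x y)
    (w : V -> V -> R)
    (w_pos : forall x y : V, e x y -> 0 < w x y)
    (w_sym : forall x y : V, e x y -> w x y = w y x)
    (n : \bar R) (n_pos : (0 < n)%E)
    (m0 : V -> R) (m0_pos : forall x : V, 0 < m0 x) :
  exists2 T : R, 0 < T &
    exists m : R -> V -> R,
      normalized_Ricci_flow e w n m0 T m /\
      (forall m' : R -> V -> R, normalized_Ricci_flow e w n m0 T m' ->
         forall (t : R) (x : V), t \in `[0, T[ -> m' t x = m t x).
Proof.
(* An isolated vertex of a connected graph is the whole graph. There [Gamma] vanishes and no pencil
   exists, but the right-hand side is 0 whatever value [Ric] has, so the flow is constant. *)
have [nb|/existsNP[x0 /(one_vertex e_conn) V1]] :=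
    pselect (forall x, exists y, e x y); last first.
  have rhs0 (k : V -> R) x : - k x + #|V|%:R^-1 * \sum_y k y = 0.
    rewrite (eq_bigr (fun=> k x)) => [|y _]; last by rewrite (V1 y) (V1 x).
    rewrite sumr_const -[in X in _ + X](mulr_natl (k x)) mulrA mulVf.
      by rewrite mul1r addNr.
    by rewrite pnatr_eq0 -lt0n; apply/card_gt0P; exists x0.
  have dcst (c t : R) : is_derive_within [set` `[0, (1 : R)[] (fun=> c) t 0.
    apply: (@is_derive_within_sub _ _ setT) => //; exact/is_deriveP.
  exists 1 => //; exists (fun _ x => m0 x); split.
    split=> // [x|t x _]; last by rewrite rhs0.
    exists (fun k _ => if k is 0%N then m0 x else 0); split=> // -[|k] t _ /=;
      exact: dcst.
  move=> m' [mp _ dm m0'] t x tT.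
  apply: (@flow_unique _ _ (fun _ _ => 0) 1 m' (fun _ x => m0 x)) => //.
  - by move=> lo hi _ _; exists 0 => // a b d *; rewrite subrr normr0 mul0r.
  by move=> s y sT; have := dm s y sT; rewrite rhs0.
pose th := fine (n^-1)%E.
have P x := pencil_graph th e_irr w_pos (nb x).
have RicE m x : (forall v, 0 < m v) -> Ric e w n m x
    = kap (mB e w th x) (mW e w x) (fun v => (m v)^-1).
  by move=> mp; exact: (Ric_kap e_irr w_pos).
have rhsE m x : (forall v, 0 < m v) ->
    - Ric e w n m x + #|V|%:R^-1 * \sum_y Ric e w n m y
    = \sum_y flow_coef x y * kap (mB e w th y) (mW e w y) (fun v => (m v)^-1).
  move=> mp; rewrite flow_coefE RicE//; congr (_ + _ * _).
  by apply: eq_bigr => y _; rewrite RicE.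
have [T T0 [m [cm m0E mp dm]]] := analytic_solution flow_coef P m0_pos.
have inT t : t \in `[0, T[ -> 0 <= t < T by rewrite in_itv.
have pos t x : t \in `[0, T[ -> 0 < ev (m x) t by move=> /inT; exact: mp.
have der t x : t \in `[0, T[ -> is_derive_within [set` `[0, T[] (ev (m x)) t
    (\sum_y flow_coef x y *
       kap (mB e w th y) (mW e w y) (fun v => (ev (m v) t)^-1)).
  move=> /inT tT; have /andP[t0 tT'] := tT; rewrite -dm//.
  apply: (@is_derive_within_sub _ _ setT) => //; apply/is_deriveP.
  by apply: (@is_derive_ev _ T) => //; rewrite ger0_norm.
exists T => //; exists (fun t x => ev (m x) t); split.
  split=> // [x|t x tT|x].
  - exact: smooth_on_ev.
  - by rewrite rhsE => [|v]; [exact: der|exact: pos].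
  by rewrite ev0.
move=> m' [m'p _ dm' m'0].
apply: (@flow_unique _ _ (fun a x => \sum_y flow_coef x y *
   kap (mB e w th y) (mW e w y) (fun v => (a v)^-1)) T m') => //.
- by move=> lo hi; exact: drift_lip.
- by move=> t x tT; rewrite -rhsE => [|v]; [exact: dm'|exact: m'p].
by move=> x; rewrite m'0 ev0.
Qed.
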